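(* Let $T>0$, $0<\theta_1<\theta_S<\theta_2<2\pi$, $c_1,c_2,c_S>0$, let $g:[0,T]\to[0,+\infty[$ be Lipschitz continuous and $K=\int_0^Tg(s)\,ds$. Let $\mathcal K\subset\mathbb R^4\times\mathbb R^4$ be a nonempty compact set of parameters $(\alpha,\beta)$, $\alpha=(\alpha_{1,1},\alpha_{0,1},\alpha_{1,0},\alpha_{0,0})$, $\beta=(\beta_{1,1},\beta_{0,1},\beta_{1,0},\beta_{0,0})$, such that for all $(\alpha,\beta)\in\mathcal K$ and all $(w_1,w_2)\in\{0,1\}^2$ the congestion cost $\mathcal F^{w_1,w_2}(r)=\alpha_{w_1,w_2}r+\beta_{w_1,w_2}$ is nonnegative for $r\in[0,K]$. Let $X$ be as in the context, let $\overline\rho\in X$ be a fixed reference, and for $(\alpha,\beta)\in\mathcal K$ let $\chi_{\alpha,\beta}\subset X$ be the set of mean field equilibria (defined in the context) corresponding to the congestion costs $\mathcal F^{w_1,w_2}(\rho)=\alpha_{w_1,w_2}\rho^{w_1,w_2}(s)+\beta_{w_1,w_2}$. Put $$\|\rho-\overline\rho\|_X=\max_{w_1,w_2\in\{0,1\}}\max_{t\in[0,T]}|\rho^{w_1,w_2}(t)-\overline\rho^{w_1,w_2}(t)|,\qquad \mathcal E(\alpha,\beta)=\inf_{\rho\in\chi_{\alpha,\beta}}\|\rho-\overline\rho\|_X .$$ Then there exists an optimal pair for the problem $\inf_{(\alpha,\beta)\in\mathcal K}\mathcal E(\alpha,\beta)$, i.e. there is $(\tilde\alpha,\tilde\beta)\in\mathcal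 K$ with $\mathcal E(\tilde\alpha,\tilde\beta)=\inf_{(\alpha,\beta)\in\mathcal K}\mathcal E(\alpha,\beta)$.
   Context: **Model.** Agents move on a circle (positions modulo $2\pi$) with station at $\theta_S$ and attractions $P_1,P_2$ at $\theta_1,\theta_2$, where $0<\theta_1<\theta_S<\theta_2<2\pi$. Each agent carries a label $(w_1,w_2)\in\{0,1\}^2$, with $w_i=1$ until $P_i$ is reached and $w_i=0$ afterwards; the branch $B_{w_1,w_2}$ is the set of states with label $(w_1,w_2)$. Agents enter at $(\theta_S,1,1)$ with flow $g$ (agents per unit time), the network being initially empty. An agent moves by $\theta'=u$ and minimizes $\int_t^T(\frac{u^2}{2}+\text{congestion cost})ds+c_1w_1(T)+c_2w_2(T)+c_S\,\xi$, where $\xi=0$ if $\theta(T)=\theta_S$ and $\xi=1$ otherwise; the congestion cost paid at time $s$ in branch $B_{w_1,w_2}$ is $\mathcal F^{w_1,w_2}(\rho^{w_1,w_2}(s))$. **Space $X$.** $X=\{f:[0,T]\to\mathbb R_+:\ f\text{ Lipschitz with constant}\le\tilde L,\ |f|\le K\}^4$; elements are written $\rho=(\rho^{1,1},\rho^{0,1},\rho^{1,0},\rho^{0,0})$, and $\rho^{w_1,w_2}(t)$ represents the total mass of agents in $B_{w_1,w_2}$ at time $t$. Here $\tilde L$ is a fixed constant depending only on the data (including $\mathcal K$), a common Lipschitz constant for all possible mass functions of the model. Convention: $\inf\emptyset=+\infty$. **Value function at the significant states, for given $\rho\in X$ and given $\mathcal F^{w_1,w_2}$.** Under integrals in $ds$,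 $\mathcal F^{w_1,w_2}$ stands for $\mathcal F^{w_1,w_2}(\rho^{w_1,w_2}(s))$. Put $d_i=\min\{|\theta_S-\theta_i|,2\pi-|\theta_S-\theta_i|\}$, $d_{12}=\min\{\theta_2-\theta_1,2\pi-(\theta_2-\theta_1)\}$. A positive number divided by $0$ is $+\infty$. For $t\in[0,T]$ the value function satisfies: - $V(\theta_i,t,0,0)=\min\{c_S,\ \frac{d_i^2}{2(T-t)}\}+\int_t^T\mathcal F^{0,0}ds$, $i=1,2$. The two options are: (1) stay at $\theta_i$ forever; (2) go to $\theta_S$, arriving at $T$. - $V(\theta_1,t,0,1)$ is the minimum of three options: (1) stay: $c_2+c_S+\int_t^T\mathcal F^{0,1}ds$; (2) go to $\theta_S$, arriving at $T$: $c_2+\frac{(\theta_S-\theta_1)^2}{2(T-t)}+\int_t^T\mathcal F^{0,1}ds$; (3) go to $\theta_2$: $\inf_{\tau\in]t,T]}\{\frac{d_{12}^2}{2(\tau-t)}+\int_t^\tau\mathcal F^{0,1}ds+V(\theta_2,\tau,0,0)\}$. - $V(\theta_2,t,1,0)$ is the minimum of three options: (1) stay: $c_1+c_S+\int_t^T\mathcal F^{1,0}ds$; (2) go to $\theta_S$, arriving at $T$: $c_1+\frac{(\theta_S-\theta_2)^2}{2(T-t)}+\int_t^T\mathcal F^{1,0}ds$; (3) go to $\theta_1$: $\inf_{\tau\in]t,T]}\{\frac{d_{12}^2}{2(\tau-t)}+\int_t^\tau\mathcal F^{1,0}ds+V(\theta_1,\tau,0,0)\}$. - $V(\theta_S,t,1,1)$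 is the minimum of three options: (1) stay: $c_1+c_2+\int_t^T\mathcal F^{1,1}ds$; (2) go to $\theta_1$: $\inf_{\tau\in]t,T]}\{\frac{(\theta_1-\theta_S)^2}{2(\tau-t)}+\int_t^\tau\mathcal F^{1,1}ds+V(\theta_1,\tau,0,1)\}$; (3) go to $\theta_2$: $\inf_{\eta\in]t,T]}\{\frac{(\theta_2-\theta_S)^2}{2(\eta-t)}+\int_t^\eta\mathcal F^{1,1}ds+V(\theta_2,\eta,1,0)\}$. Each option corresponds to a constant-speed control kept until the agent leaves the branch. Option $i$ is *optimal* at a significant state at time $t$ if it realizes the corresponding minimum. For an option going to an attraction, an *optimal arrival time* at entering time $t$ is a minimizer $\tau$ (or $\eta$) of the corresponding infimum. **Split functions.** A split function associated to $\rho$ is a vector $\lambda\in L^\infty(0,T)^{13}$ with components $\lambda_i^{(\theta_S,1,1)},\lambda_i^{(\theta_1,0,1)},\lambda_i^{(\theta_2,1,0)}$ ($i=1,2,3$) and $\lambda_i^{(\theta_1,0,0)},\lambda_i^{(\theta_2,0,0)}$ ($i=1,2$), such that for a.e. $s\in[0,T]$: every component is $\ge0$; a component is $0$ at $s$ if the corresponding option $i$ is not optimal at that significant state at time $s$; and for each significant state the components sum to $1$. **Flows and the multifunction $\psi$.** Given $\rho\in X$ and a split function $\lambda$ associated to $\rho$, agents entering a significant state at time $s$ split among the options in fractions $\lambda_i(s)$ and each fraction uses the corresponding optimal control. This generates nonnegative flow densities on $[0,T]$: $g_{0,1}$ (entering $(\theta_1,0,1)$), $g_{1,0}$ (entering $(\theta_2,1,0)$),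 $g_{1,2}$ (entering $(\theta_2,0,0)$), $g_{2,1}$ (entering $(\theta_1,0,0)$), characterized for all $t\in[0,T]$ by $$\int_0^tg_{0,1}=\int_{\{s:\bar\tau_{S1}(s)<t\}}\lambda_2^{(\theta_S,1,1)}g\,ds,\qquad \int_0^tg_{1,0}=\int_{\{s:\bar\tau_{S2}(s)<t\}}\lambda_3^{(\theta_S,1,1)}g\,ds,$$ $$\int_0^tg_{1,2}=\int_{\{s:\bar\tau_{12}(s)<t\}}\lambda_3^{(\theta_1,0,1)}g_{0,1}\,ds,\qquad \int_0^tg_{2,1}=\int_{\{s:\bar\tau_{21}(s)<t\}}\lambda_3^{(\theta_2,1,0)}g_{1,0}\,ds,$$ where $\bar\tau_{S1},\bar\tau_{S2},\bar\tau_{12},\bar\tau_{21}$ are (measurable selections of) the optimal arrival times for, respectively, option (2) and option (3) at $(\theta_S,1,1)$, option (3) at $(\theta_1,0,1)$, option (3) at $(\theta_2,1,0)$. The generated total mass is $\rho'=(\rho'^{1,1},\rho'^{0,1},\rho'^{1,0},\rho'^{0,0})$ with $$\rho'^{1,1}(t)=\int_0^t(g-g_{0,1}-g_{1,0}),\quad \rho'^{0,1}(t)=\int_0^t(g_{0,1}-g_{1,2}),\quad \rho'^{1,0}(t)=\int_0^t(g_{1,0}-g_{2,1}),\quad \rho'^{0,0}(t)=\int_0^t(g_{1,2}+g_{2,1}).$$ $\psi(\rho)$ is the set of all $\rho'\in X$ generated in this way as $\lambda$ ranges over all split functions associated to $\rho$. A *mean field equilibrium* is a $\rho\in X$ with $\rho\in\psi(\rho)$.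 *)

(* Defs.v *)
From HB Require Import structures.
From mathcomp Require Export all_boot all_order all_algebra.
From mathcomp Require Export all_classical all_reals all_analysis.

Set Implicit Arguments.
Unset Strict Implicit.
Unset Printing Implicit Defensive.

Export Order.TTheory GRing.Theory Num.Theory.
Export numFieldNormedType.Exports.

Local Open Scope classical_set_scope.
Local Open Scope ring_scope.

(* An element rho of X, and a family of congestion costs, are indexed by the
   label (w1, w2) with true for 1 and false for 0: rho false true is
   rho^{0,1}.  Functions on [0, T] are represented by functions on R whose
   values outside [0, T] are irrelevant. *)
Definition by_label (S : Type) := bool -> bool -> S.

(* The coordinates of R^4 are ordered (1,1), (0,1), (1,0), (0,0). *)
Definition coord (w1 w2 : bool) : 'I_4 :=
  match w1, w2 with
  | true, true => @Ordinal 4 0 isT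
  | false, true => @Ordinal 4 1 isT
  | true, false => @Ordinal 4 2 isT
  | false, false => @Ordinal 4 3 isT
  end.

Definition affine_cost (R : realType) (ab : 'rV[R]_4 * 'rV[R]_4) :
    by_label (R -> R) :=
  fun w1 w2 r => ab.1 ord0 (coord w1 w2) * r + ab.2 ord0 (coord w1 w2).

Definition essentially_bounded (R : realType) (D : set R) (f : R -> R) : Prop :=
  exists M : R, {ae @lebesgue_measure R, forall s, D s -> `|f s| <= M}.

(* thS, th1, th2 are the positions of the station and of the two attractions;
   L is the Lipschitz constant in the definition of the space X. *)
Section TouristFlow.
Variables (R : realType) (T thS th1 th2 c1 c2 cS : R) (g : R -> R) (L : R).

Local Notation mu := (@lebesgue_measure R).

Definition entered_mass : R := \int[mu]_(s in `[0, T]) g s.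

Definition mass_space : set (by_label (R -> R)) :=
  [set rho : by_label (R -> R) | forall w1 w2 : bool,
    [/\ forall t, t \in `[0, T] -> 0 <= rho w1 w2 t,
        L.-lipschitz_(`[0, T]) (rho w1 w2) &
        forall t, t \in `[0, T] -> `|rho w1 w2 t| <= entered_mass] ].

Definition station_dist (th : R) : R :=
  Num.min `|thS - th| (2 * pi - `|thS - th|).

Definition attraction_dist : R := Num.min (th2 - th1) (2 * pi - (th2 - th1)).

Section Control.
Variables (F : by_label (R -> R)) (rho : by_label (R -> R)).

Local Open Scope ereal_scope.

Definition congestion (w1 w2 : bool) (a b : R) : \bar R :=
  \int[mu]_(s in `[a, b]) (F w1 w2 (rho w1 w2 s))%:E.

(* Kinetic cost of covering the distance D in time dt at constant speed; it is
   +oo for D > 0 and dt = 0 because 0^-1 = +oo in \bar R. *)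
Definition kinetic (D dt : R) : \bar R := (D ^+ 2)%:E / (2 * dt)%:E.

Definition transit_cost (w1 w2 : bool) (D : R) (W : R -> \bar R) (t tau : R) :
    \bar R :=
  kinetic D (tau - t) + congestion w1 w2 t tau + W tau.

Definition best_transit (w1 w2 : bool) (D : R) (W : R -> \bar R) (t : R) :
    \bar R :=
  ereal_inf [set transit_cost w1 w2 D W t tau | tau in `]t, T]].

Definition optimal_arrival (w1 w2 : bool) (D : R) (W : R -> \bar R)
    (t tau : R) : Prop :=
  tau \in `]t, T] /\ transit_cost w1 w2 D W t tau = best_transit w1 w2 D W t.

Definition best_option (n : nat) (o : n.-tuple (\bar R)) : \bar R :=
  \big[Order.min/+oo]_(x <- o) x.

(* Options are indexed from 0: the i-th option has index i - 1. *)
Definition options_00 (th t : R) : 2.-tuple (\bar R) :=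
  [tuple cS%:E; kinetic (station_dist th) (T - t)].

Definition V_00 (th t : R) : \bar R :=
  best_option (options_00 th t) + congestion false false t T.

Definition options_01 (t : R) : 3.-tuple (\bar R) :=
  [tuple c2%:E + cS%:E + congestion false true t T;
         c2%:E + kinetic (thS - th1) (T - t) + congestion false true t T;
         best_transit false true attraction_dist (V_00 th2) t].

Definition V_01 (t : R) : \bar R := best_option (options_01 t).

Definition options_10 (t : R) : 3.-tuple (\bar R) :=
  [tuple c1%:E + cS%:E + congestion true false t T;
         c1%:E + kinetic (thS - th2) (T - t) + congestion true false t T;
         best_transit true false attraction_dist (V_00 th1) t].

Definition V_10 (t : R) : \bar R := best_option (options_10 t).

Definition options_11 (t : R) : 3.-tuple (\bar R) :=
  [tuple c1%:E + c2%:E + congestion true true t T;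
         best_transit true true (th1 - thS) V_01 t;
         best_transit true true (th2 - thS) V_10 t].

Local Close Scope ereal_scope.

Definition split_at (n : nat) (options : R -> n.-tuple (\bar R))
    (lambda : 'I_n -> R -> R) : Prop :=
  (forall i, measurable_fun `[0, T] (lambda i) /\
             essentially_bounded `[0, T] (lambda i)) /\
  {ae mu, forall s, s \in `[0, T] ->
    [/\ forall i, 0 <= lambda i s,
        forall i, tnth (options s) i <> best_option (options s) ->
                  lambda i s = 0 &
        \sum_(i < n) lambda i s = 1] }.

(* split_S11, split_101, split_210, split_100, split_200 are the components at
   (th_S,1,1), (th_1,0,1), (th_2,1,0), (th_1,0,0), (th_2,0,0). *)
Record split_components : Type := SplitComponents {
  split_S11 : 'I_3 -> R -> R;
  split_101 : 'I_3 -> R -> R;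
  split_210 : 'I_3 -> R -> R;
  split_100 : 'I_2 -> R -> R;
  split_200 : 'I_2 -> R -> R }.

Definition split_function (lambda : split_components) : Prop :=
  [/\ split_at options_11 (split_S11 lambda),
      split_at options_01 (split_101 lambda),
      split_at options_10 (split_210 lambda),
      split_at (options_00 th1) (split_100 lambda) &
      split_at (options_00 th2) (split_200 lambda)].

(* No arrival time exists for an agent entering at time T, since ]T, T] is
   empty, so selections are defined on [0, T[. *)
Definition arrival_selection (w1 w2 : bool) (D : R) (W : R -> \bar R)
    (tau : R -> R) : Prop :=
  measurable_fun `[0, T[ tau /\
  forall s, s \in `[0, T[ -> optimal_arrival w1 w2 D W s (tau s).

Definition flow_density (f : R -> R) : Prop :=
  mu.-integrable `[0, T] (EFin \o f) /\
  forall s, s \in `[0, T] -> 0 <= f s.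

(* f is the flow arriving at the times tau when agents leave with flow h. *)
Definition transported_flow (tau h f : R -> R) : Prop :=
  forall t, t \in `[0, T] ->
    \int[mu]_(s in `[0, t]) f s =
    \int[mu]_(s in [set s | (s \in `[0, T[) && (tau s < t)]) h s.

Definition option2 : 'I_3 := @Ordinal 3 1 isT.
Definition option3 : 'I_3 := @Ordinal 3 2 isT.

Definition generated_flows (lambda : split_components)
    (g01 g10 g12 g21 : R -> R) : Prop :=
  exists tauS1 tauS2 tau12 tau21 : R -> R,
  [/\ [/\ arrival_selection true true (th1 - thS) V_01 tauS1,
          arrival_selection true true (th2 - thS) V_10 tauS2,
          arrival_selection false true attraction_dist (V_00 th2) tau12 &
          arrival_selection true false attraction_dist (V_00 th1) tau21],
      [/\ flow_density g01, flow_density g10,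
          flow_density g12 & flow_density g21] &
      [/\ transported_flow tauS1
            (fun s => split_S11 lambda option2 s * g s) g01,
          transported_flow tauS2
            (fun s => split_S11 lambda option3 s * g s) g10,
          transported_flow tau12
            (fun s => split_101 lambda option3 s * g01 s) g12 &
          transported_flow tau21
            (fun s => split_210 lambda option3 s * g10 s) g21]].

Definition generated_mass (lambda : split_components)
    (rho' : by_label (R -> R)) : Prop :=
  exists g01 g10 g12 g21 : R -> R,
    generated_flows lambda g01 g10 g12 g21 /\
    forall t, t \in `[0, T] ->
    [/\ rho' true true t = \int[mu]_(s in `[0, t]) (g s - g01 s - g10 s),
        rho' false true t = \int[mu]_(s in `[0, t]) (g01 s - g12 s),
        rho' true false t = \int[mu]_(s in `[0, t]) (g10 s - g21 s) &
        rho' false false t = \int[mu]_(s in `[0, t]) (g12 s + g21 s)].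

Definition psi : set (by_label (R -> R)) :=
  [set rho' | mass_space rho' /\
     exists lambda, split_function lambda /\ generated_mass lambda rho'].

End Control.

Definition equilibria (F : by_label (R -> R)) : set (by_label (R -> R)) :=
  [set rho | mass_space rho /\ psi F rho rho].

(* The maximum over [0, T] is attained on X, where it is the supremum. *)
Definition distX (rho rhobar : by_label (R -> R)) : R :=
  \big[Num.max/0]_(w : bool * bool)
    sup [set `|rho w.1 w.2 t - rhobar w.1 w.2 t| | t in `[0, T]].

(* Extended-real valued, with value +oo when there is no equilibrium. *)
Definition error (rhobar : by_label (R -> R)) (ab : 'rV[R]_4 * 'rV[R]_4) :
    \bar R :=
  ereal_inf [set (distX rho rhobar)%:E | rho in equilibria (affine_cost ab)].

End TouristFlow.

(* Main.v *)
From HB Require Import structures.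
Require Import Defs.
From mathcomp Require Import measurable_realfun ring lra.

(* The equilibria form a closed multifunction of the parameters, so the limit
   along an ultrafilter of a minimizing sequence of pairs (parameter,
   equilibrium) is again such a pair.

   An equilibrium is encoded by cumulative masses alone: the mass that has
   entered each attraction, and, at each branch point, the mass that has chosen
   each option. All these functions are nondecreasing and, since the total
   masses are L-Lipschitz, Lipschitz with a common constant. They thus have
   pointwise limits, and the densities of the limits (Radon-Nikodym) give back
   the flows and, by taking quotients, the split functions; this avoids passing
   to the limit in products of weakly converging densities. The costs, hence
   the value function, converge uniformly. Options that are suboptimal by a
   margin on an interval are therefore eventually not chosen there, and optimal
   arrival times accumulate only at optimal arrival times. Arrival times are
   nondecreasing in the departure time, so that the flow equations only involve
   cumulative masses over initial intervals; the common Lipschitz bound prevents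
   arrivals from concentrating in the limit. *)

Set Implicit Arguments.
Unset Strict Implicit.
Unset Printing Implicit Defensive.

Local Open Scope classical_set_scope.
Local Open Scope ring_scope.

(** * Densities of Lipschitz functions *)

(** Congestion couples departure and arrival times. An antiderivative [phi] of the cost removes the
    coupling: adding [phi] at the departure time to a travelling option leaves a kinetic cost plus a
    function [H] of the arrival time alone. The shifted options are nondecreasing in the departure
    time, optimal arrivals can be compared by exchanging them, and convergence of the costs is used
    only through [phi]. The kinetic cost is singular: travelling options become [+oo] at the final
    time. Estimates are therefore made after truncation above a finite bound of the minimum, which
    the option of staying provides. Optimal arrivals need not be unique, so selections are not
    followed to the limit. Only the sets of optimal arrivals are, and a selection is chosen afresh
    at the end, measurable because it is monotone. An ultrafilter replaces subsequences because
    limits are wanted at all times [t] at once; boundedness alone provides them, with no diagonal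
    extraction. *)

(** The complement [D] encodes the Lipschitz bound: the two Stieltjes measures add up to [C] times
    Lebesgue measure, by uniqueness on half-open intervals, so a Lebesgue-null set is null for each
    of them. *)
Lemma lipschitz_dominated (R : realType) (C : R) (A D : cumulative R R) :
  0 < C -> (forall x, A x + D x = C * x) ->
  lebesgue_stieltjes_measure A `<< @lebesgue_measure R.
Proof.
move=> C0 AD.
have C1 : 0 <= C^-1 by rewrite invr_ge0 ltW.
pose m := mscale (NngNum C1)
  (measure_add (lebesgue_stieltjes_measure A) (lebesgue_stieltjes_measure D)).
have mE X : m X = ((C^-1)%:E * (lebesgue_stieltjes_measure A X +
    lebesgue_stieltjes_measure D X))%E.
  by congr (_ * _)%E; exact: measure_addE.
have lebE X : measurable X -> lebesgue_measure X = m X.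
  apply: lebesgue_measure_unique => Y [[a b] _ <-].
  rewrite [RHS]mE /lebesgue_measure /lebesgue_stieltjes_measure.
  rewrite /measure_extension !measurable_mu_extE/=; [|exact: is_ocitv..].
  have [ab|ba] := leP a b; last first.
    have -> : `]a, b]%classic = set0 :> set R.
      by apply: set_itv_ge; rewrite bnd_simp -leNgt ltW.
    by rewrite !wlength0 adde0 mule0.
  rewrite !wlength_itv_bnd//= -EFinD -EFinM; congr EFin.
  have -> : A b - A a + (D b - D a) = C * (b - a).
    by rewrite mulrBr -!AD; ring.
  by rewrite mulKf// gt_eqF.
move=> N Nnull X mX XN.
have := Nnull X mX XN.
move=> /(eq_trans (esym (lebE _ mX)))/eqP; rewrite mE mule_eq0 => /orP[|].
  by rewrite eqe invr_eq0 gt_eqF.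
by rewrite padde_eq0// => /andP[/eqP].
Qed.

Lemma lipschitz_nondecreasing_density (R : realType) (T C : R) (A : R -> R) :
  0 <= T -> 0 < C -> A 0 = 0 ->
  (forall s t, 0 <= s -> s <= t -> t <= T -> 0 <= A t - A s <= C * (t - s)) ->
  exists f : R -> R, [/\ forall x, 0 <= f x,
    (@lebesgue_measure R).-integrable setT (EFin \o f) &
    forall t, t \in `[0, T] ->
      \int[@lebesgue_measure R]_(s in `[0, t]) f s = A t].
Proof.
move=> T0 C0 A0 HA.
(* Freezing [A] outside [[0, T]] makes it and its complement [Db] nondecreasing on the whole
   line. *)
pose clip x := Num.max 0 (Num.min x T).
have clip0 x : 0 <= clip x by rewrite le_max lexx.
have clipT x : clip x <= T by rewrite ge_max T0 ge_min lexx orbT.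
have clip_le x y : x <= y -> clip x <= clip y.
  by move=> xy; rewrite /clip !maxEle !minEle; repeat case: ifPn;
    rewrite -?ltNge; lra.
have clip_lip x y : x <= y -> clip y - clip x <= y - x.
  by move=> xy; rewrite /clip !maxEle !minEle; repeat case: ifPn;
    rewrite -?ltNge; lra.
have clipE x : x \in `[0, T] -> clip x = x.
  by rewrite in_itv/= /clip => /andP[x0 xT]; rewrite min_l// max_r.
have incr_cont (g : R -> R) : (forall x y, x <= y -> 0 <= g y - g x <= C * (y - x)) ->
    continuous g.
  move=> Hg x; apply/(@cvgrPdist_le _ R^o) => e e0.
  near=> y.
  have yx : `|x - y| <= e / C.
    near: y; apply: (@cvgr_dist_le _ R^o _ _ _ id x) => //.
    by rewrite divr_gt0.
  have : `|g x - g y| <= C * `|x - y|.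
    have [xy|/ltW yx'] := leP x y.
      have /andP[h1 h2] := Hg _ _ xy.
      by rewrite distrC [`|x - y|]distrC !ger0_norm ?subr_ge0// -subr_ge0.
    have /andP[h1 h2] := Hg _ _ yx'.
    by rewrite !ger0_norm ?subr_ge0// -subr_ge0.
  move=> /le_trans; apply.
  by rewrite mulrC -ler_pdivlMr.
pose Ab x := A (clip x).
pose Db x := C * x - Ab x.
have HAb x y : x <= y -> 0 <= Ab y - Ab x <= C * (y - x).
  move=> xy; have /andP[-> h] := HA _ _ (clip0 x) (clip_le _ _ xy) (clipT y).
  by rewrite (le_trans h)// ler_wpM2l ?clip_lip// ltW.
have HDb x y : x <= y -> 0 <= Db y - Db x <= C * (y - x).
  by move=> /HAb/andP[]; rewrite /Db => h1 h2; apply/andP; split; lra.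
have Abnd : nondecreasing Ab by move=> x y /HAb/andP[]; rewrite subr_ge0.
have Dbnd : nondecreasing Db by move=> x y /HDb/andP[]; rewrite subr_ge0.
have Abrc := right_continuousW (incr_cont _ HAb).
have Dbrc := right_continuousW (incr_cont _ HDb).
pose Am := isCumulative.Build R _ R Ab Abnd Abrc.
pose Dm := isCumulative.Build R _ R Db Dbnd Dbrc.
pose Ac : cumulative R R := HB.pack Ab Am.
pose Dc : cumulative R R := HB.pack Db Dm.
have dom : lebesgue_stieltjes_measure Ac `<< @lebesgue_measure R.
  by apply: (@lipschitz_dominated _ C Ac Dc) => // x; rewrite /= /Db addrC subrK.
have LSE a b : a <= b ->
    lebesgue_stieltjes_measure Ac `]a, b] = (Ab b - Ab a)%:E.
  move=> ab; rewrite /lebesgue_stieltjes_measure /measure_extension.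
  by rewrite measurable_mu_extE/= ?wlength_itv_bnd//; exact: is_ocitv.
(* The restriction to []0, T]] is a finite measure, the form to which Radon-Nikodym is applied.
   Leaving out the origin is harmless, since [A 0 = 0] and a point is Lebesgue-null. *)
have mD : measurable (`]0, T] : set (measurableTypeR R)) by exact: measurable_itv.
have fD : (lebesgue_stieltjes_measure Ac `]0%R, T]%classic < +oo)%E.
  by rewrite LSE// ltry.
have domr : mfrestr mD fD `<< @lebesgue_measure R.
  move=> N /dom Nnull X mX XN; rewrite /mfrestr /mrestr.
  apply: Nnull; first exact: measurableI.
  by apply: subset_trans XN; exact: subIsetl.
have [f [f0 ffin intf fE]] :=
  @radon_nikodym_sigma_finite _ _ _ (@lebesgue_measure R) (mfrestr mD fD) domr.
exists (fine \o f).
have fineE : EFin \o (fine \o f) = f by apply/funext => x /=; rewrite fineK.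
split; [by move=> x; exact: fine_ge0|by rewrite fineE|].
move=> t t0T; move: (t0T); rewrite in_itv/= => /andP[t0 tT].
rewrite -Rintegral_itv_obnd_cbnd; last first.
  by rewrite fineE; exact: integrableS intf.
rewrite /Rintegral -[X in fine X](_ : mfrestr mD fD `]0, t] = _).
  rewrite /mfrestr /mrestr setIidl; last first.
    by apply: subset_itvl; rewrite bnd_simp.
  by rewrite LSE//= /Ab !clipE// ?in_itv/= ?lexx// A0 subr0.
by rewrite fE//; apply: eq_integral => x _; rewrite /= fineK.
Unshelve. all: by end_near. Qed.

(** * Transported flows *)

Section AlmostEverywhere.
Context {R : realType}.
Local Notation mu := (@lebesgue_measure R).
Implicit Types (D A B : set R) (f g q : R -> R).

Lemma ae_impl (P P' : R -> Prop) :
  {ae mu, forall x, P x} -> (forall x, P x -> P' x) -> {ae mu, forall x, P' x}.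
Proof.
by move=> aeP PP'; apply: filterS aeP; first exact: (ae_filter_ringOfSetsType mu).
Qed.

Lemma ae_impl2 (P1 P2 P' : R -> Prop) :
  {ae mu, forall x, P1 x} -> {ae mu, forall x, P2 x} ->
  (forall x, P1 x -> P2 x -> P' x) -> {ae mu, forall x, P' x}.
Proof.
move=> aeP1 aeP2 PP'; apply: filterS2 aeP1 aeP2; last exact: PP'.
exact: (ae_filter_ringOfSetsType mu).
Qed.

Lemma ae_eq_Rintegral D f g : measurable D ->
  measurable_fun D f -> measurable_fun D g ->
  {ae mu, forall x, D x -> f x = g x} ->
  \int[mu]_(x in D) f x = \int[mu]_(x in D) g x.
Proof.
move=> mD mf mg fg; congr fine; apply: ae_eq_integral => //.
- exact/measurable_EFinP.
- exact/measurable_EFinP.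
- by apply: (ae_impl fg) => x /[apply] ->.
Qed.

Lemma integrable_measurable D f :
  mu.-integrable D (EFin \o f) -> measurable_fun D f.
Proof. by move=> /measurable_int/measurable_EFinP. Qed.

Lemma Rintegral_ae_ge0 D f : measurable D ->
  mu.-integrable D (EFin \o f) -> {ae mu, forall x, D x -> 0 <= f x} ->
  0 <= \int[mu]_(x in D) f x.
Proof.
move=> mD /integrable_measurable mf f0.
rewrite (@ae_eq_Rintegral D f (fun x => `|f x|))//.
- by apply: Rintegral_ge0 => x _; exact: normr_ge0.
- exact: measurableT_comp.
- by apply: (ae_impl f0) => x /[apply] /ger0_norm.
Qed.

Lemma Rintegral_ae_subset A B f : measurable A -> measurable B -> A `<=` B ->
  mu.-integrable B (EFin \o f) -> {ae mu, forall x, B x -> 0 <= f x} ->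
  \int[mu]_(x in A) f x <= \int[mu]_(x in B) f x.
Proof.
move=> mA mB AB intf f0.
have mBA : measurable (B `\` A) by exact: measurableD.
rewrite -[in leRHS](setDUK AB) Rintegral_setU ?setDUK//; last first.
  by apply/disj_set2P; rewrite setDIK.
rewrite lerDl; apply: Rintegral_ae_ge0 => //.
  by apply: integrableS intf => //; exact: subDsetl.
by apply: (ae_impl f0) => x + [Bx _]; apply.
Qed.

(** Lebesgue differentiation: once [f] and [g] are set to 0 outside [[0, T]], their primitives from
    [-oo] coincide on the whole line, and almost everywhere the derivatives of these are [f] and
    [g]. *)
Lemma ae_eq_of_Rintegral (T : R) f g :
  mu.-integrable `[0, T] (EFin \o f) -> mu.-integrable `[0, T] (EFin \o g) ->
  (forall t, t \in `[0, T] ->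
    \int[mu]_(s in `[0, t]) f s = \int[mu]_(s in `[0, t]) g s) ->
  {ae mu, forall s, s \in `[0, T] -> f s = g s}.
Proof.
move=> intf intg fg.
have ftc h : mu.-integrable `[0, T] (EFin \o h) ->
    {ae mu, forall x : R, derive1 (fun y : R^o =>
      \int[mu]_(t in `]-oo, y]) (h \_ `[0, T]) t : R^o) x = (h \_ `[0, T]) x}.
  move=> inth; have mh := integrable_locally_restrict (measurable_itv _) inth.
  have inthT : mu.-integrable setT (EFin \o (h \_ `[0, T])).
    by rewrite -restrict_EFin -integrable_mkcond.
  have := @FTC1Ny R (h \_ `[0, T]) _ mh.
  have H y : mu.-integrable `]-oo, y] (EFin \o (h \_ `[0, T])).
    exact: integrableS inthT.
  by move=> /(_ H); move/ae_impl; apply=> x [].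
have same : (fun y : R => \int[mu]_(t in `]-oo, y]) (f \_ `[0, T]) t) =
            (fun y : R => \int[mu]_(t in `]-oo, y]) (g \_ `[0, T]) t).
  apply/funext => y; rewrite -!Rintegral_mkcondr.
  have -> : `]-oo, y]%classic `&` `[0, T]%classic =
      `[0, Num.min y T]%classic :> set R.
    by apply/seteqP; split => x /=; rewrite !in_itv/= le_min; lra.
  have [T0|T0] := leP 0 (Num.min y T).
    by apply: fg; rewrite in_itv/= T0 ge_min lexx orbT.
  by rewrite set_itv_ge ?Rintegral_set0// bnd_simp -ltNge.
apply: (ae_impl2 (ftc _ intf) (ftc _ intg)) => x; rewrite same => -> + xT.
by rewrite !patchE !mem_set.
Qed.

Lemma Rintegral0_ge0_ae D f : measurable D ->
  mu.-integrable D (EFin \o f) -> (forall x, D x -> 0 <= f x) ->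
  \int[mu]_(x in D) f x = 0 -> {ae mu, forall x, D x -> f x = 0}.
Proof.
move=> mD intf f0 int0.
have mf : measurable_fun D (EFin \o f) by exact: measurable_int intf.
have [+ _] := ae_eq_integral_abs mu mD mf.
have -> : (\int[mu]_(x in D) `|(EFin \o f) x| = 0)%E.
  rewrite -[RHS]/((0:R)%:E) -int0 /Rintegral fineK; last first.
    exact: integrable_fin_num.
  by apply: eq_integral => x /set_mem/f0 fx; rewrite /= ger0_norm.
by move=> /(_ erefl)/ae_impl; apply=> x /[apply] -[].
Qed.

End AlmostEverywhere.

(** * Transport expressed by cumulative masses *)

Section Transport.
Context {R : realType} (T : R).
Local Notation mu := (@lebesgue_measure R).
Implicit Types (M : R -> set R) (Q A q f tau : R -> R).

(* [M s] is the set of optimal arrival times of the agents entering at [s],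
   [Q] and [A] are the masses that have left and arrived. Quantifying over all
   of [M s] makes the relation independent of the selection of an arrival. *)
Definition arrives M Q A : Prop :=
  [/\ forall s t, s \in `[0, T[ -> t \in `[0, T] ->
        (forall u, M s u -> u < t) -> Q s <= A t,
      forall s t, s \in `[0, T[ -> t \in `[0, T] ->
        (forall u, M s u -> t <= u) -> A t <= Q s &
      forall t, t \in `[0, T] -> A t <= Q T].

Definition monotone_arrivals M : Prop :=
  forall s s' u u', s \in `[0, T[ -> s' \in `[0, T[ -> s < s' ->
    M s u -> M s' u' -> u <= u'.

Let departed tau t := [set s | (s \in `[0, T[) && (tau s < t)].

Let measurable_departed tau t :
  measurable_fun `[0, T[ tau -> measurable (departed tau t).
Proof.
move=> mtau.
have -> : departed tau t = `[0, T[ `&` tau @^-1` `]-oo, t[.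
  by apply/seteqP; split => s /=; rewrite in_itv/= => /andP.
by apply: mtau.
Qed.

(** By monotonicity, the set of departures arriving before [t] contains [[0, s]] when [tau s < t]
    and lies in [[0, s]] when [t <= tau s]. *)
Lemma transported_flow_arrives M tau q f : 0 < T ->
  measurable_fun `[0, T[ tau -> (forall s, s \in `[0, T[ -> M s (tau s)) ->
  monotone_arrivals M ->
  mu.-integrable `[0, T] (EFin \o q) ->
  {ae mu, forall s, s \in `[0, T] -> 0 <= q s} ->
  transported_flow T tau q f ->
  arrives M (fun t => \int[mu]_(s in `[0, t]) q s)
            (fun t => \int[mu]_(s in `[0, t]) f s).
Proof.
move=> T0 mtau Mtau monM intq q0 tr.
have mono s s' : s \in `[0, T[ -> s' \in `[0, T[ -> s < s' -> tau s <= tau s'.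
  by move=> sT sT' ss'; apply: (monM s s') => //; exact: Mtau.
have sub t : departed tau t `<=` `[0, T].
  by move=> s /= /andP[]; rewrite !in_itv/=; lra.
split => [s t sT tT H|s t sT tT H|t tT]; rewrite tr//.
- have taus : tau s < t by apply: H; exact: Mtau.
  apply: Rintegral_ae_subset => //.
  + exact: measurable_departed.
  + move=> x /=; move: (sT); rewrite !in_itv/= => /andP[s0 sltT] /andP[x0 xs].
    rewrite x0/= (le_lt_trans xs sltT)/=.
    move: xs; rewrite le_eqVlt => /predU1P[->//|xs].
    apply: le_lt_trans taus; apply: mono => //.
    by rewrite in_itv/= x0 (lt_trans xs).
  + apply: integrableS intq => //; first exact: measurable_departed.
    exact: sub.
  + by apply: (ae_impl q0) => x + /sub xT; apply.
- have taus : t <= tau s by apply: H; exact: Mtau.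
  move: (sT); rewrite in_itv/= => /andP[s0 sltT].
  have subsT : `[0, s]%classic `<=` `[0, T]%classic.
    by move=> x /=; rewrite !in_itv/=; lra.
  apply: Rintegral_ae_subset => //.
  + exact: measurable_departed.
  + move=> x /= /andP[xT taux]; move: (xT); rewrite !in_itv/= => /andP[-> _]/=.
    rewrite leNgt; apply/negP => sx; have := mono _ _ sT xT sx.
    by move: taus taux; lra.
  + by apply: integrableS intq => //.
  + by apply: (ae_impl q0) => x + /subsT xT; apply.
- apply: Rintegral_ae_subset => //; first exact: measurable_departed.
  exact: sub.
Qed.

(** The departures arriving before [t] form an initial interval, with or without its endpoint [a],
    and its mass is [Q a] in both cases. The mass arrived at [t] is squeezed between values of [Q]
    just before and just after [a], and the Lipschitz bound on [Q] closes the gap. *)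
Lemma arrives_transported_flow M tau q f (C : R) : 0 < T ->
  measurable_fun `[0, T[ tau -> (forall s, s \in `[0, T[ -> M s (tau s)) ->
  monotone_arrivals M ->
  mu.-integrable `[0, T] (EFin \o q) -> (forall s, s \in `[0, T] -> 0 <= q s) ->
  (forall s, s \in `[0, T] -> 0 <= f s) ->
  let Q t := \int[mu]_(s in `[0, t]) q s in
  (forall s t, 0 <= s -> s <= t -> t <= T -> Q t - Q s <= C * (t - s)) ->
  arrives M Q (fun t => \int[mu]_(s in `[0, t]) f s) ->
  transported_flow T tau q f.
Proof.
move=> T0 mtau Mtau monM intq q0 f0 Q lipQ [arr1 arr2 arr3] t tT.
have C0 : 0 < `|C| + 1 by rewrite ltr_wpDl.
have lipQ1 s u : 0 <= s -> s <= u -> u <= T -> Q u - Q s <= (`|C| + 1) * (u - s).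
  move=> s0 su uT; apply: le_trans (lipQ _ _ s0 su uT) _.
  by rewrite ler_wpM2r ?subr_ge0// (le_trans (ler_norm _))// lerDl ler01.
have mono s s' : s \in `[0, T[ -> s' \in `[0, T[ -> s < s' -> tau s <= tau s'.
  by move=> sT sT' ss'; apply: (monM s s') => //; exact: Mtau.
have q0ae D : D `<=` `[0, T] -> {ae mu, forall x, D x -> 0 <= q x}.
  by move=> DT; apply: aeW => s /DT; exact: q0.
pose E := departed tau t; rewrite -/E.
have mE : measurable E by exact: measurable_departed.
have ET : E `<=` `[0, T] by move=> s /= /andP[]; rewrite !in_itv/=; lra.
(* Adjoining 0 keeps the supremum meaningful when no departure arrives before [t]. *)
pose a := sup (0 |` E).
have hsE : has_sup (0 |` E).
  split; first by exists 0; left.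
  by exists T => s [->|/ET/=]; rewrite ?in_itv/=; lra.
have a0 : 0 <= a by apply: ub_le_sup; [case: hsE|left].
have aT : a <= T.
  apply: ge_sup; first by case: hsE.
  by move=> s [->|/ET/=]; rewrite ?in_itv/=; lra.
have Ea s : E s -> s <= a by move=> Es; apply: ub_le_sup; [case: hsE|right].
have aE s : 0 <= s -> s < a -> exists2 e, E e & s < e.
  move=> s0 sa; have [e [->|Ee] se] := sup_gt (proj1 hsE) sa; last by exists e.
  by move: s0 se; lra.
have EQ : \int[mu]_(s in E) q s = Q a.
  have subaT : `[0, a]%classic `<=` `[0, T]%classic.
    by move=> x /=; rewrite !in_itv/=; lra.
  have intqa : mu.-integrable `[0, a] (EFin \o q) by exact: integrableS intq.
  apply/eqP; rewrite eq_le; apply/andP; split.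
    apply: Rintegral_ae_subset => //; last exact: q0ae.
    move=> s Es /=; rewrite in_itv/= Ea// andbT.
    by move: (ET _ Es) => /=; rewrite in_itv/=; lra.
  rewrite /Q -Rintegral_itv_bndo_bndc; last first.
    by apply: integrableS intqa => //; apply: subset_itvl; rewrite bnd_simp.
  apply: Rintegral_ae_subset => //; last exact: q0ae.
    move=> s /=; rewrite in_itv/= => /andP[s0 sa].
    have [e /andP[eT taue] se] := aE _ s0 sa.
    have sT : s \in `[0, T[ by move: eT; rewrite !in_itv/=; lra.
    by apply/andP; split=> //; exact: le_lt_trans (mono _ _ sT eT se) taue.
  by apply: integrableS intq.
rewrite EQ; apply/eqP; rewrite eq_le; apply/andP; split.
  have [aeqT|aneT] := eqVneq a T; first by rewrite aeqT; exact: arr3.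
  have {aneT aT}aT : a < T by rewrite lt_neqAle aneT.
  apply/ler_addgt0Pr => e e0.
  pose d := Num.min (e / (`|C| + 1)) ((T - a) / 2).
  have d0 : 0 < d by rewrite lt_min !divr_gt0// subr_gt0.
  have dT : d <= (T - a) / 2 by rewrite ge_min lexx orbT.
  have de : (`|C| + 1) * d <= e by rewrite mulrC -ler_pdivlMr// ge_min lexx.
  have adT : a + d / 2 \in `[0, T[ by rewrite in_itv/=; lra.
  have adT' : a + d \in `[0, T[ by rewrite in_itv/=; lra.
  have : \int[mu]_(s in `[0, t]) f s <= Q (a + d).
    apply: arr2 => // u Mu.
    (* Beyond [a] only the selected arrival is known to be at least [t]. The intermediate departure
       [a + d / 2] transfers this, by monotonicity, to every optimal arrival at [a + d]. *)
    apply: (@le_trans _ _ (tau (a + d / 2))).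
      rewrite leNgt; apply/negP => tad.
      have : a + d / 2 <= a by apply: Ea; apply/andP.
      by lra.
    by apply: (monM (a + d / 2) (a + d)) => //; [lra|exact: Mtau].
  have : Q (a + d) - Q a <= (`|C| + 1) * (a + d - a) by apply: lipQ1; lra.
  by rewrite [a + d]addrC addrK; move: de; lra.
have [aeq0|ane0] := eqVneq a 0.
  rewrite aeq0 /Q set_itv1 Rintegral_set1; apply: Rintegral_ge0 => s /= st.
  by apply: f0; move: st tT; rewrite !in_itv/=; lra.
have {ane0 a0}a0 : 0 < a by rewrite lt_neqAle eq_sym ane0.
apply/ler_addgt0Pr => e e0.
pose d := Num.min (e / (`|C| + 1)) (a / 2).
have d0 : 0 < d by rewrite lt_min !divr_gt0.
have dT : d <= a / 2 by rewrite ge_min lexx orbT.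
have de : (`|C| + 1) * d <= e by rewrite mulrC -ler_pdivlMr// ge_min lexx.
have : Q (a - d) <= \int[mu]_(s in `[0, t]) f s.
  have adT : a - d \in `[0, T[ by rewrite in_itv/=; lra.
  have [||x /andP[xT taux] ax] := aE (a - d); [lra|lra|].
  apply: arr1 => // u Mu; apply: le_lt_trans taux.
  by apply: (monM (a - d) x) => //; exact: Mtau.
have : Q a - Q (a - d) <= (`|C| + 1) * (a - (a - d)) by apply: lipQ1; lra.
rewrite (_ : a - (a - d) = d); last by ring.
by move: de; lra.
Qed.

End Transport.

(** * Optimal transits *)

Section ExtendedReals.
Context {R : realType}.
Implicit Types (x y z : \bar R) (e : R).
Local Open Scope ereal_scope.

Lemma best_option_le n (o : n.-tuple (\bar R)) i : best_option o <= tnth o i.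
Proof. by rewrite /best_option big_tuple; exact: bigmin_le. Qed.

Lemma le_best_option n (o : n.-tuple (\bar R)) x :
  (forall i, x <= tnth o i) -> x <= best_option o.
Proof.
by move=> H; rewrite /best_option big_tuple; apply: le_bigmin; rewrite ?leey.
Qed.

Lemma best_option_attained n (o : n.+1.-tuple (\bar R)) :
  exists i, best_option o = tnth o i.
Proof.
have : best_option o <= best_option o by [].
rewrite {1}/best_option big_tuple => /bigmin_leP[oo|[i _ oi]].
  by exists ord0; apply/le_anti; rewrite best_option_le (le_trans _ oo)// leey.
by exists i; apply/le_anti; rewrite best_option_le oi.
Qed.

(** Two additive inequalities rather than a bound on a difference, so that [+oo] is close to itself:
    travelling options take this value at the final time. *)
Definition eclose e x y : Prop := x <= y + e%:E /\ y <= x + e%:E.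

Lemma eclose_sym e x y : eclose e x y -> eclose e y x.
Proof. by case. Qed.

Lemma eclosexx e x : (0 <= e)%R -> eclose e x x.
Proof. by move=> e0; split; rewrite leeDl. Qed.

Lemma ecloseW e1 e2 x y : (e1 <= e2)%R -> eclose e1 x y -> eclose e2 x y.
Proof.
by move=> e12 [xy yx]; split; [apply: le_trans xy _|apply: le_trans yx _];
  rewrite leeD2l// lee_fin.
Qed.

Lemma ecloseD e1 e2 x y z t :
  eclose e1 x y -> eclose e2 z t -> eclose (e1 + e2) (x + z) (y + t).
Proof.
by move=> [xy yx] [zt tz]; split; rewrite EFinD addeACA leeD.
Qed.

Lemma eclose_EFin e (r s : R) :
  eclose e r%:E s%:E <-> (`|r - s| <= e)%R.
Proof.
rewrite /eclose -!EFinD !lee_fin ler_norml; split; first by case=> *; lra.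
by move=> /andP[*]; split; lra.
Qed.

Lemma eclose_inf (I : Type) (D : set I) (f g : I -> \bar R) e :
  (forall i, D i -> eclose e (f i) (g i)) ->
  eclose e (ereal_inf [set f i | i in D]) (ereal_inf [set g i | i in D]).
Proof.
suff H (h k : I -> \bar R) : (forall i, D i -> h i <= k i + e%:E) ->
    ereal_inf [set h i | i in D] <= ereal_inf [set k i | i in D] + e%:E.
  by move=> fg; split; apply: H => i /fg[].
move=> hk; rewrite -leeBlDr//; apply: le_ereal_inf_tmp => _ [i Di <-].
by rewrite leeBlDr// (le_trans _ (hk _ Di))//; apply: ereal_inf_lbound; exists i.
Qed.

Lemma eclose_best n (o o' : n.+1.-tuple (\bar R)) e :
  (forall i, eclose e (tnth o i) (tnth o' i)) ->
  eclose e (best_option o) (best_option o').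
Proof.
suff H (p p' : n.+1.-tuple (\bar R)) :
    (forall i, tnth p i <= tnth p' i + e%:E) ->
    best_option p <= best_option p' + e%:E.
  by move=> oo'; split; apply: H => i; have [] := oo' i.
move=> pp'; have [i ->] := best_option_attained p'.
by rewrite (le_trans _ (pp' i))// best_option_le.
Qed.

End ExtendedReals.

Definition continuous_on (R : realType) (T : R) (f : R -> R) : Prop :=
  forall t e, 0 <= t <= T -> 0 < e -> exists2 d, 0 < d &
    forall t', 0 <= t' <= T -> `|t - t'| <= d -> `|f t - f t'| <= e.

Lemma continuous_onD (R : realType) (T : R) (f g : R -> R) :
  continuous_on T f -> continuous_on T g ->
  continuous_on T (fun t => f t + g t).
Proof.
move=> cf cg t e tT e0; have e2 : 0 < e / 2 by rewrite divr_gt0.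
have [d d0 Hd] := cf t _ tT e2; have [d' d'0 Hd'] := cg t _ tT e2.
exists (Num.min d d'); first by rewrite lt_min d0.
move=> t' t'T; rewrite le_min => /andP[/(Hd _ t'T) + /(Hd' _ t'T)].
by rewrite !ler_norml; lra.
Qed.

Lemma continuous_onN (R : realType) (T : R) (f : R -> R) :
  continuous_on T f -> continuous_on T (fun t => - f t).
Proof.
move=> cf t e tT e0; have [d d0 Hd] := cf t e tT e0.
by exists d => // t' t'T td; rewrite -opprD normrN; exact: Hd.
Qed.

(** * Kinetic cost and minimizing arrival times *)

Section Transit.
Context {R : realType} (T D : R).
Hypothesis D0 : D != 0.
Implicit Types (H : R -> R).

Let DD : 0 < D ^+ 2.
Proof. by rewrite exprn_even_gt0. Qed.

Lemma kineticE (dt : R) : 0 < dt -> kinetic D dt = (D ^+ 2 / (2 * dt))%:E.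
Proof. by move=> dt0; rewrite /kinetic inver mulf_eq0 pnatr_eq0/= gt_eqF. Qed.

Lemma kinetic0 : kinetic D 0 = +oo%E.
Proof. by rewrite /kinetic mulr0 inve0 gt0_muley// lte_fin. Qed.

Lemma kinetic_ge0 (dt : R) : 0 <= dt -> (0 <= kinetic D dt)%E.
Proof.
by move=> dt0; rewrite /kinetic mule_ge0// ?inve_ge0 lee_fin ?sqr_ge0// mulr_ge0.
Qed.

Lemma kinetic_increment (x y d : R) : 0 < d -> d <= x -> x <= y ->
  D ^+ 2 / (2 * x) <= D ^+ 2 / (2 * y) + D ^+ 2 / (2 * d ^+ 2) * (y - x).
Proof.
move=> d0 dx xy; have x0 : 0 < x by lra. have y0 : 0 < y by lra.
rewrite -lerBlDl.
have -> : D ^+ 2 / (2 * x) - D ^+ 2 / (2 * y) = D ^+ 2 / (2 * (x * y)) * (y - x).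
  by field; rewrite ?gt_eqF.
rewrite ler_wpM2r ?subr_ge0// ler_pM2l// lef_pV2 ?posrE ?mulr_gt0//.
by rewrite ler_pM2l// expr2; apply: ler_pM; lra.
Qed.

Lemma kinetic_le (x y : R) : 0 < x -> x <= y ->
  D ^+ 2 / (2 * y) <= D ^+ 2 / (2 * x).
Proof.
move=> x0 xy; have y0 : 0 < y by lra.
by rewrite ler_pM2l// lef_pV2 ?posrE ?mulr_gt0// ler_pM2l.
Qed.

(** [H] is the value on arrival plus the antiderivative of the congestion cost. The remaining part
    of the transit cost depends on the departure [s] alone and does not affect the minimizers. *)
Definition transit_minimizer H (s u : R) : Prop :=
  s < u <= T /\ forall v, s < v <= T ->
    D ^+ 2 / (2 * (u - s)) + H u <= D ^+ 2 / (2 * (v - s)) + H v.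

(* The kinetic cost is strictly submodular in departure and arrival times. *)
Lemma transit_minimizer_mono H s s' u u' : s < s' ->
  transit_minimizer H s u -> transit_minimizer H s' u' -> u <= u'.
Proof.
move=> ss' [/andP[su uT] minu] [/andP[su' uT'] minu'].
rewrite leNgt; apply/negP => u'u.
have := minu u'; have := minu' u.
have -> : s' < u <= T by apply/andP; split => //; lra.
have -> : s < u' <= T by apply/andP; split => //; lra.
move=> /(_ isT) h1 /(_ isT) h2.
have a0 : 0 < u - s by lra. have b0 : 0 < u' - s by lra.
have c0 : 0 < u - s' by lra. have d0 : 0 < u' - s' by lra.
(* Each departure is compared with the arrival of the other; in the sum of the two inequalities [H]
   cancels. *)
have : D ^+ 2 / (2 * (u' - s')) - D ^+ 2 / (2 * (u - s')) <=
       D ^+ 2 / (2 * (u' - s)) - D ^+ 2 / (2 * (u - s)) by lra.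
have -> : D ^+ 2 / (2 * (u' - s')) - D ^+ 2 / (2 * (u - s')) =
  D ^+ 2 * (u - u') / 2 / ((u' - s') * (u - s')).
  by field; rewrite ?gt_eqF.
have -> : D ^+ 2 / (2 * (u' - s)) - D ^+ 2 / (2 * (u - s)) =
  D ^+ 2 * (u - u') / 2 / ((u' - s) * (u - s)).
  by field; rewrite ?gt_eqF.
have uu0 : 0 < D ^+ 2 * (u - u') / 2.
  by apply: divr_gt0 => //; apply: mulr_gt0; rewrite ?subr_gt0.
apply/negP; rewrite -ltNge ltr_pM2l//.
rewrite ltf_pV2 ?posrE ?mulr_gt0//.
by apply: ltr_pM; rewrite ?ltW//; lra.
Qed.

(* Clearing the denominator [u - s] keeps the limit of minimizers away from
   [s]. *)
Lemma transit_minimizer_lim (U : set_system nat) (H_ : nat -> R -> R) H s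
    (u_ : nat -> R) u : ProperFilter U -> 0 <= s < T ->
  (forall e, 0 < e -> \forall n \near U, forall t, 0 <= t <= T ->
     `|H_ n t - H t| <= e) ->
  continuous_on T H ->
  u_ @ U --> u -> (forall n, transit_minimizer (H_ n) s (u_ n)) ->
  transit_minimizer H s u.
Proof.
move=> FU /andP[s0 sT] HH cH uu umin.
have su : s <= u.
  by apply: (cvgr_to_ge uu); apply: nearW => n; have [/andP[/ltW]] := umin n.
have uT : u <= T.
  by apply: (cvgr_to_le uu); apply: nearW => n; have [/andP[]] := umin n.
have u_T n : 0 <= u_ n <= T by have [/andP[]] := umin n; lra.
have Hu : (fun n => H_ n (u_ n)) @ U --> H u.
  apply/cvgrPdist_le => e e0.
  have e2 : 0 < e / 2 by rewrite divr_gt0.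
  have u0T : 0 <= u <= T by apply/andP; split => //; lra.
  have [d d0 Hd] := cH _ _ u0T e2.
  near=> n.
  have : `|H_ n (u_ n) - H (u_ n)| <= e / 2 
    by near: n; apply: filterS (HH _ e2) => n; apply.
  have : `|H u - H (u_ n)| <= e / 2.
    apply: Hd => //; near: n; exact: (@cvgr_dist_le _ _ _ _ _ _ _ uu).
  rewrite !ler_norml => /andP[? ?] /andP[? ?]; apply/andP; split; lra.
have key v : s < v <= T ->
    D ^+ 2 / 2 <= (u - s) * (D ^+ 2 / (2 * (v - s)) + H v - H u).
  move=> vT.
  have Hv : (fun n => H_ n v) @ U --> H v.
    apply/cvgrPdist_le => e e0; apply: filterS (HH _ e0) => n Hn.
    by rewrite distrC; apply: Hn; lra.
  have cv : (fun n => (u_ n - s) * (D ^+ 2 / (2 * (v - s)) + H_ n v - H_ n (u_ n))) @ U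
      --> (u - s) * (D ^+ 2 / (2 * (v - s)) + H v - H u).
    apply: cvgM; first by apply: cvgB => //; exact: cvg_cst.
    by apply: cvgB => //; apply: cvgD => //; exact: cvg_cst.
  apply: (cvgr_to_ge cv); apply: nearW => n.
  have [/andP[sun _] /(_ v vT) hn] := umin n.
  have -> : D ^+ 2 / 2 = (u_ n - s) * (D ^+ 2 / (2 * (u_ n - s))).
    by field; rewrite gt_eqF// subr_gt0.
  by rewrite ler_pM2l ?subr_gt0//; lra.
have ltsu : s < u.
  rewrite lt_neqAle su andbT; apply/eqP => seu.
  have := key T; rewrite sT lexx => /(_ isT).
  by rewrite -seu subrr mul0r; apply/negP; rewrite -ltNge divr_gt0.
split; first by rewrite ltsu.
move=> v /key; have us : 0 < u - s by rewrite subr_gt0.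
rewrite -ler_pdivrMl// (_ : (u - s)^-1 * _ = D ^+ 2 / (2 * (u - s))); first by lra.
by field; rewrite gt_eqF.
Unshelve. all: by end_near. Qed.

End Transit.

(** * Options as functions of the departure time *)

Section Steady.
Context {R : realType} (T : R).
Implicit Types (P C d e : R) (f : R -> \bar R).
Local Open Scope ereal_scope.

Definition truncate P (x : \bar R) : R := fine (Order.min P%:E x).

Lemma truncateE P x : (0 <= P)%R -> 0 <= x -> (truncate P x)%:E = Order.min P%:E x.
Proof.
by move=> P0 x0; rewrite /truncate fineK// ge0_fin_numE ?le_min ?lee_fin ?P0//
  (le_lt_trans _ (ltry P))// ge_min lexx.
Qed.

(* The options become infinite at the final time, whence the truncation. *)
Definition steady P f : Prop :=
  (forall s t : R, (0 <= s)%R -> (s <= t)%R -> (t <= T)%R -> f s <= f t) /\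
  exists d C, [/\ (0 < d)%R, (0 <= C)%R &
    forall s t : R, (0 <= s)%R -> (s <= t)%R -> (t <= s + d)%R -> (t <= T)%R ->
    Order.min P%:E (f t) <= Order.min P%:E (f s) + (C * (t - s))%:E].

Lemma steady_cst P (c : \bar R) : steady P (fun=> c).
Proof.
split=> //; exists 1%R, 0%R; split => // s t *.
by rewrite mul0r adde0.
Qed.

Lemma steady_min P f g :
  steady P f -> steady P g -> steady P (fun t => Order.min (f t) (g t)).
Proof.
move=> [mf [d [C [d0 C0 Hf]]]] [mg [d' [C' [d'0 C'0 Hg]]]]; split.
  move=> s t s0 st tT; rewrite le_min !ge_min mf// mg// orbT//.
exists (Num.min d d'), (C + C')%R; split.
- by rewrite lt_min d0.
- exact: addr_ge0.
move=> s t s0 st; rewrite -lerBlDl le_min !lerBlDl => /andP[sd sd'] tT.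
have minP x y : Order.min P%:E (Order.min x y) =
    Order.min (Order.min P%:E x) (Order.min P%:E y) by rewrite minACA minxx.
rewrite !minP.
have Cs : (C * (t - s) <= (C + C') * (t - s))%R.
  by rewrite ler_wpM2r ?subr_ge0// lerDl.
have Cs' : (C' * (t - s) <= (C + C') * (t - s))%R.
  by rewrite ler_wpM2r ?subr_ge0// lerDr.
rewrite [X in _ <= X + _]minEle; case: ifP => _; rewrite ge_min.
  by rewrite (le_trans (Hf _ _ s0 st sd tT))// leeD2l.
by rewrite (le_trans (Hg _ _ s0 st sd' tT)) ?orbT// leeD2l.
Qed.

Lemma steady_bigmin P (I : Type) (r : seq I) (o : I -> R -> \bar R) :
  (forall i, steady P (o i)) ->
  steady P (fun t => \big[Order.min/+oo]_(i <- r) o i t).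
Proof.
move=> so; elim: r => [|i r IH].
  under [X in steady P X]eq_fun do rewrite big_nil; exact: steady_cst.
under [X in steady P X]eq_fun do rewrite big_cons; exact: steady_min.
Qed.

Lemma steady_continuous P f : (0 <= P)%R ->
  (forall t : R, (0 <= t <= T)%R -> 0 <= f t) -> steady P f ->
  continuous_on T (fun t => truncate P (f t)).
Proof.
move=> P0 f0 [mf [d [C [d0 C0 Hf]]]] t e tT e0.
have C1 : (0 < C + 1)%R by rewrite ltr_wpDl.
exists (Num.min d (e / (C + 1))%R); first by rewrite lt_min d0 divr_gt0.
have key s u : (0 <= s <= T)%R -> (0 <= u <= T)%R -> (s <= u)%R ->
    (`|s - u| <= Num.min d (e / (C + 1))%R)%R ->
    (`|truncate P (f s) - truncate P (f u)| <= e)%R.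
  move=> sT uT su; rewrite distrC ger0_norm ?subr_ge0// le_min => /andP[sd se].
  have : (truncate P (f s) <= truncate P (f u))%R.
    rewrite -lee_fin !truncateE ?f0// le_min !ge_min lexx/= mf ?orbT//; lra.
  have : (truncate P (f u) <= truncate P (f s) + C * (u - s))%R.
    by rewrite -lee_fin EFinD !truncateE ?f0//; apply: Hf; lra.
  have : (C * (u - s) <= e)%R.
    by move: se; rewrite ler_pdivlMr// mulrDr mulr1; lra.
  by rewrite distrC => h1 h2 h3; rewrite ger0_norm; lra.
move=> t' t'T; have [tt'|/ltW t't] := leP t t'; first by move=> h; apply: key.
by rewrite distrC => h; rewrite distrC; apply: key.
Qed.

(** [S] restricts the arrival times: [setT] for a trip to an attraction, [[set T]] for the return to
    the station, so that one estimate serves both. *)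
Definition transit_value (S : set R) (D : R) (H : R -> R) (t : R) : \bar R :=
  ereal_inf [set (D ^+ 2 / (2 * (u - t)) + H u)%:E |
    u in [set u | S u /\ (t < u <= T)%R]].

Lemma transit_value_ge0 S (D : R) (H : R -> R) (t : R) :
  (forall u : R, (0 <= u <= T)%R -> (0 <= H u)%R) ->
  (0 <= t)%R -> 0 <= transit_value S D H t.
Proof.
move=> H0 t0; apply: le_ereal_inf_tmp => _ [u [_ uT] <-].
rewrite lee_fin addr_ge0 ?H0//; last by lra.
by rewrite divr_ge0 ?sqr_ge0// mulr_ge0// subr_ge0; lra.
Qed.

(** Since [H] is nonnegative, a trip costing less than [P] lasts at least
    [D ^+ 2 / (2 * P) = 2 * d]. Leaving later by at most [d] still leaves a duration of at least
    [d], where the kinetic cost has slope at most [D ^+ 2 / (2 * d ^+ 2)]. *)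
Lemma steady_transit S (D : R) (H : R -> R) P : (D != 0)%R -> (0 < P)%R ->
  (forall u : R, (0 <= u <= T)%R -> (0 <= H u)%R) ->
  steady P (transit_value S D H).
Proof.
move=> D0 P0 H0.
have DD : (0 < D ^+ 2)%R by rewrite exprn_even_gt0.
pose d := (D ^+ 2 / (4 * P))%R.
have d0 : (0 < d)%R by rewrite divr_gt0// mulr_gt0.
split=> [s t s0 st tT|].
  apply: le_ereal_inf_tmp => _ [u [Su uT] <-].
  apply: (@le_trans _ _ (D ^+ 2 / (2 * (u - s)) + H u)%:E).
    by apply: ereal_inf_lbound; exists u => //; split => //; lra.
  by rewrite lee_fin lerD2r kinetic_le//; lra.
exists d, (D ^+ 2 / (2 * d ^+ 2))%R; split => //.
  by rewrite divr_ge0 ?sqr_ge0// mulr_ge0// sqr_ge0.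
move=> s t s0 st td tT.
set C := (_ / _ * _)%R.
have C0 : (0 <= C)%R.
  rewrite mulr_ge0 ?subr_ge0// divr_ge0 ?sqr_ge0//.
  by rewrite mulr_ge0// sqr_ge0.
rewrite -leeBlDr// le_min; apply/andP; split.
  by rewrite leeBlDr// ge_min leeDl// lee_fin.
apply: le_ereal_inf_tmp => _ [u [Su uT] <-]; rewrite leeBlDr// ge_min.
have [Pu|uP] := leP P (D ^+ 2 / (2 * (u - s)) + H u)%R.
  by rewrite -EFinD lee_fin (le_trans Pu)// lerDl.
apply/orP; right.
have us0 : (0 < u - s)%R by lra.
have us : (2 * d <= u - s)%R.
  have : (D ^+ 2 / (2 * (u - s)) <= P)%R.
    by have := H0 u; have -> : (0 <= u <= T)%R by [lra|] ; move=> /(_ isT); lra.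
  rewrite ler_pdivrMr ?mulr_gt0// => h.
  have -> : (2 * d = D ^+ 2 / (2 * P))%R by rewrite /d; field; rewrite gt_eqF.
  by rewrite ler_pdivrMr ?mulr_gt0//; lra.
apply: (@le_trans _ _ (D ^+ 2 / (2 * (u - t)) + H u)%:E).
  by apply: ereal_inf_lbound; exists u => //; split => //; lra.
rewrite -EFinD lee_fin addrAC lerD2r /C (_ : t - s = (u - s) - (u - t))%R; last by ring.
by apply: kinetic_increment => //; lra.
Qed.

End Steady.

(** The uniform margin matches the last clause of [split_mass]; unlike mere suboptimality, it
    survives a small uniform perturbation of the options. *)
Definition suboptimal_open (R : realType) (T : R) n
    (options : R -> n.-tuple (\bar R)) : Prop :=
  forall s i, 0 <= s <= T -> tnth (options s) i <> best_option (options s) ->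
  exists e d : R, [/\ 0 < e, 0 < d & forall t : R, 0 <= t <= T ->
    `|s - t| <= d ->
    (best_option (options t) + e%:E <= tnth (options t) i)%E].

Section Options.
Context {R : realType} (T : R) (n : nat) (options : R -> n.+1.-tuple (\bar R)).
Variables (o : 'I_n.+1 -> R -> \bar R) (phi : R -> R) (c : R).
Hypothesis c0 : (0 <= c)%R.
Hypothesis optionsE : forall (t : R) i, (0 <= t <= T)%R ->
  (tnth (options t) i + (phi t)%:E = o i t)%E.
Hypothesis steady_o : forall P i, (0 < P)%R -> steady T P (o i).
Hypothesis o_ge0 : forall i (t : R), (0 <= t <= T)%R -> (0 <= o i t)%E.
Hypothesis o_le : forall t : R, (0 <= t <= T)%R -> (o ord0 t <= c%:E)%E.
Local Open Scope ereal_scope.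

Let m t := \big[Order.min/+oo]_(i < n.+1) o i t.

Let mE t : (0 <= t <= T)%R -> best_option (options t) + (phi t)%:E = m t.
Proof.
move=> tT; apply/le_anti/andP; split.
  apply: le_bigmin; rewrite ?leey// => i _.
  by rewrite -optionsE// leeD2r// best_option_le.
have [i ->] := best_option_attained (options t).
by rewrite optionsE//; exact: bigmin_le.
Qed.

Let m_ge0 t : (0 <= t <= T)%R -> 0 <= m t.
Proof. by move=> tT; apply: le_bigmin; rewrite ?leey// => i _; exact: (o_ge0 i). Qed.

Let m_le t : (0 <= t <= T)%R -> m t <= c%:E.
Proof. by move=> tT; apply: le_trans (o_le tT); exact: bigmin_le. Qed.

Let P := (c + 1)%R.

Let P0 : (0 < P)%R. Proof. by rewrite ltr_wpDl. Qed.

Let steady_m : steady T P m.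
Proof. by apply: steady_bigmin => i; exact: steady_o. Qed.

Let truncate_m t : (0 <= t <= T)%R -> (truncate P (m t))%:E = m t.
Proof.
move=> tT; rewrite truncateE ?(ltW P0) ?m_ge0// min_r//.
by rewrite (le_trans (m_le tT))// lee_fin lerDl.
Qed.

(** The shift [phi] turns the options into the steady functions [o i]. The option [ord0] bounds
    their minimum by [c], so truncation at [P = c + 1] does not change the minimum, whose continuity
    is then that of a truncated steady function. *)
Lemma best_option_value : exists w : R -> R,
  [/\ forall t : R, (0 <= t <= T)%R ->
        best_option (options t) = (w t)%:E,
      forall t : R, (0 <= t <= T)%R -> (0 <= w t + phi t <= c)%R &
      continuous_on T (fun t => w t + phi t)%R].
Proof.
exists (fun t => truncate P (m t) - phi t)%R; split.
- by move=> t tT; rewrite EFinB truncate_m// -mE// addeK.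
- move=> t tT; rewrite subrK -!lee_fin truncate_m// m_ge0//=.
  exact: m_le.
- under [X in continuous_on _ X]eq_fun do rewrite subrK.
  exact: steady_continuous (ltW P0) m_ge0 steady_m.
Qed.

(** Truncation at [c + 1], strictly above the minimum, preserves a positive gap even for an infinite
    option. Half of this gap persists as long as the option and the minimum each move by at most a
    quarter of it. *)
Lemma suboptimal_nbhs : suboptimal_open T options.
Proof.
move=> s i sT nopt.
have lt_m : m s < o i s.
  rewrite -mE// -optionsE// lteD2rE// lt_neqAle best_option_le andbT.
  by apply/eqP => /esym.
pose gap := (truncate P (o i s) - truncate P (m s))%R.
have gap0 : (0 < gap)%R.
  rewrite subr_gt0 -lte_fin truncate_m// truncateE ?(ltW P0) ?o_ge0//.
  by rewrite lt_min lt_m (le_lt_trans (m_le sT))// lte_fin ltrDl.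
have gap4 : (0 < gap / 4)%R by rewrite divr_gt0.
have [d d0 Hd] := steady_continuous (ltW P0) (o_ge0 i) (steady_o i P0) sT gap4.
have [d' d'0 Hd'] := steady_continuous (ltW P0) m_ge0 steady_m sT gap4.
exists (gap / 2)%R, (Num.min d d'); split.
- by rewrite divr_gt0.
- by rewrite lt_min d0.
move=> t tT; rewrite le_min => /andP[td td'].
rewrite -(@leeD2rE _ (phi t)%:E)// addeAC mE// optionsE// -truncate_m//.
apply: (@le_trans _ _ (truncate P (o i t))%:E).
  rewrite -EFinD lee_fin; move: (Hd t tT td) (Hd' t tT td').
  by rewrite !ler_norml /gap; lra.
by rewrite truncateE ?(ltW P0) ?o_ge0// ge_min lexx orbT.
Qed.

End Options.

(** * Regularity of the value function *)

Section Potential.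
Context {R : realType} (T : R) (F rho phi : by_label (R -> R)).

(** An abstract antiderivative of the congestion cost along [rho]; on [[0, T]] the value function
    depends on [F] and [rho] through it alone. *)
Definition potential : Prop :=
  [/\ forall w1 w2, phi w1 w2 0 = 0,
      forall w1 w2 s t, 0 <= s -> s <= t -> t <= T -> phi w1 w2 s <= phi w1 w2 t,
      forall w1 w2, continuous_on T (phi w1 w2) &
      forall w1 w2 s t, 0 <= s -> s <= t -> t <= T ->
        congestion F rho w1 w2 s t = (phi w1 w2 t - phi w1 w2 s)%:E].

Hypothesis potential_phi : potential.

Lemma potential_ge0 w1 w2 (t : R) : 0 <= t <= T -> 0 <= phi w1 w2 t.
Proof.
case: potential_phi => phi0 nd _ _ /andP[t0 tT].
by rewrite -(phi0 w1 w2); exact: nd.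
Qed.

Lemma congestionE w1 w2 s t : 0 <= s -> s <= t -> t <= T ->
  congestion F rho w1 w2 s t = (phi w1 w2 t - phi w1 w2 s)%:E.
Proof. by case: potential_phi => _ _ _; exact. Qed.

Section TransitValue.
Variables (w1 w2 : bool) (D : R) (W : R -> \bar R) (w : R -> R).
Hypothesis D0 : D != 0.
Hypothesis WE : forall t, 0 <= t <= T -> W t = (w t)%:E.

Let H t := w t + phi w1 w2 t.

Let transit_costE s u : 0 <= s -> s < u <= T ->
  transit_cost F rho w1 w2 D W s u =
  ((D ^+ 2 / (2 * (u - s)) + H u)%:E - (phi w1 w2 s)%:E)%E.
Proof.
move=> s0 /andP[su uT]; rewrite /transit_cost kineticE ?subr_gt0//.
rewrite (congestionE _ _ s0 (ltW su) uT) WE; last by rewrite uT ltW// (le_lt_trans s0).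
by rewrite -EFinB -!EFinD /H; congr EFin; ring.
Qed.

Lemma best_transitE s : 0 <= s <= T ->
  (best_transit T F rho w1 w2 D W s + (phi w1 w2 s)%:E =
   transit_value T setT D H s)%E.
Proof.
move=> /andP[s0 sT]; apply/le_anti/andP; split.
  apply: le_ereal_inf_tmp => _ [u [_ uT] <-].
  have -> : ((D ^+ 2 / (2 * (u - s)) + H u)%:E =
      transit_cost F rho w1 w2 D W s u + (phi w1 w2 s)%:E)%E.
    by rewrite transit_costE// subeK.
  by rewrite leeD2r//; apply: ereal_inf_lbound; exists u => //=; rewrite in_itv.
rewrite -leeBlDr//; apply: le_ereal_inf_tmp => _ [u /= + <-]; rewrite in_itv/= => uT.
rewrite (transit_costE s0 uT) leeD2r//.
by apply: ereal_inf_lbound; exists u.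
Qed.

Lemma optimal_arrivalE s u : 0 <= s < T ->
  optimal_arrival T F rho w1 w2 D W s u <-> transit_minimizer T D H s u.
Proof.
move=> /andP[s0 sT]; rewrite /optimal_arrival /transit_minimizer in_itv/=.
have costle v v' : s < v <= T -> s < v' <= T ->
    (transit_cost F rho w1 w2 D W s v <= transit_cost F rho w1 w2 D W s v')%E =
    (D ^+ 2 / (2 * (v - s)) + H v <= D ^+ 2 / (2 * (v' - s)) + H v').
  by move=> vT v'T; rewrite !transit_costE// leeD2rE// lee_fin.
split=> [[uT uE]|[uT umin]]; split=> //.
  move=> v vT; rewrite -costle// uE; apply: ereal_inf_lbound.
  by exists v => //=; rewrite in_itv.
apply/le_anti/andP; split.
  by apply: le_ereal_inf_tmp => _ [v /= + <-]; rewrite in_itv/= => vT;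
    rewrite costle// umin.
by apply: ereal_inf_lbound; exists u => //=; rewrite in_itv.
Qed.

End TransitValue.

(** The return to the station is a transit whose only admissible arrival is [T]. At [t = T] the
    infimum is over the empty set and the kinetic cost is infinite, so both sides are [+oo]. *)
Lemma home_transitE (D h t : R) : D != 0 -> 0 <= t <= T ->
  (kinetic D (T - t) + h%:E = transit_value T [set T] D (cst h) t)%E.
Proof.
move=> D0 /andP[t0]; rewrite le_eqVlt => /predU1P[->|tT].
  rewrite subrr kinetic0// /transit_value.
  rewrite (_ : [set u | _] = set0) ?image_set0 ?ereal_inf0 ?addye//.
  by apply/seteqP; split => // u /= [->]; rewrite ltxx.
rewrite kineticE ?subr_gt0// -EFinD; apply/le_anti/andP; split.
  by apply: le_ereal_inf_tmp => _ [u [-> _] <-].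
by apply: ereal_inf_lbound; exists T => //; split => //; rewrite tT lexx.
Qed.

End Potential.

Section ValueFunction.
Context {R : realType} (T thS th1 th2 c1 c2 cS : R) (F rho phi : by_label (R -> R)).
Hypotheses (T0 : 0 < T) (hth1 : 0 < th1) (hth1S : th1 < thS)
  (hthS2 : thS < th2) (hth2 : th2 < 2 * pi) (hc1 : 0 < c1) (hc2 : 0 < c2)
  (hcS : 0 < cS).
Hypothesis potential_phi : potential T F rho phi.

Let phi_ge0 := potential_ge0 potential_phi.

Let T_in : 0 <= T <= T. Proof. by move: T0 => h; lra. Qed.

Lemma station_dist_neq0 (th : R) : 0 < th < 2 * pi -> th != thS ->
  station_dist thS th != 0.
Proof.
move=> /andP[th0 thpi] thne; rewrite gt_eqF// /station_dist lt_min.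
rewrite normr_gt0 subr_eq0 eq_sym thne/= subr_gt0 ltr_norml.
by move: hth1 hth1S hthS2 hth2 => *; lra.
Qed.

Lemma attraction_dist_neq0 : attraction_dist th1 th2 != 0.
Proof.
rewrite gt_eqF// /attraction_dist lt_min.
by move: hth1 hth1S hthS2 hth2 => *; lra.
Qed.

Definition regular_value (V : R -> \bar R) : Prop := exists w : R -> R,
  [/\ forall t, 0 <= t <= T -> V t = (w t)%:E,
      forall t, 0 <= t <= T -> 0 <= w t & continuous_on T w].

(** Both options pay the same congestion, which stays outside the minimum; they are therefore steady
    without any shift, whence [cst 0] in place of an antiderivative. *)
Lemma regular_00 th : station_dist thS th != 0 ->
  suboptimal_open T (options_00 T thS cS th) /\
  regular_value (V_00 T thS cS F rho th).
Proof.
move=> D0.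
pose o (i : 'I_2) : R -> \bar R :=
  if val i == 0%N then fun=> cS%:E
  else transit_value T [set T] (station_dist thS th) (cst 0).
have oE t i : 0 <= t <= T ->
    (tnth (options_00 T thS cS th t) i + 0%:E = o i t)%E.
  move=> tT; case: i => -[|[|//]] i2; rewrite /tnth/= /o/= ?adde0//.
  by rewrite -home_transitE// adde0.
have so P i : 0 < P -> steady T P (o i).
  move=> P0; rewrite /o; case: ifP => _; first exact: steady_cst.
  by apply: steady_transit => // u _; rewrite /cst.
have o0 i t : 0 <= t <= T -> (0 <= o i t)%E.
  rewrite /o; case: ifP => _ tT; first by rewrite lee_fin ltW.
  by apply: transit_value_ge0 => //; lra.
have ole t : 0 <= t <= T -> (o ord0 t <= cS%:E)%E by [].
have [v [vE v0 cv]] := @best_option_value R T _ (options_00 T thS cS th) o (cst 0)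
  cS (ltW hcS) oE so o0 ole.
split.
  exact: @suboptimal_nbhs R T _ (options_00 T thS cS th) o (cst 0)
    cS (ltW hcS) oE so o0 ole.
have VE t : 0 <= t <= T -> V_00 T thS cS F rho th t =
    (v t + (phi false false T - phi false false t))%:E.
  move=> tT; rewrite /V_00 vE// (congestionE potential_phi) -?EFinD//; by case/andP: tT.
exists (fun t => v t + (phi false false T - phi false false t)); split => //.
  move=> t tT; have [_ nd _ _] := potential_phi.
  have := nd false false t T; have := v0 _ tT; rewrite addr0; lra.
apply: continuous_onD.
  by under [X in continuous_on _ X]eq_fun do rewrite -[v _]addr0.
apply: continuous_onD.
  by move=> t e tT e0; exists 1 => // t' *; rewrite subrr normr0 ltW.
by apply: continuous_onN; case: potential_phi.
Qed.

Lemma best_transit_ge0 w1 w2 (D : R) (W : R -> \bar R) (t : R) :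
  (forall t : R, 0 <= t <= T -> (0 <= W t)%E) -> 0 <= t ->
  (0 <= best_transit T F rho w1 w2 D W t)%E.
Proof.
move=> W0 t0; apply: le_ereal_inf_tmp => _ [u /= + <-].
rewrite in_itv/= => /andP[tu uT].
rewrite /transit_cost (congestionE potential_phi _ _ t0 (ltW tu) uT).
have [_ nd _ _] := potential_phi.
rewrite !adde_ge0 ?W0//.
- by rewrite kinetic_ge0// subr_ge0 ltW.
- by rewrite lee_fin subr_ge0 nd// ltW.
- by rewrite uT ltW// (le_lt_trans t0).
Qed.

(** Shifted by [phi], staying costs the constant [c + phi w1 w2 T], which is the upper bound of the
    minimum. The families [y] and [z] are the two travelling options before and after the shift. *)
Lemma regular_options w1 w2 (c : R) (y z : bool -> R -> \bar R)
    (options : R -> 3.-tuple (\bar R)) :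
  0 <= c ->
  (forall t, options t =
    [tuple c%:E + congestion F rho w1 w2 t T; y false t; y true t])%E ->
  (forall b (t : R), 0 <= t <= T -> (0 <= y b t)%E /\ (0 <= z b t)%E) ->
  (forall b (t : R), 0 <= t <= T -> (y b t + (phi w1 w2 t)%:E = z b t)%E) ->
  (forall b P, 0 < P -> steady T P (z b)) ->
  suboptimal_open T options /\ regular_value (fun t => best_option (options t)).
Proof.
move=> c0 optE yz0 yzE sz.
pose o (i : 'I_3) : R -> \bar R :=
  if val i == 0%N then fun=> (c + phi w1 w2 T)%:E else z (val i == 2%N).
have cp0 : 0 <= c + phi w1 w2 T by rewrite addr_ge0// phi_ge0.
have [_ nd cphi _] := potential_phi.
have oE t i : 0 <= t <= T -> (tnth (options t) i + (phi w1 w2 t)%:E = o i t)%E.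
  move=> tT; rewrite optE; case: i => -[|[|[|//]]] i3; rewrite /tnth/= /o/=.
  - case/andP: tT => t0 tT.
    by rewrite (congestionE potential_phi)// -!EFinD addrA subrK.
  - exact: yzE.
  - exact: yzE.
have so P i : 0 < P -> steady T P (o i).
  by move=> P0; rewrite /o; case: ifP => _; [exact: steady_cst|exact: sz].
have o0 i t : 0 <= t <= T -> (0 <= o i t)%E.
  rewrite /o; case: ifP => _ tT; first by rewrite lee_fin.
  by have [] := yz0 (val i == 2%N) t tT.
have ole t : 0 <= t <= T -> (o ord0 t <= (c + phi w1 w2 T)%:E)%E by [].
have [v [vE v0 cv]] := best_option_value cp0 oE so o0 ole.
split; first exact: suboptimal_nbhs cp0 oE so o0 ole.
exists v; split=> [//|t tT|].
- rewrite -lee_fin -vE//; apply: le_best_option => i; rewrite optE.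
  case: i => -[|[|[|//]]] i3; rewrite /tnth/=.
  + case/andP: tT => t0 tT; rewrite (congestionE potential_phi)// -EFinD lee_fin.
    by rewrite addr_ge0// subr_ge0 nd.
  + by have [] := yz0 false t tT.
  + by have [] := yz0 true t tT.
- under [X in continuous_on _ X]eq_fun => t do rewrite -[v t](addrK (phi w1 w2 t)).
  by apply: continuous_onD => //; apply: continuous_onN.
Qed.

Lemma regular_attraction w1 w2 (c D D' : R) (W : R -> \bar R)
    (options : R -> 3.-tuple (\bar R)) :
  0 < c -> D != 0 -> D' != 0 -> regular_value W ->
  (forall t, options t =
    [tuple c%:E + cS%:E + congestion F rho w1 w2 t T;
           c%:E + kinetic D (T - t) + congestion F rho w1 w2 t T;
           best_transit T F rho w1 w2 D' W t])%E ->
  suboptimal_open T options /\ regular_value (fun t => best_option (options t)).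
Proof.
move=> c0 D0 D'0 [w [WE w0 cw]] optE.
have cc0 : 0 <= c + cS by rewrite addr_ge0 ?ltW.
have H0 u : 0 <= u <= T -> 0 <= w u + phi w1 w2 u.
  by move=> uT; rewrite addr_ge0 ?w0// phi_ge0.
have h0 u : 0 <= u <= T -> 0 <= cst (c + phi w1 w2 T) u.
  by move=> uT; rewrite /= addr_ge0 ?(ltW c0)// phi_ge0.
have [_ nd _ _] := potential_phi.
apply: (@regular_options w1 w2 (c + cS)
  (fun b t => if b then best_transit T F rho w1 w2 D' W t else
    c%:E + kinetic D (T - t) + congestion F rho w1 w2 t T)%E
  (fun b => if b then transit_value T setT D' (fun t => w t + phi w1 w2 t)
    else transit_value T [set T] D (cst (c + phi w1 w2 T)))) => //.
- move=> [] t /andP[t0 tT]; split.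
  + by apply: best_transit_ge0 => // u uT; rewrite WE// lee_fin w0.
  + exact: transit_value_ge0.
  + rewrite (congestionE potential_phi)// !adde_ge0 ?lee_fin ?(ltW c0)//.
      by rewrite kinetic_ge0// subr_ge0.
    by rewrite subr_ge0 nd.
  + exact: transit_value_ge0.
- move=> [] t tT; first exact: best_transitE.
  rewrite -home_transitE// (congestionE potential_phi)//; try by case/andP: tT.
  by rewrite -addeA -EFinD subrK addeC addeA -EFinD addeC [c + _]addrC.
- by move=> [] P P0; apply: steady_transit.
Qed.

Lemma regular_station (c D D' : R) (W W' : R -> \bar R)
    (options : R -> 3.-tuple (\bar R)) :
  0 < c -> D != 0 -> D' != 0 -> regular_value W -> regular_value W' ->
  (forall t, options t =
    [tuple c%:E + congestion F rho true true t T;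
           best_transit T F rho true true D W t;
           best_transit T F rho true true D' W' t])%E ->
  suboptimal_open T options /\ regular_value (fun t => best_option (options t)).
Proof.
move=> c0 D0 D'0 [w [WE w0 cw]] [w' [W'E w'0 cw']] optE.
have H0 u : 0 <= u <= T -> 0 <= w u + phi true true u.
  by move=> uT; rewrite addr_ge0 ?w0// phi_ge0.
have H'0 u : 0 <= u <= T -> 0 <= w' u + phi true true u.
  by move=> uT; rewrite addr_ge0 ?w'0// phi_ge0.
apply: (@regular_options true true c
  (fun b => if b then best_transit T F rho true true D' W'
    else best_transit T F rho true true D W)
  (fun b => if b then transit_value T setT D' (fun t => w' t + phi true true t)
    else transit_value T setT D (fun t => w t + phi true true t))) => //.
- exact: ltW.
- move=> [] t /andP[t0 tT]; split.
  + by apply: best_transit_ge0 => // u uT; rewrite W'E// lee_fin w'0.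
  + exact: transit_value_ge0.
  + by apply: best_transit_ge0 => // u uT; rewrite WE// lee_fin w0.
  + exact: transit_value_ge0.
- by move=> [] t tT; exact: best_transitE.
- by move=> [] P P0; apply: steady_transit.
Qed.

End ValueFunction.

(** * Stability under limits *)

Section Stability.
Context {R : realType} (T thS th1 th2 c1 c2 cS : R).
Variables (F rho phi F' rho' phi' : by_label (R -> R)) (e : R).
Hypotheses (pot : potential T F rho phi) (pot' : potential T F' rho' phi').
Hypothesis e0 : 0 <= e.
Hypothesis close : forall w1 w2 t, 0 <= t <= T ->
  `|phi w1 w2 t - phi' w1 w2 t| <= e.

Lemma eclose_congestion w1 w2 (s t : R) : 0 <= s -> s <= t -> t <= T ->
  eclose (e + e) (congestion F rho w1 w2 s t) (congestion F' rho' w1 w2 s t).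
Proof.
move=> s0 st tT; rewrite (congestionE pot)// (congestionE pot')//.
apply/eclose_EFin.
have sT : 0 <= s <= T by rewrite s0 (le_trans st).
have {}tT : 0 <= t <= T by rewrite tT (le_trans s0).
move: (close w1 w2 sT) (close w1 w2 tT); rewrite !ler_norml; lra.
Qed.

Lemma eclose_V_00 (th t : R) : 0 <= t <= T ->
  eclose (e + e) (V_00 T thS cS F rho th t) (V_00 T thS cS F' rho' th t).
Proof.
move=> /andP[t0 tT]; rewrite /V_00 -[e + e]add0r.
by apply: ecloseD; [exact: eclosexx|exact: eclose_congestion].
Qed.

Lemma eclose_best_transit w1 w2 (D a : R) (W W' : R -> \bar R) (s : R) :
  0 <= s <= T -> (forall u : R, 0 <= u <= T -> eclose a (W u) (W' u)) ->
  eclose (e + e + a) (best_transit T F rho w1 w2 D W s)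
                     (best_transit T F' rho' w1 w2 D W' s).
Proof.
move=> /andP[s0 sT] WW'; apply: eclose_inf => u; rewrite /= in_itv/= => /andP[su uT].
apply: ecloseD; last by apply: WW'; rewrite uT (le_trans s0)// ltW.
rewrite -[e + e]add0r; apply: ecloseD; first exact: eclosexx.
by apply: eclose_congestion => //; exact: ltW.
Qed.

(** Each branch crossed contributes [e + e], the error on an increment of [phi]: one branch and then
    [V_00] give [4 * e] at an attraction, and one more branch gives the [6 * e] at the station
    below. *)
Let eclose_attraction w1 w2 (c D D' th : R) (t : R) i : 0 <= t <= T ->
  let o F rho := [tuple c%:E + cS%:E + congestion F rho w1 w2 t T;
           c%:E + kinetic D (T - t) + congestion F rho w1 w2 t T;
           best_transit T F rho w1 w2 D' (V_00 T thS cS F rho th) t]%E in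
  eclose (4 * e) (tnth (o F rho) i) (tnth (o F' rho') i).
Proof.
move=> tT /=; have [t0 tleT] := andP tT.
have econg x :
    eclose (4 * e) (x + congestion F rho w1 w2 t T)
                   (x + congestion F' rho' w1 w2 t T).
  apply: (@ecloseW _ (0 + (e + e))); first by move: e0 => h; lra.
  by apply: ecloseD; [exact: eclosexx|exact: eclose_congestion].
case: i => -[|[|[|//]]] i3; rewrite /tnth/=; [exact: econg|exact: econg|].
apply: (@ecloseW _ (e + e + (e + e))); first by move: e0 => h; lra.
by apply: eclose_best_transit => // u; exact: eclose_V_00.
Qed.

Lemma eclose_options_01 (t : R) i : 0 <= t <= T ->
  eclose (4 * e) (tnth (options_01 T thS th1 th2 c2 cS F rho t) i)
                 (tnth (options_01 T thS th1 th2 c2 cS F' rho' t) i).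
Proof. exact: eclose_attraction. Qed.

Lemma eclose_options_10 (t : R) i : 0 <= t <= T ->
  eclose (4 * e) (tnth (options_10 T thS th1 th2 c1 cS F rho t) i)
                 (tnth (options_10 T thS th1 th2 c1 cS F' rho' t) i).
Proof. exact: eclose_attraction. Qed.

Lemma eclose_options_11 (t : R) i : 0 <= t <= T ->
  eclose (6 * e) (tnth (options_11 T thS th1 th2 c1 c2 cS F rho t) i)
                 (tnth (options_11 T thS th1 th2 c1 c2 cS F' rho' t) i).
Proof.
move=> tT; have [t0 tleT] := andP tT.
have e6 : 6 * e = e + e + 4 * e by ring.
case: i => -[|[|[|//]]] i3; rewrite /tnth/=.
- apply: (@ecloseW _ (0 + (e + e))); first by move: e0 => h; lra.
  by apply: ecloseD; [exact: eclosexx|exact: eclose_congestion].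
- rewrite e6; apply: eclose_best_transit => // u uT.
  by apply: eclose_best => j; exact: eclose_options_01.
- rewrite e6; apply: eclose_best_transit => // u uT.
  by apply: eclose_best => j; exact: eclose_options_10.
Qed.

End Stability.

(** Compactness gives a cluster point, and an ultrafilter converges to each of its cluster points,
    since it contains every set or its complement. *)
Lemma ultra_compact_cvg (X : topologicalType) (K : set X) (U : set_system nat)
    (x_ : nat -> X) : UltraFilter U -> compact K -> (forall n, K (x_ n)) ->
  exists2 l, K l & x_ @ U --> l.
Proof.
move=> UU cK Kx.
have [|l [Kl cl]] := cK (x_ @ U) _; first by apply: nearW.
exists l => // B Bl; have [//|UC] := in_ultra_setVsetC (x_ @^-1` B) UU.
by have [y [nBy /nBy]] := cl (~` B) B UC Bl.
Qed.

Lemma ultra_bounded_cvg (R : realType) (a b : R) (U : set_system nat)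
    (x_ : nat -> R) : UltraFilter U -> (forall n, a <= x_ n <= b) ->
  exists l : R, x_ @ U --> l.
Proof.
move=> UU xab.
have [||l _ xl] := @ultra_compact_cvg _ `[a, b]%classic U x_ UU.
- exact: segment_compact.
- by move=> n /=; rewrite in_itv/=.
- by exists l.
Qed.

(** * Masses at a single state and their limits *)

Section MassBalance.
Context {R : realType} (T : R).
Implicit Types (M : R -> set R) (Q A : R -> R).

Definition cumulative_mass A : Prop :=
  A 0 = 0 /\ forall s t, 0 <= s -> s <= t -> t <= T -> A s <= A t.

(* The mass [A t] that has entered a state by time [t] is divided into the
   masses [Q i t] that have chosen the option [i]. *)
Definition split_mass n (options : R -> n.-tuple (\bar R)) A
    (Q : 'I_n -> R -> R) : Prop :=
  [/\ forall i, cumulative_mass (Q i),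
      forall t, 0 <= t <= T -> \sum_(i < n) Q i t = A t &
      forall i e a b, 0 < e -> 0 <= a -> a <= b -> b <= T ->
        (forall s : R, a <= s <= b ->
          (best_option (options s) + e%:E <= tnth (options s) i)%E) ->
        Q i a = Q i b].

Section Limit.
Context (U : set_system nat) {UU : UltraFilter U}.

Lemma cumulative_mass_lim (A_ : nat -> R -> R) A : (forall n, cumulative_mass (A_ n)) ->
  (forall t, 0 <= t <= T -> A_ ^~ t @ U --> A t) -> 0 <= T -> cumulative_mass A.
Proof.
move=> accA AA T0; split.
  have : A_ ^~ 0 @ U --> A 0 by apply: AA; rewrite lexx.
  have -> : A_ ^~ 0 = cst 0 by apply/funext => n; have [] := accA n.
  by move=> /cvg_lim <-//; rewrite lim_cst.
move=> s t s0 st tT; apply: ler_cvg_to (AA s _) (AA t _) _.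
- by rewrite s0 (le_trans st).
- by rewrite tT (le_trans s0).
- by apply: nearW => n; have [_] := accA n; exact.
Qed.

Lemma split_mass_lim n (options_ : nat -> R -> n.+1.-tuple (\bar R))
    (options : R -> n.+1.-tuple (\bar R)) (A_ : nat -> R -> R) A
    (Q_ : nat -> 'I_n.+1 -> R -> R) (Q : 'I_n.+1 -> R -> R) : 0 <= T ->
  (forall e, 0 < e -> \forall k \near U, forall t i, 0 <= t <= T ->
     eclose e (tnth (options_ k t) i) (tnth (options t) i)) ->
  (forall t, 0 <= t <= T -> A_ ^~ t @ U --> A t) ->
  (forall i t, 0 <= t <= T -> (fun k => Q_ k i t) @ U --> Q i t) ->
  (forall k, split_mass (options_ k) (A_ k) (Q_ k)) -> split_mass options A Q.
Proof.
move=> T0 oo AA QQ splitk; split.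
- move=> i; apply: (@cumulative_mass_lim (Q_ ^~ i)) => //; last exact: QQ.
  by move=> k; have [] := splitk k.
- move=> t tT; apply: (@cvg_unique _ _ (A_ ^~ t @ U)) => //; last exact: AA.
  have -> : A_ ^~ t = fun k => \sum_(i < n.+1) Q_ k i t.
    by apply/funext => k; have [_ ->] := splitk k.
  by apply: cvg_big => [|i _]; [exact: add_continuous|exact: QQ].
- move=> i e a b e0 a0 ab bT gap.
  (* Of the margin [e], one third is lost on the minimum, one third on the option, and one third
     remains for the index [k]. *)
  have e3 : 0 < e / 3 by rewrite divr_gt0.
  have aT : 0 <= a <= T by rewrite a0 (le_trans ab).
  have bT' : 0 <= b <= T by rewrite bT (le_trans a0).
  have QE : \forall k \near U, Q_ k i a = Q_ k i b.
    apply: filterS (oo _ e3) => k ook; have [_ _ /(_ i (e / 3) a b)] := splitk k.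
    apply=> // s sab.
    have sT : 0 <= s <= T by lra.
    have [_ bb] : eclose (e / 3) (best_option (options s)) (best_option (options_ k s)).
      by apply: eclose_best => j; exact/eclose_sym/ook.
    have [_ tt] := ook s i sT.
    rewrite -(@leeD2rE _ (e / 3)%:E)// (le_trans _ tt)//.
    apply: le_trans (gap s sab).
    apply: (@le_trans _ _ (best_option (options s) +
        (e / 3)%:E + (e / 3)%:E + (e / 3)%:E)%E).
      by rewrite !leeD2r.
    by rewrite -!addeA -!EFinD leeD2l// lee_fin; lra.
  apply: (@cvg_unique _ _ ((fun k => Q_ k i a) @ U)) => //; first exact: QQ.
  by apply: cvg_trans (QQ i b bT'); apply: near_eq_cvg; apply: filterS QE => k.
Qed.

(** The first clause of [arrives] tests the open condition [u < t], which is inherited by nearby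
    indices. The second tests the closed condition [t <= u]; it is relaxed to [t - d < u], and the
    Lipschitz bound on [A] pays for the shift by [d]. *)
Lemma arrives_lim (M_ : nat -> R -> set R) M (A_ Q_ : nat -> R -> R) A Q (C : R) :
  0 <= T -> 0 <= C ->
  (forall k s u, s \in `[0, T[ -> M_ k s u -> s < u <= T) ->
  (forall k s, s \in `[0, T[ -> M_ k s !=set0) ->
  (forall s (u_ : nat -> R) u, s \in `[0, T[ -> (forall k, M_ k s (u_ k)) ->
     u_ @ U --> u -> M s u) ->
  (forall t, 0 <= t <= T -> A_ ^~ t @ U --> A t) ->
  (forall t, 0 <= t <= T -> Q_ ^~ t @ U --> Q t) ->
  cumulative_mass A -> cumulative_mass Q ->
  (forall s t, 0 <= s -> s <= t -> t <= T -> A t - A s <= C * (t - s)) ->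
  (forall k, arrives T (M_ k) (Q_ k) (A_ k)) ->
  arrives T M Q A /\ forall s, s \in `[0, T[ -> M s !=set0.
Proof.
move=> T0 C0 MT M0 Mlim AA QQ [A0 ndA] [Q0 ndQ] lipA arr.
have sub s : s \in `[0, T[ -> 0 <= s <= T by rewrite in_itv/=; lra.
(* Upper semicontinuity of the optimal arrivals: otherwise elements [u_ k] of [M_ k s] outside [P]
   would converge along [U] to a point of [M s], hence of the open set [P]. *)
have Mnear (P : set R) s : s \in `[0, T[ -> open P ->
    (forall u, M s u -> P u) -> \forall k \near U, forall u, M_ k s u -> P u.
  move=> sT oP MP.
  pose B := [set k | forall u, M_ k s u -> P u].
  have [//|UC] := in_ultra_setVsetC B UU.
  have ex k : exists u, M_ k s u /\ ((~` B) k -> ~ P u).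
    have [Bk|nBk] := pselect (B k).
      by have [u Mu] := M0 k s sT; exists u.
    by move: (nBk) => /existsNP[u /not_implyP[Mu Pu]]; exists u.
  have [u_ Hu] := choice ex.
  have uT k : 0 <= u_ k <= T.
    have [Mu _] := Hu k; have := MT _ _ _ sT Mu; have := sub _ sT; lra.
  have [u uu] := ultra_bounded_cvg UU uT.
  have Pu : P u by apply: MP; apply: (Mlim s u_) => // k; have [] := Hu k.
  have : nbhs u P by exact: open_nbhs_nbhs.
  move=> /uu UP; have {}UP : U (u_ @^-1` P) by [].
  have [k [Ck Pk]] := filter_ex (filterI UC UP).
  by have [_ /(_ Ck)] := Hu k.
split; last first.
  move=> s sT; have [u_ Hu] := choice (fun k => M0 k s sT).
  have uT k : 0 <= u_ k <= T.
    have := MT _ _ _ sT (Hu k); have := sub _ sT; lra.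
  by have [u uu] := ultra_bounded_cvg UU uT; exists u; exact: Mlim uu.
split=> [s t sT tT H|s t sT tT H|t tT].
- apply: ler_cvg_to (QQ s (sub _ sT)) (AA t _) _; first by move: tT; rewrite in_itv.
  apply: filterS (Mnear [set u | u < t] s sT (@open_lt _ t) H) => k Hk.
  by have [+ _ _] := arr k; apply.
- have [t0|t0] := eqVneq t 0.
    by rewrite t0 A0 -Q0 ndQ//; have := sub _ sT; lra.
  apply/ler_addgt0Pr => e e0.
  have C1 : 0 < C + 1 by rewrite ltr_wpDl.
  pose d := Num.min (e / (C + 1)) t.
  have {}t0 : 0 < t by move: tT; rewrite in_itv/= lt_neqAle eq_sym t0 => /andP[].
  have d0 : 0 < d by rewrite lt_min divr_gt0.
  have dt : d <= t by rewrite ge_min lexx orbT.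
  have de : (C + 1) * d <= e by rewrite mulrC -ler_pdivlMr// ge_min lexx.
  have tdT : t - d \in `[0, T] by move: tT; rewrite !in_itv/=; lra.
  have : A (t - d) <= Q s.
    apply: ler_cvg_to (AA _ _) (QQ s (sub _ sT)) _; first by move: tdT; rewrite in_itv.
    have tH : forall u, M s u -> t - d < u by move=> u /H; lra.
    apply: filterS (Mnear [set u | t - d < u] s sT (@open_gt _ (t - d)) tH) => k Hk.
    by have [_ + _] := arr k; apply=> // u /Hk /ltW.
  have : A t - A (t - d) <= C * (t - (t - d)).
    by apply: lipA; move: tdT tT; rewrite !in_itv/=; lra.
  rewrite (_ : t - (t - d) = d); last by ring.
  by move: de; lra.
- apply: ler_cvg_to (AA t _) (QQ T _) _.
  + by move: tT; rewrite in_itv.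
  + by rewrite T0 lexx.
  + by apply: nearW => k; have [_ _] := arr k; exact.
Qed.

End Limit.

End MassBalance.

(** * Mass balance of the whole network *)

Section MassBalance.
Context {R : realType} (T thS th1 th2 c1 c2 cS : R) (g : R -> R) (L : R).
Hypotheses (T0 : 0 < T) (hth1 : 0 < th1) (hth1S : th1 < thS)
  (hthS2 : thS < th2) (hth2 : th2 < 2 * pi) (hc1 : 0 < c1) (hc2 : 0 < c2)
  (hcS : 0 < cS).
Local Notation mu := (@lebesgue_measure R).

(* Masses up to time [t]: [mass_in_ij] have entered at an attraction, the
   index being that of the flow [g_ij]; [mass_out_w] have chosen a given option
   at the entrance of the branch [w]. *)
Record masses : Type := Masses {
  mass_in_01 : R -> R;
  mass_in_10 : R -> R;
  mass_in_12 : R -> R;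
  mass_in_21 : R -> R;
  mass_out_11 : 'I_3 -> R -> R;
  mass_out_01 : 'I_3 -> R -> R;
  mass_out_10 : 'I_3 -> R -> R }.

Definition mass_entered (t : R) : R := \int[mu]_(s in `[0, t]) g s.

(** The existence of optimal arrivals is carried along, since a selection has to be rebuilt from the
    limit masses. *)
Definition transports (M : R -> set R) (Q A : R -> R) : Prop :=
  arrives T M Q A /\ forall s, s \in `[0, T[ -> M s !=set0.

Section Predicates.
Variables (F rho : by_label (R -> R)).

Definition arrivals_S1 : R -> set R :=
  optimal_arrival T F rho true true (th1 - thS) (V_01 T thS th1 th2 c2 cS F rho).
Definition arrivals_S2 : R -> set R :=
  optimal_arrival T F rho true true (th2 - thS) (V_10 T thS th1 th2 c1 cS F rho).
Definition arrivals_12 : R -> set R :=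
  optimal_arrival T F rho false true (attraction_dist th1 th2)
    (V_00 T thS cS F rho th2).
Definition arrivals_21 : R -> set R :=
  optimal_arrival T F rho true false (attraction_dist th1 th2)
    (V_00 T thS cS F rho th1).

Definition masses_split (m : masses) : Prop :=
  [/\ split_mass T (options_11 T thS th1 th2 c1 c2 cS F rho) mass_entered
        (mass_out_11 m),
      split_mass T (options_01 T thS th1 th2 c2 cS F rho) (mass_in_01 m)
        (mass_out_01 m) &
      split_mass T (options_10 T thS th1 th2 c1 cS F rho) (mass_in_10 m)
        (mass_out_10 m)].

Definition masses_transported (m : masses) : Prop :=
  [/\ transports arrivals_S1 (mass_out_11 m option2) (mass_in_01 m),
      transports arrivals_S2 (mass_out_11 m option3) (mass_in_10 m),
      transports arrivals_12 (mass_out_01 m option3) (mass_in_12 m) &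
      transports arrivals_21 (mass_out_10 m option3) (mass_in_21 m)].

End Predicates.

Definition masses_cumulative (m : masses) : Prop :=
  [/\ cumulative_mass T (mass_in_01 m), cumulative_mass T (mass_in_10 m),
      cumulative_mass T (mass_in_12 m) & cumulative_mass T (mass_in_21 m)].

Definition masses_total (rho : by_label (R -> R)) (m : masses) : Prop :=
  forall t, 0 <= t <= T ->
  [/\ rho true true t = mass_entered t - mass_in_01 m t - mass_in_10 m t,
      rho false true t = mass_in_01 m t - mass_in_12 m t,
      rho true false t = mass_in_10 m t - mass_in_21 m t &
      rho false false t = mass_in_12 m t + mass_in_21 m t].

Definition mass_balance (F rho : by_label (R -> R)) (m : masses) : Prop :=
  [/\ masses_split F rho m, masses_transported F rho m,
      masses_cumulative m & masses_total rho m].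

Definition increments_le (C : R) (A : R -> R) : Prop :=
  forall s t, 0 <= s -> s <= t -> t <= T -> A t - A s <= C * (t - s).

(* The densities of all flows are bounded since the total masses are
   Lipschitz: this is what rules out concentrated arrivals in the limit. *)
Lemma masses_increments (rho : by_label (R -> R)) (m : masses) (G : R) :
  (forall w1 w2 s t, 0 <= s -> s <= t -> t <= T ->
     `|rho w1 w2 t - rho w1 w2 s| <= L * (t - s)) ->
  increments_le G mass_entered -> 0 <= L ->
  masses_cumulative m -> masses_total rho m ->
  [/\ increments_le (G + 2 * L) (mass_in_01 m),
      increments_le (G + 2 * L) (mass_in_10 m),
      increments_le (G + 2 * L) (mass_in_12 m) &
      increments_le (G + 2 * L) (mass_in_21 m)].
Proof.
move=> lip lipG L0 [[_ a01] [_ a10] [_ a12] [_ a21]] tot.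
suff H s t : 0 <= s -> s <= t -> t <= T ->
  [/\ mass_in_01 m t - mass_in_01 m s <= (G + 2 * L) * (t - s),
      mass_in_10 m t - mass_in_10 m s <= (G + 2 * L) * (t - s),
      mass_in_12 m t - mass_in_12 m s <= (G + 2 * L) * (t - s) &
      mass_in_21 m t - mass_in_21 m s <= (G + 2 * L) * (t - s)].
  by split=> s t s0 st tT; have [] := H s t s0 st tT.
move=> s0 st tT.
have sT : 0 <= s <= T by rewrite s0 (le_trans st).
have {}tT' : 0 <= t <= T by rewrite tT (le_trans s0).
have [r11s r01s r10s _] := tot s sT; have [r11t r01t r10t _] := tot t tT'.
(* The balance of branch (1,1) bounds the sum of the increments of [mass_in_01] and [mass_in_10] by
   [(G + L) * (t - s)]; the balances of (0,1) and (1,0) add one more [L] for [mass_in_12] and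
   [mass_in_21]. *)
have Ld : 0 <= L * (t - s) by rewrite mulr_ge0// subr_ge0.
have := lip true true s t s0 st tT; have := lip false true s t s0 st tT.
have := lip true false s t s0 st tT; have := lipG s t s0 st tT.
have := a01 s t s0 st tT; have := a10 s t s0 st tT.
rewrite r11s r01s r10s r11t r01t r10t !ler_norml mulrDl -mulrA.
by move=> ? ? ? /andP[? ?] /andP[? ?] /andP[? ?]; split; lra.
Qed.

Section Values.
Variables (F rho phi : by_label (R -> R)).
Hypothesis pot : potential T F rho phi.

Let TT : thS - th1 != 0. Proof. by move: hth1S => h; rewrite gt_eqF//; lra. Qed.
Let TT' : thS - th2 != 0. Proof. by move: hthS2 => h; rewrite lt_eqF//; lra. Qed.
Let D12 := attraction_dist_neq0 hth1 hth1S hthS2 hth2.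

Lemma regular_V_00 th : th = th1 \/ th = th2 ->
  suboptimal_open T (options_00 T thS cS th) /\
  regular_value T (V_00 T thS cS F rho th).
Proof.
move=> th12; apply: (regular_00 hcS pot).
apply: (station_dist_neq0 hth1 hth1S hthS2 hth2).
  by move: th12 hth1 hth1S hthS2 hth2 => [->|->] *; lra.
by case: th12 => ->; [rewrite lt_eqF|rewrite gt_eqF].
Qed.

Lemma regular_V_01 :
  suboptimal_open T (options_01 T thS th1 th2 c2 cS F rho) /\
  regular_value T (V_01 T thS th1 th2 c2 cS F rho).
Proof.
have [_ reg] := regular_V_00 (or_intror erefl).
exact: (regular_attraction T0 hcS pot hc2 TT D12 reg).
Qed.

Lemma regular_V_10 :
  suboptimal_open T (options_10 T thS th1 th2 c1 cS F rho) /\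
  regular_value T (V_10 T thS th1 th2 c1 cS F rho).
Proof.
have [_ reg] := regular_V_00 (or_introl erefl).
exact: (regular_attraction T0 hcS pot hc1 TT' D12 reg).
Qed.

Lemma regular_V_11 :
  suboptimal_open T (options_11 T thS th1 th2 c1 c2 cS F rho) /\
  regular_value T (fun t =>
    best_option (options_11 T thS th1 th2 c1 c2 cS F rho t)).
Proof.
have [_ reg] := regular_V_01; have [_ reg'] := regular_V_10.
have TN : th1 - thS != 0 by rewrite -opprB oppr_eq0.
have TN' : th2 - thS != 0 by rewrite -opprB oppr_eq0.
have c12 : 0 < c1 + c2 by exact: addr_gt0.
have optE t : options_11 T thS th1 th2 c1 c2 cS F rho t =
    [tuple (c1 + c2)%:E + congestion F rho true true t T;
           best_transit T F rho true true (th1 - thS)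
             (V_01 T thS th1 th2 c2 cS F rho) t;
           best_transit T F rho true true (th2 - thS)
             (V_10 T thS th1 th2 c1 cS F rho) t]%E by [].
exact: (regular_station T0 pot c12 TN TN' reg reg' optE).
Qed.

Lemma regular_arrivals_ind (P : (R -> set R) -> Prop) :
  (forall w1 w2 D W, D != 0 -> regular_value T W ->
     P (optimal_arrival T F rho w1 w2 D W)) ->
  [/\ P (arrivals_S1 F rho), P (arrivals_S2 F rho), P (arrivals_12 F rho) &
      P (arrivals_21 F rho)].
Proof.
move=> HP; split; apply: HP => //.
- by rewrite -opprB oppr_eq0.
- by have [] := regular_V_01.
- by rewrite -opprB oppr_eq0.
- by have [] := regular_V_10.
- by have [_] := regular_V_00 (or_intror erefl).
- by have [_] := regular_V_00 (or_introl erefl).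
Qed.

Lemma optimal_arrival_mono w1 w2 D W : D != 0 -> regular_value T W ->
  monotone_arrivals T (optimal_arrival T F rho w1 w2 D W).
Proof.
move=> D0 [w [WE _ _]] s s' u u'; rewrite !in_itv/= => sT s'T ss'.
move=> /(optimal_arrivalE pot w1 w2 D WE u sT) Mu.
move=> /(optimal_arrivalE pot w1 w2 D WE u' s'T) Mu'.
exact: (transit_minimizer_mono D0 ss' Mu Mu').
Qed.

End Values.

Section Limit.
Context (U : set_system nat) {UU : UltraFilter U}.
Variables (F_ rho_ phi_ : nat -> by_label (R -> R)) (F rho phi : by_label (R -> R)).
Hypothesis pot_ : forall n, potential T (F_ n) (rho_ n) (phi_ n).
Hypothesis pot : potential T F rho phi.
Hypothesis phi_lim : forall e, 0 < e -> \forall n \near U,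
  forall w1 w2 t, 0 <= t <= T -> `|phi_ n w1 w2 t - phi w1 w2 t| <= e.

Lemma optimal_arrival_lim w1 w2 D (W_ : nat -> R -> \bar R) (W : R -> \bar R)
    (K : R) s (u_ : nat -> R) u : D != 0 -> 0 <= K ->
  (forall n, regular_value T (W_ n)) -> regular_value T W ->
  (forall e n, 0 <= e ->
    (forall w1 w2 t, 0 <= t <= T -> `|phi_ n w1 w2 t - phi w1 w2 t| <= e) ->
    forall t, 0 <= t <= T -> eclose (K * e) (W_ n t) (W t)) ->
  s \in `[0, T[ ->
  (forall n, optimal_arrival T (F_ n) (rho_ n) w1 w2 D (W_ n) s (u_ n)) ->
  u_ @ U --> u ->
  optimal_arrival T F rho w1 w2 D W s u.
Proof.
move=> D0 K0 regW_ [w [WE _ cw]] closeW; rewrite in_itv/= => sT.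
have [w_ Hw_] := choice regW_.
move=> Mu uu.
apply/(optimal_arrivalE pot w1 w2 D WE _ sT).
apply: (transit_minimizer_lim (H_ := fun n t => w_ n t + phi_ n w1 w2 t) D0 _ sT _ _ uu).
- move=> e e0.
  (* The error on the sum of value and potential is [K] times the error on [phi] for the value, plus
     once that error for the potential. *)
  have K1 : 0 < K + 1 by rewrite ltr_wpDl.
  have eK : 0 < e / (K + 1) by rewrite divr_gt0.
  apply: filterS (phi_lim eK) => n Hn t tT.
  have [WE_ _ _] := Hw_ n.
  have /= := closeW _ _ (ltW eK) Hn t tT.
  rewrite WE// WE_// => /eclose_EFin h1.
  have -> : w_ n t + phi_ n w1 w2 t - (w t + phi w1 w2 t) =
    w_ n t - w t + (phi_ n w1 w2 t - phi w1 w2 t) by ring.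
  apply: le_trans (ler_normD _ _) _.
  apply: le_trans (lerD h1 (Hn w1 w2 t tT)) _.
  by rewrite -[X in _ + X]mul1r -mulrDl mulrC divfK// gt_eqF.
- by apply: continuous_onD => //; case: pot.
- move=> n; have [WE_ _ _] := Hw_ n.
  exact/(optimal_arrivalE (pot_ n) w1 w2 D WE_ _ sT).
Qed.

Lemma transports_lim w1 w2 D (W_ : nat -> R -> \bar R) (W : R -> \bar R)
    (K C : R) (A_ Q_ : nat -> R -> R) A Q : D != 0 -> 0 <= K -> 0 <= C ->
  (forall n, regular_value T (W_ n)) -> regular_value T W ->
  (forall e n, 0 <= e ->
    (forall w1 w2 t, 0 <= t <= T -> `|phi_ n w1 w2 t - phi w1 w2 t| <= e) ->
    forall t, 0 <= t <= T -> eclose (K * e) (W_ n t) (W t)) ->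
  (forall t, 0 <= t <= T -> A_ ^~ t @ U --> A t) ->
  (forall t, 0 <= t <= T -> Q_ ^~ t @ U --> Q t) ->
  cumulative_mass T A -> cumulative_mass T Q -> increments_le C A ->
  (forall n, transports (optimal_arrival T (F_ n) (rho_ n) w1 w2 D (W_ n))
     (Q_ n) (A_ n)) ->
  transports (optimal_arrival T F rho w1 w2 D W) Q A.
Proof.
move=> D0 K0 C0 regW_ regW closeW AA QQ accA accQ lipA tr.
apply: (arrives_lim
  (M_ := fun n => optimal_arrival T (F_ n) (rho_ n) w1 w2 D (W_ n)) (ltW T0) C0
  _ _ _ AA QQ accA accQ lipA) => //.
- by move=> n s u _ [+ _]; rewrite in_itv.
- by move=> n s sT; have [_] := tr n; exact.
- move=> s u_ u sT Mu uu.
  exact: optimal_arrival_lim D0 K0 regW_ regW closeW sT Mu uu.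
- by move=> n; have [] := tr n.
Qed.

(** Monotonicity and the total masses pass to the limit first. Through [masses_increments] they give
    the limit masses their own Lipschitz bounds, which the limit of the transport relations
    requires. *)
Lemma mass_balance_lim (m_ : nat -> masses) (m : masses) (G : R) : 0 <= G ->
  0 <= L ->
  (forall w1 w2 s t, 0 <= s -> s <= t -> t <= T ->
     `|rho w1 w2 t - rho w1 w2 s| <= L * (t - s)) ->
  increments_le G mass_entered ->
  (forall n, mass_balance (F_ n) (rho_ n) (m_ n)) ->
  (forall w1 w2 t, 0 <= t <= T -> (fun n => rho_ n w1 w2 t) @ U --> rho w1 w2 t) ->
  (forall t, 0 <= t <= T ->
    [/\ (fun n => mass_in_01 (m_ n) t) @ U --> mass_in_01 m t,
        (fun n => mass_in_10 (m_ n) t) @ U --> mass_in_10 m t,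
        (fun n => mass_in_12 (m_ n) t) @ U --> mass_in_12 m t &
        (fun n => mass_in_21 (m_ n) t) @ U --> mass_in_21 m t]) ->
  (forall i t, 0 <= t <= T ->
    [/\ (fun n => mass_out_11 (m_ n) i t) @ U --> mass_out_11 m i t,
        (fun n => mass_out_01 (m_ n) i t) @ U --> mass_out_01 m i t &
        (fun n => mass_out_10 (m_ n) i t) @ U --> mass_out_10 m i t]) ->
  mass_balance F rho m.
Proof.
move=> G0 L0 lip lipG bal rholim inlim outlim.
have in01 t tT := let: And4 h _ _ _ := inlim t tT in h.
have in10 t tT := let: And4 _ h _ _ := inlim t tT in h.
have in12 t tT := let: And4 _ _ h _ := inlim t tT in h.
have in21 t tT := let: And4 _ _ _ h := inlim t tT in h.
have out11 i t tT := let: And3 h _ _ := outlim i t tT in h.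
have out01 i t tT := let: And3 _ h _ := outlim i t tT in h.
have out10 i t tT := let: And3 _ _ h := outlim i t tT in h.
have acc : masses_cumulative m.
  by split; apply: (cumulative_mass_lim _ _ (ltW T0)); [|exact: in01|
    |exact: in10| |exact: in12| |exact: in21];
    move=> n; have [_ _ [? ? ? ?] _] := bal n.
have tot : masses_total rho m.
  move=> t tT; have totn n := let: And4 _ _ _ h := bal n in h t tT.
  have lim_eq (f h : nat -> R) (a b : R) : f @ U --> a -> h @ U --> b ->
      f =1 h -> a = b.
    move=> fa hb fh; apply: (@cvg_unique _ _ (f @ U)) => //.
    by rewrite (funext fh).
  split.
  - apply: (lim_eq (fun n => rho_ n true true t) (fun n =>
      mass_entered t - mass_in_01 (m_ n) t - mass_in_10 (m_ n) t)).
    + exact: rholim.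
    + apply: cvgB; last exact: in10.
      by apply: cvgB; [exact: cvg_cst|exact: in01].
    + by move=> n; have [-> _ _ _] := totn n.
  - apply: (lim_eq (fun n => rho_ n false true t)
      (fun n => mass_in_01 (m_ n) t - mass_in_12 (m_ n) t)).
    + exact: rholim.
    + by apply: cvgB; [exact: in01|exact: in12].
    + by move=> n; have [_ -> _ _] := totn n.
  - apply: (lim_eq (fun n => rho_ n true false t)
      (fun n => mass_in_10 (m_ n) t - mass_in_21 (m_ n) t)).
    + exact: rholim.
    + by apply: cvgB; [exact: in10|exact: in21].
    + by move=> n; have [_ _ -> _] := totn n.
  - apply: (lim_eq (fun n => rho_ n false false t)
      (fun n => mass_in_12 (m_ n) t + mass_in_21 (m_ n) t)).
    + exact: rholim.
    + by apply: cvgD; [exact: in12|exact: in21].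
    + by move=> n; have [_ _ _ ->] := totn n.
have eclose_near (n : nat) (options_ : nat -> R -> n.-tuple (\bar R))
    (options : R -> n.-tuple (\bar R)) (K : R) : 0 <= K ->
    (forall e k, 0 <= e ->
      (forall w1 w2 t, 0 <= t <= T -> `|phi_ k w1 w2 t - phi w1 w2 t| <= e) ->
      forall t i, 0 <= t <= T ->
        eclose (K * e) (tnth (options_ k t) i) (tnth (options t) i)) ->
    forall e, 0 < e -> \forall k \near U, forall t i, 0 <= t <= T ->
      eclose e (tnth (options_ k t) i) (tnth (options t) i).
  move=> K0 H e e0.
  have K1 : 0 < K + 1 by rewrite ltr_wpDl.
  have eK : 0 < e / (K + 1) by rewrite divr_gt0.
  apply: filterS (phi_lim eK) => k Hk t i tT.
  apply: ecloseW (H _ _ (ltW eK) Hk t i tT).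
  by rewrite mulrCA ger_pMr// ler_pdivrMr// mul1r lerDl.
have splitm : masses_split F rho m.
  split.
  - apply: (split_mass_lim (ltW T0)
      (options_ := fun n => options_11 T thS th1 th2 c1 c2 cS (F_ n) (rho_ n))
      _ _ out11 (A_ := fun=> mass_entered)) => //.
    + apply: (@eclose_near _ _ _ 6) => // e k e0 Hk t i tT.
      exact: (eclose_options_11 _ _ _ _ _ _ (pot_ k) pot e0 Hk i tT).
    + by move=> t _; exact: cvg_cst.
    + by move=> n; have [[]] := bal n.
  - apply: (split_mass_lim (ltW T0)
      (options_ := fun n => options_01 T thS th1 th2 c2 cS (F_ n) (rho_ n))
      _ in01 out01) => //.
    + apply: (@eclose_near _ _ _ 4) => // e k e0 Hk t i tT.
      exact: (eclose_options_01 _ _ _ _ _ (pot_ k) pot e0 Hk i tT).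
    + by move=> n; have [[]] := bal n.
  - apply: (split_mass_lim (ltW T0)
      (options_ := fun n => options_10 T thS th1 th2 c1 cS (F_ n) (rho_ n))
      _ in10 out10) => //.
    + apply: (@eclose_near _ _ _ 4) => // e k e0 Hk t i tT.
      exact: (eclose_options_10 _ _ _ _ _ (pot_ k) pot e0 Hk i tT).
    + by move=> n; have [[]] := bal n.
split => //.
have [inc01 inc10 inc12 inc21] := masses_increments lip lipG L0 acc tot.
have [[acc11 _ _] [acc01 _ _] [acc10 _ _]] := splitm.
have [ac01 ac10 ac12 ac21] := acc.
have C0 : 0 <= G + 2 * L by rewrite addr_ge0// mulr_ge0.
have trn n : masses_transported (F_ n) (rho_ n) (m_ n) by have [_] := bal n.
have D12 := attraction_dist_neq0 hth1 hth1S hthS2 hth2.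
have DS1 : th1 - thS != 0 by move: hth1S => h; rewrite lt_eqF//; lra.
have DS2 : th2 - thS != 0 by move: hthS2 => h; rewrite gt_eqF//; lra.
split.
- apply: (transports_lim (K := 4) DS1 _ C0 _ _ _ in01 (out11 _) ac01 (acc11 _)
    inc01 (W_ := fun n => V_01 T thS th1 th2 c2 cS (F_ n) (rho_ n))) => //.
  + by move=> n; have [] := regular_V_01 (pot_ n).
  + by have [] := regular_V_01 pot.
  + move=> e k e0 Hk t tT; apply: eclose_best => i.
    exact: (eclose_options_01 _ _ _ _ _ (pot_ k) pot e0 Hk i tT).
  + by move=> n; have [h _ _ _] := trn n; exact: h.
- apply: (transports_lim (K := 4) DS2 _ C0 _ _ _ in10 (out11 _) ac10 (acc11 _)
    inc10 (W_ := fun n => V_10 T thS th1 th2 c1 cS (F_ n) (rho_ n))) => //.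
  + by move=> n; have [] := regular_V_10 (pot_ n).
  + by have [] := regular_V_10 pot.
  + move=> e k e0 Hk t tT; apply: eclose_best => i.
    exact: (eclose_options_10 _ _ _ _ _ (pot_ k) pot e0 Hk i tT).
  + by move=> n; have [_ h _ _] := trn n; exact: h.
- apply: (transports_lim (K := 2) D12 _ C0 _ _ _ in12 (out01 _) ac12 (acc01 _)
    inc12 (W_ := fun n => V_00 T thS cS (F_ n) (rho_ n) th2)) => //.
  + by move=> n; have [_] := regular_V_00 (pot_ n) (or_intror erefl).
  + by have [_] := regular_V_00 pot (or_intror erefl).
  + move=> e k e0 Hk t tT; rewrite mulr_natl mulr2n.
    exact: (eclose_V_00 _ _ (pot_ k) pot Hk _ tT).
  + by move=> n; have [_ _ h _] := trn n; exact: h.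
- apply: (transports_lim (K := 2) D12 _ C0 _ _ _ in21 (out10 _) ac21 (acc10 _)
    inc21 (W_ := fun n => V_00 T thS cS (F_ n) (rho_ n) th1)) => //.
  + by move=> n; have [_] := regular_V_00 (pot_ n) (or_introl erefl).
  + by have [_] := regular_V_00 pot (or_introl erefl).
  + move=> e k e0 Hk t tT; rewrite mulr_natl mulr2n.
    exact: (eclose_V_00 _ _ (pot_ k) pot Hk _ tT).
  + by move=> n; have [_ _ _ h] := trn n; exact: h.
Qed.

End Limit.

End MassBalance.

(** * Equilibria as mass balances *)

Section Integrals.
Context {R : realType}.
Local Notation mu := (@lebesgue_measure R).
Implicit Types (D : set R) (f h lambda : R -> R).

Lemma RintegralSum D (I : Type) (s : seq I) (f : I -> R -> R) : measurable D ->
  (forall i, mu.-integrable D (EFin \o f i)) ->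
  \int[mu]_(x in D) (\sum_(i <- s) f i x) =
  \sum_(i <- s) \int[mu]_(x in D) f i x.
Proof.
move=> mD intf; elim: s => [|i s IH].
  under eq_Rintegral do rewrite big_nil.
  by rewrite big_nil Rintegral_cst// mul0r.
under eq_Rintegral do rewrite big_cons.
rewrite big_cons RintegralD ?IH//.
have := @integrable_sum _ _ _ mu D mD I s xpredT _ (fun i _ => intf i).
by apply: eq_integrable => // x _; rewrite /= -sumEFin.
Qed.

Lemma integrableMl_ae D lambda h : measurable D -> measurable_fun D lambda ->
  mu.-integrable D (EFin \o h) ->
  {ae mu, forall x, D x -> 0 <= lambda x <= 1} ->
  mu.-integrable D (EFin \o (fun x => lambda x * h x)).
Proof.
move=> mD ml inth lambda01.
have mh := integrable_measurable inth.
(* The bounds on [lambda] hold only almost everywhere; the clipped [l] satisfies them everywhere and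
   yields the same integral of absolute values. *)
pose l x := Num.max 0 (Num.min 1 (lambda x)).
have ml' : measurable_fun D l.
  by apply: measurable_maxr => //; exact: measurable_minr.
have l01 x : 0 <= l x <= 1 by rewrite /l !maxEle !minEle; repeat case: ifPn;
  rewrite -?ltNge; lra.
have : mu.-integrable D (EFin \o (fun x => l x * h x)).
  apply: (@le_integrable _ _ _ mu D mD _ (EFin \o h)) => //.
    by apply/measurable_EFinP; exact: measurable_funM.
  move=> x _ /=; rewrite lee_fin normrM ger0_norm; last by have := l01 x; lra.
  by rewrite ler_piMl//; have := l01 x; lra.
move=> /integrableP[_ foo]; apply/integrableP; split.
  by apply/measurable_EFinP; exact: measurable_funM.
apply: le_lt_trans foo; rewrite le_eqVlt; apply/orP; left; apply/eqP.
apply: ae_eq_integral => //.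
- by apply: measurableT_comp => //; apply/measurable_EFinP; exact: measurable_funM.
- by apply: measurableT_comp => //; apply/measurable_EFinP; exact: measurable_funM.
- apply: (ae_impl lambda01) => x H Dx /=.
  by have /andP[l0 l1] := H Dx; rewrite /l min_r// max_r.
Qed.

Lemma Rintegral_itv0B (T : R) f s t : mu.-integrable `[0, T] (EFin \o f) ->
  0 <= s -> s <= t -> t <= T ->
  \int[mu]_(x in `[0, t]) f x - \int[mu]_(x in `[0, s]) f x =
  \int[mu]_(x in `]s, t]) f x.
Proof.
move=> intf s0 st tT; apply: Rintegral_itvB.
- by apply: integrableS intf => //; apply: subset_itvl; rewrite bnd_simp.
- by rewrite bnd_simp.
- by rewrite bnd_simp.
Qed.

Lemma cumulative_mass_Rintegral (T : R) f : mu.-integrable `[0, T] (EFin \o f) ->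
  {ae mu, forall s, s \in `[0, T] -> 0 <= f s} ->
  cumulative_mass T (fun t => \int[mu]_(s in `[0, t]) f s).
Proof.
move=> intf f0; split; first by rewrite set_itv1 Rintegral_set1.
move=> s t s0 st tT; rewrite -subr_ge0 (Rintegral_itv0B intf)//.
have sub : `]s, t]%classic `<=` `[0, T]%classic.
  by move=> x /=; rewrite !in_itv/=; lra.
apply: Rintegral_ae_ge0 => //; first exact: integrableS intf.
by apply: (ae_impl f0) => x + /sub xT; apply.
Qed.

Lemma split_at_mass (T : R) n (options : R -> n.-tuple (\bar R))
    (lambda : 'I_n -> R -> R) h :
  (forall t, 0 <= t <= T -> best_option (options t) \is a fin_num) ->
  flow_density T h -> split_at T options lambda ->
  [/\ forall i, mu.-integrable `[0, T] (EFin \o (fun s => lambda i s * h s)),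
      forall i, {ae mu, forall s, s \in `[0, T] -> 0 <= lambda i s * h s} &
      split_mass T options (fun t => \int[mu]_(s in `[0, t]) h s)
        (fun i t => \int[mu]_(s in `[0, t]) (lambda i s * h s))].
Proof.
move=> finV [inth h0] [mlambda aelambda].
have ml i : measurable_fun `[0, T] (lambda i) by have [] := mlambda i.
have l01 i : {ae mu, forall s, `[0, T]%classic s -> 0 <= lambda i s <= 1}.
  apply: (ae_impl aelambda) => s H sT; have [l0 _ l1] := H sT.
  rewrite l0/= -l1 (bigD1 i)//= lerDl; apply: sumr_ge0 => j _; exact: l0.
have intl i : mu.-integrable `[0, T] (EFin \o (fun s => lambda i s * h s)).
  exact: integrableMl_ae.
have q0 i : {ae mu, forall s, s \in `[0, T] -> 0 <= lambda i s * h s}.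
  apply: (ae_impl aelambda) => s H sT; have [l0 _ _] := H sT.
  by rewrite mulr_ge0 ?h0.
split => //; split.
- by move=> i; apply: cumulative_mass_Rintegral.
- move=> t /andP[t0 tT].
  have sub : `[0, t]%classic `<=` `[0, T]%classic.
    by apply: subset_itvl; rewrite bnd_simp.
  rewrite -RintegralSum//; last by move=> i; exact: integrableS (intl i).
  apply: ae_eq_Rintegral => //.
  + apply: measurable_sum => i; apply: integrable_measurable.
    exact: integrableS (intl i).
  + by apply: integrable_measurable; exact: integrableS inth.
  + apply: (ae_impl aelambda) => s H /sub sT; have [_ _ l1] := H sT.
    by rewrite -mulr_suml l1 mul1r.
- move=> i e a b e0 a0 ab bT gap; apply/esym/eqP; rewrite -subr_eq0.
  rewrite (Rintegral_itv0B (intl i))//; apply/eqP.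
  have sub : `]a, b]%classic `<=` `[0, T]%classic.
    by move=> x /=; rewrite !in_itv/=; lra.
  rewrite (_ : 0 = \int[mu]_(x in `]a, b]) 0 x); last first.
    by rewrite /= Rintegral_cst// mul0r.
  apply: ae_eq_Rintegral => //.
  + by apply: integrable_measurable; exact: integrableS (intl i).
  + exact: measurable_cst.
  + apply: (ae_impl aelambda) => s H sab; have sT := sub _ sab.
    have [_ nonopt _] := H sT.
    have -> : lambda i s = 0; last by rewrite mul0r.
    apply: nonopt => opt.
    have sab' : a <= s <= b by move: sab; rewrite /= in_itv/=; lra.
    have sT' : 0 <= s <= T by move: sT; rewrite /= in_itv.
    (* At an infinite minimum a margin would be compatible with optimality, whence the appeal to
       [finV]. *)
    have := gap _ sab'; rewrite opt -(fineK (finV _ sT')) -EFinD lee_fin; lra.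
Qed.

End Integrals.

Section EquilibriumMasses.
Context {R : realType} (T thS th1 th2 c1 c2 cS : R) (g : R -> R) (L : R).
Hypotheses (T0 : 0 < T) (hth1 : 0 < th1) (hth1S : th1 < thS)
  (hthS2 : thS < th2) (hth2 : th2 < 2 * pi) (hc1 : 0 < c1) (hc2 : 0 < c2)
  (hcS : 0 < cS) (dens_g : flow_density T g).
Variables (F rho phi : by_label (R -> R)).
Hypothesis pot : potential T F rho phi.
Local Notation mu := (@lebesgue_measure R).

Lemma psi_mass_balance rho' : psi T thS th1 th2 c1 c2 cS g L F rho rho' ->
  exists m,
  [/\ masses_split T thS th1 th2 c1 c2 cS g F rho m,
      masses_transported T thS th1 th2 c1 c2 cS F rho m,
      masses_cumulative T m & masses_total T g rho' m].
Proof.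
move=> [_ [lambda [[sp11 sp01 sp10 _ _] [g01 [g10 [g12 [g21 [flows total]]]]]]]].
have [tauS1 [tauS2 [tau12 [tau21 [sel dens tr]]]]] := flows.
have [[mS1 selS1] [mS2 selS2] [m12 sel12] [m21 sel21]] := sel.
have [d01 d10 d12 d21] := dens; have [trS1 trS2 tr12 tr21] := tr.
have fin V : regular_value T V -> forall t, 0 <= t <= T -> V t \is a fin_num.
  by move=> [w [wE _ _]] t tT; rewrite wE.
have [_ reg11] :=
  regular_V_11 T0 hth1 hth1S hthS2 hth2 hc1 hc2 hcS pot.
have [_ reg01] := regular_V_01 T0 hth1 hth1S hthS2 hth2 hc2 hcS pot.
have [_ reg10] := regular_V_10 T0 hth1 hth1S hthS2 hth2 hc1 hcS pot.
have [int11 q11 mass11] := split_at_mass (fin _ reg11) dens_g sp11.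
have [int01 q01 mass01] := split_at_mass (fin _ reg01) d01 sp01.
have [int10 q10 mass10] := split_at_mass (fin _ reg10) d10 sp10.
have [monS1 monS2 mon12 mon21] :=
  regular_arrivals_ind T0 hth1 hth1S hthS2 hth2 hc1 hc2 hcS pot
    (fun w1 w2 D W => @optimal_arrival_mono _ _ _ _ _ pot w1 w2 D W).
exists (Masses (fun t => \int[mu]_(s in `[0, t]) g01 s)
  (fun t => \int[mu]_(s in `[0, t]) g10 s)
  (fun t => \int[mu]_(s in `[0, t]) g12 s)
  (fun t => \int[mu]_(s in `[0, t]) g21 s)
  (fun i t => \int[mu]_(s in `[0, t]) (split_S11 lambda i s * g s))
  (fun i t => \int[mu]_(s in `[0, t]) (split_101 lambda i s * g01 s))
  (fun i t => \int[mu]_(s in `[0, t]) (split_210 lambda i s * g10 s))).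
have transp M tau q f : measurable_fun `[0, T[ tau ->
    (forall s, s \in `[0, T[ -> M s (tau s)) -> monotone_arrivals T M ->
    mu.-integrable `[0, T] (EFin \o q) ->
    {ae mu, forall s, s \in `[0, T] -> 0 <= q s} ->
    transported_flow T tau q f ->
    transports T M (fun t => \int[mu]_(s in `[0, t]) q s)
                   (fun t => \int[mu]_(s in `[0, t]) f s).
  move=> mtau Mtau monM intq q0 trq; split.
    exact: transported_flow_arrives trq.
  by move=> s sT; exists (tau s); exact: Mtau.
have acc f : flow_density T f ->
    cumulative_mass T (fun t => \int[mu]_(s in `[0, t]) f s).
  by move=> [intf f0]; apply: cumulative_mass_Rintegral => //; exact: aeW.
split.
- by split.
- split.
  + exact: (transp _ _ _ _ mS1 selS1 monS1 (int11 _) (q11 _) trS1).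
  + exact: (transp _ _ _ _ mS2 selS2 monS2 (int11 _) (q11 _) trS2).
  + exact: (transp _ _ _ _ m12 sel12 mon12 (int01 _) (q01 _) tr12).
  + exact: (transp _ _ _ _ m21 sel21 mon21 (int10 _) (q10 _) tr21).
- by split; exact: acc.
- move=> t tT; have tT' : t \in `[0, T] by rewrite in_itv.
  have sub : `[0, t]%classic `<=` `[0, T]%classic.
    by apply: subset_itvl; rewrite bnd_simp; case/andP: tT.
  have int f : flow_density T f -> mu.-integrable `[0, t] (EFin \o f).
    by move=> [intf _]; exact: integrableS intf.
  have [-> -> -> ->] := total t tT'.
  split.
  + rewrite RintegralB//; [|exact: (integrableB _ (int _ dens_g) (int _ d01))|exact: int].
    by rewrite RintegralB//; exact: int.
  + by rewrite RintegralB//; exact: int.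
  + by rewrite RintegralB//; exact: int.
  + by rewrite RintegralD//; exact: int.
Qed.

End EquilibriumMasses.

(** * Split functions recovered from densities *)

Section SplitFunctions.
Context {R : realType} (T : R) (n : nat) (options : R -> n.+1.-tuple (\bar R)).
Local Notation mu := (@lebesgue_measure R).
Hypothesis fin_best : forall t : R, 0 <= t <= T ->
  best_option (options t) \is a fin_num.
Hypothesis open_options : suboptimal_open T options.

Let optimal (i : 'I_n.+1) : set R := [set s |
  0 <= s <= T /\ tnth (options s) i = best_option (options s)].

(** Suboptimality is an open condition within [[0, T]], so optimality holds on [[0, T]] minus an
    open set. *)
Let measurable_optimal i : measurable (optimal i).
Proof.
pose U := [set t : R | exists s d : R, [/\ 0 < d, `|s - t| < d &
  forall t' : R, 0 <= t' <= T -> `|s - t'| <= d ->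
    tnth (options t') i <> best_option (options t')]].
have oU : open U.
  rewrite openE => t [s [d [d0 st Hd]]]; apply/nbhs_ballP.
  exists (d - `|s - t|) => /=; first by rewrite subr_gt0.
  move=> x; rewrite /ball /= => tx; exists s, d; split => //.
  by have := ler_distD t s x; move: tx; lra.
have -> : optimal i = `[0, T]%classic `\` U.
  apply/seteqP; split => [s [sT opt]|s [/=]]; rewrite ?in_itv/=.
    split; first by rewrite /= in_itv.
    by move=> [x [d [d0 xs H]]]; apply: (H s sT (ltW xs)).
  move=> sT nU; split => //; apply: contrapT => nopt; apply: nU.
  have [e [d [e0 d0 H]]] := open_options sT nopt.
  exists s, d; split; rewrite ?subrr ?normr0// => t' t'T std opt.
  have := H t' t'T std; rewrite opt -(fineK (fin_best t'T)) -EFinD lee_fin; lra.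
by apply: measurableD => //; exact: open_measurable.
Qed.

(** Everyone takes the optimal option of least index. This is the default where the flow vanishes
    and the quotients of densities carry no information. *)
Lemma optimal_split : exists lambda : 'I_n.+1 -> R -> R,
  (forall i, measurable_fun setT (lambda i)) /\
  forall s, 0 <= s <= T ->
  [/\ forall i, 0 <= lambda i s,
      forall i, tnth (options s) i <> best_option (options s) -> lambda i s = 0 &
      \sum_(i < n.+1) lambda i s = 1].
Proof.
pose first i := optimal i `\` \bigcup_(j in [set j : 'I_n.+1 | (j < i)%N]) optimal j.
exists (fun i => \1_(first i)); split.
  move=> i; apply: measurable_indic; apply: measurableD => //.
  exact: fin_bigcup_measurable.
move=> s sT; split.
- by move=> i; rewrite indicE ler0n.
- move=> i nopt; rewrite indicE memNset// => -[[_ opt] _]; exact: nopt.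
have [i optE] := best_option_attained (options s).
have opti : [pred j | `[< optimal j s >]] i by apply/asboolP; split.
have [i0 /asboolP opt0 min0] := arg_minnP (fun j : 'I_n.+1 => j : nat) opti.
rewrite (bigD1 i0)//= big1 ?addr0.
  rewrite indicE mem_set//; split => // -[j /= ji0 optj].
  by have := min0 j (asboolT optj); rewrite leqNgt ji0.
move=> j ji0; rewrite indicE memNset// => -[optj nopt].
have [ltji0|lti0j|/val_inj eqji0] := ltngtP (val j) (val i0).
- by have := min0 j (asboolT optj); rewrite leqNgt ltji0.
- by apply: nopt; exists i0.
- by rewrite eqji0 eqxx in ji0.
Qed.

(** The fraction is [q i / S] where the total density [S] is nonzero, and the default split
    elsewhere. That suboptimal options receive nothing is known only in integrated form, on
    intervals with a margin; countably many rational intervals reach every suboptimal time, so the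
    exceptional sets together remain null. *)
Lemma split_of_densities (q : 'I_n.+1 -> R -> R) :
  (forall i s, 0 <= q i s) ->
  (forall i, mu.-integrable setT (EFin \o q i)) ->
  (forall i e a b, 0 < e -> 0 <= a -> a <= b -> b <= T ->
    (forall s : R, a <= s <= b ->
      (best_option (options s) + e%:E <= tnth (options s) i)%E) ->
    \int[mu]_(s in `[0, a]) q i s = \int[mu]_(s in `[0, b]) q i s) ->
  exists lambda : 'I_n.+1 -> R -> R, split_at T options lambda /\
    forall i s, lambda i s * (\sum_(j < n.+1) q j s) = q i s.
Proof.
move=> q0 intq gapq.
have [dflt [mdflt dfltP]] := optimal_split.
pose S s := \sum_(j < n.+1) q j s.
have S0 s : 0 <= S s by apply: sumr_ge0.
have mq i : measurable_fun setT (q i) by apply: integrable_measurable; exact: intq.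
have mS : measurable_fun setT S by exact: measurable_sum.
have qS i s : q i s <= S s by rewrite /S (bigD1 i)//= lerDl sumr_ge0.
pose lambda i s := \1_(S @^-1` [set 0]) s * dflt i s + q i s * (S s)^-1.
have mlambda i : measurable_fun setT (lambda i).
  apply: measurable_funD; apply: measurable_funM => //.
    apply: measurable_indic; rewrite -[X in measurable X]setTI.
    exact: mS.
  (* [S] is nonnegative, so its inverse is a real power of it, which is measurable. *)
  rewrite (_ : (fun s => (S s)^-1) = (fun s => S s `^ (-1))).
    exact: measurableT_comp (measurable_powR _) mS.
  by apply/funext => s; rewrite powR_inv1.
have lambda0 i s : S s = 0 -> lambda i s = dflt i s.
  move=> Ss0; rewrite /lambda indicE mem_set// mul1r.
  by rewrite Ss0 invr0 mulr0 addr0.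
have lambdaS i s : S s != 0 -> lambda i s = q i s / S s.
  move=> /eqP Ss0; rewrite /lambda indicE memNset; last by [].
  by rewrite mul0r add0r.
exists lambda; split; last first.
  move=> i s; rewrite -/(S s); have [Ss0|Ss0] := eqVneq (S s) 0.
    rewrite Ss0 mulr0; apply/esym/eqP; rewrite eq_le q0 andbT.
    by rewrite -Ss0.
  by rewrite lambdaS// divfK.
have lambda_ge0 i s : 0 <= s <= T -> 0 <= lambda i s.
  move=> sT; have [Ss0|Ss0] := eqVneq (S s) 0.
    by rewrite lambda0//; have [] := dfltP s sT.
  by rewrite lambdaS// divr_ge0.
have lambda_sum s : 0 <= s <= T -> \sum_(i < n.+1) lambda i s = 1.
  move=> sT; have [Ss0|Ss0] := eqVneq (S s) 0.
    by under eq_bigr do rewrite lambda0//; have [] := dfltP s sT.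
  by under eq_bigr do rewrite lambdaS//; rewrite -mulr_suml divff.
have ae_q0 : {ae mu, forall s, s \in `[0, T] ->
    forall i, tnth (options s) i <> best_option (options s) -> q i s = 0}.
  (* The index is an option with two rational endpoints, cut to [[0, T]]; it ranges over a countable
     type, enumerated below by [unpickle]. *)
  pose P (k : 'I_n.+1 * (rat * rat)) (s : R) :=
    let a : R := Num.max 0 (ratr k.2.1) in let b : R := Num.min T (ratr k.2.2) in
    (exists2 e, 0 < e & a <= b /\ forall u : R, a <= u <= b ->
      (best_option (options u) + e%:E <= tnth (options u) k.1)%E) ->
    s \in `[a, b] -> q k.1 s = 0.
  have aeP k : {ae mu, forall s, P k s}.
    rewrite /P; set a : R := Num.max _ _; set b : R := Num.min _ _.
    have [[e e0 [ab gap]]|nogap] := pselect (exists2 e, 0 < e & a <= b /\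
      forall u : R, a <= u <= b ->
      (best_option (options u) + e%:E <= tnth (options u) k.1)%E); last exact: aeW.
    have a0 : 0 <= a by rewrite le_max lexx.
    have bT : b <= T by rewrite ge_min lexx.
    have intD D : measurable D -> mu.-integrable D (EFin \o q k.1).
      by move=> mD; exact: integrableS (intq k.1).
    have := @Rintegral0_ge0_ae R `[a, b] (q k.1) _ (intD _ _) _ _.
    have int0 : \int[mu]_(x in `[a, b]) q k.1 x = 0.
      rewrite -Rintegral_itv_obnd_cbnd; last exact: intD.
      rewrite -(@Rintegral_itv0B R T)//; last exact: intD.
      by rewrite (gapq _ e a b)// subrr.
    move=> H; have := H (measurable_itv _) (measurable_itv _) (fun x _ => q0 _ x) int0.
    by move=> {}H; apply: (ae_impl H) => s Hs _; exact: Hs.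
  have : {ae mu, forall s, forall m : nat,
      if unpickle m is Some k then P k s else True}.
    by apply: ae_foralln => m; case: unpickle => [k|]; [exact: aeP|exact: aeW].
  move=> H; apply: (ae_impl H) => s {}H; rewrite in_itv/= => sT i nopt.
  have [e [d [e0 d0 gap]]] := open_options sT nopt.
  have sd : s - d < s by lra.
  have sd' : s < s + d by lra.
  have [x xs] := rat_in_itvoo sd; have [y ys] := rat_in_itvoo sd'.
  have := H (pickle (i, (x, y))); rewrite pickleK /P/=; apply.
    exists e => //; split.
      rewrite ge_max !le_min; move: xs ys sT; rewrite !in_itv/=.
      by move=> /andP[? ?] /andP[? ?] /andP[? ?]; apply/andP; split; apply/andP; split; lra.
    move=> u; rewrite ge_max le_min => /andP[/andP[u0 xu] /andP[uT uy]].
    apply: gap; first by rewrite u0.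
    by move: xs ys; rewrite !in_itv/= ler_norml; lra.
  rewrite in_itv/= ge_max le_min; move: xs ys sT; rewrite !in_itv/=.
  by move=> /andP[? ?] /andP[? ?] /andP[? ?]; apply/andP; split; apply/andP; split; lra.
split.
  move=> i; split; first exact: measurable_funTS.
  exists 1; apply: aeW => s; rewrite /= in_itv/= => sT.
  rewrite ger0_norm ?lambda_ge0// -(lambda_sum _ sT) (bigD1 i)//= lerDl.
  by apply: sumr_ge0 => j _; exact: lambda_ge0.
apply: (ae_impl ae_q0) => s Hs sT; have qs := Hs sT; move: sT.
rewrite in_itv/= => sT; split; [|move=> i nopt|exact: lambda_sum].
  by move=> i; exact: lambda_ge0.
have [Ss0|Ss0] := eqVneq (S s) 0.
  by rewrite lambda0//; have [_ ->] := dfltP s sT.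
by rewrite lambdaS// qs// mul0r.
Qed.

End SplitFunctions.

(** * From mass balances back to equilibria *)

Section BalancePsi.
Context {R : realType} (T thS th1 th2 c1 c2 cS : R) (g : R -> R) (L : R).
Hypotheses (T0 : 0 < T) (hth1 : 0 < th1) (hth1S : th1 < thS)
  (hthS2 : thS < th2) (hth2 : th2 < 2 * pi) (hc1 : 0 < c1) (hc2 : 0 < c2)
  (hcS : 0 < cS) (dens_g : flow_density T g).
Local Notation mu := (@lebesgue_measure R).

Lemma density_of_cumulative_mass (C : R) (A : R -> R) : cumulative_mass T A ->
  increments_le T C A ->
  exists f : R -> R, [/\ forall x, 0 <= f x, mu.-integrable setT (EFin \o f) &
    forall t, t \in `[0, T] -> \int[mu]_(s in `[0, t]) f s = A t].
Proof.
move=> [A0 ndA] lipA.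
have C1 : 0 < `|C| + 1 by rewrite ltr_wpDl.
apply: (lipschitz_nondecreasing_density (ltW T0) C1 A0) => s t s0 st tT.
rewrite subr_ge0 ndA//= (le_trans (lipA s t s0 st tT))// ler_wpM2r ?subr_ge0//.
by rewrite (le_trans (ler_norm _))// lerDl.
Qed.

Lemma split_mass_increments (C : R) n (options : R -> n.-tuple (\bar R)) A Q :
  split_mass T options A Q -> increments_le T C A ->
  forall i, increments_le T C (Q i).
Proof.
move=> [accQ sumQ _] lipA i s t s0 st tT.
apply: le_trans (lipA s t s0 st tT); rewrite -!sumQ; last 2 first.
- by rewrite s0 (le_trans st).
- by rewrite tT (le_trans s0).
rewrite -sumrB (bigD1 i)//= lerDl; apply: sumr_ge0 => j _.
by rewrite subr_ge0; have [_] := accQ j; exact.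
Qed.

Lemma split_mass_densities (C : R) n (options : R -> n.+1.-tuple (\bar R)) A Q :
  (forall t : R, 0 <= t <= T -> best_option (options t) \is a fin_num) ->
  suboptimal_open T options ->
  split_mass T options A Q -> increments_le T C A ->
  exists q lambda : 'I_n.+1 -> R -> R,
  [/\ forall i, [/\ forall s, 0 <= q i s, mu.-integrable setT (EFin \o q i) &
        forall t, t \in `[0, T] -> \int[mu]_(s in `[0, t]) q i s = Q i t],
      split_at T options lambda,
      forall i s, lambda i s * (\sum_(j < n.+1) q j s) = q i s &
      forall t, t \in `[0, T] ->
        \int[mu]_(s in `[0, t]) (\sum_(j < n.+1) q j s) = A t].
Proof.
move=> fin opn splitQ lipA.
have [accQ sumQ gapQ] := splitQ.
have [q qP] := choice (fun i => density_of_cumulative_mass (accQ i)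
  (split_mass_increments splitQ lipA i)).
have q0 i s : 0 <= q i s by have [] := qP i.
have intq i : mu.-integrable setT (EFin \o q i) by have [] := qP i.
have qQ i t : t \in `[0, T] -> \int[mu]_(s in `[0, t]) q i s = Q i t.
  by have [_ _] := qP i; exact.
have [|lambda [spl lambdaE]] := split_of_densities fin opn q0 intq.
  move=> i e a b e0 a0 ab bT gap; rewrite !qQ; first exact: gapQ gap.
  - by rewrite in_itv/= bT (le_trans a0).
  - by rewrite in_itv/= a0 (le_trans ab).
exists q, lambda; split => // t tT.
rewrite RintegralSum//; last by move=> i; exact: integrableS (intq i).
by under eq_bigr do rewrite qQ//; apply: sumQ; rewrite in_itv in tT.
Qed.

(** Any choice of optimal arrivals is nondecreasing in the departure time, hence measurable. *)
Lemma arrival_selection_exists F rho w1 w2 D (W : R -> \bar R) :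
  monotone_arrivals T (optimal_arrival T F rho w1 w2 D W) ->
  (forall s, s \in `[0, T[ -> optimal_arrival T F rho w1 w2 D W s !=set0) ->
  exists tau, arrival_selection T F rho w1 w2 D W tau.
Proof.
move=> mono nonempty.
have /choice[tau tauP] : forall s, exists u, s \in `[0, T[ ->
    optimal_arrival T F rho w1 w2 D W s u.
  move=> s; have [sT|nsT] := boolP (s \in `[0, T[); last by exists 0.
  by have [u Mu] := nonempty s sT; exists u.
(* Arrivals lie in [[0, T]], so the values 0 before and [T] after [[0, T[] keep the extension
   nondecreasing on the line. *)
pose tau' s := if s < 0 then 0 else if s < T then tau s else T.
have tau'E s : s \in `[0, T[ -> tau' s = tau s.
  by rewrite in_itv/= /tau' => /andP[s0 ->]; rewrite ltNge s0.
exists tau'; split; last by move=> s sT; rewrite tau'E//; exact: tauP.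
apply: nondecreasing_measurable => // s s' ss'.
have tauT x : x \in `[0, T[ -> 0 <= tau x <= T.
  move=> xT; have [+ _] := tauP x xT; move: xT; rewrite !in_itv/=; lra.
rewrite /tau'; have [s_lt0|s0] := ltP s 0.
  have [//|s'0] := ltP s' 0; have [s'T|s'T] := ltP s' T; last exact: ltW.
  by have := tauT s'; rewrite in_itv/= s'0 s'T => /(_ isT)/andP[].
rewrite (ltNge s' 0) (le_trans s0 ss')/=.
have [sT|sT] := ltP s T; last by rewrite (ltNge s' T) (le_trans sT ss').
have sI : s \in `[0, T[ by rewrite in_itv/= s0.
have [s'T|s'T] := ltP s' T; last by have /andP[] := tauT s sI.
have s'I : s' \in `[0, T[ by rewrite in_itv/= s'T (le_trans s0 ss').
have [->//|ne] := eqVneq s s'.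
by apply: (mono s s') => //; [rewrite lt_neqAle ne|exact: tauP|exact: tauP].
Qed.

Section Fixed.
Variables (F rho phi : by_label (R -> R)).
Hypothesis pot : potential T F rho phi.

Lemma mass_balance_psi (G : R) m : 0 <= G -> 0 <= L ->
  mass_space T g L rho ->
  (forall w1 w2 s t, 0 <= s -> s <= t -> t <= T ->
     `|rho w1 w2 t - rho w1 w2 s| <= L * (t - s)) ->
  increments_le T G (mass_entered g) ->
  mass_balance T thS th1 th2 c1 c2 cS g F rho m ->
  psi T thS th1 th2 c1 c2 cS g L F rho rho.
Proof.
move=> G0 L0 Xrho lip lipG [[sp11 sp01 sp10] [trS1 trS2 tr12 tr21] acc tot].
have [inc01 inc10 inc12 inc21] := masses_increments lip lipG L0 acc tot.
have [_ _ ac12 ac21] := acc.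
have fin V : regular_value T V -> forall t, 0 <= t <= T -> V t \is a fin_num.
  by move=> [w [wE _ _]] t tT; rewrite wE.
have [op11 reg11] :=
  regular_V_11 T0 hth1 hth1S hthS2 hth2 hc1 hc2 hcS pot.
have [op01 reg01] := regular_V_01 T0 hth1 hth1S hthS2 hth2 hc2 hcS pot.
have [op10 reg10] := regular_V_10 T0 hth1 hth1S hthS2 hth2 hc1 hcS pot.
have [monS1 monS2 mon12 mon21] :=
  regular_arrivals_ind T0 hth1 hth1S hthS2 hth2 hc1 hc2 hcS pot
    (fun w1 w2 D W => @optimal_arrival_mono _ _ _ _ _ pot w1 w2 D W).
have [q11 [l11 [q11P spl11 l11E sum11]]] :=
  split_mass_densities (fin _ reg11) op11 sp11 lipG.
have [q01 [l01 [q01P spl01 l01E sum01]]] :=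
  split_mass_densities (fin _ reg01) op01 sp01 inc01.
have [q10 [l10 [q10P spl10 l10E sum10]]] :=
  split_mass_densities (fin _ reg10) op10 sp10 inc10.
have [g12 [g12_0 int12 g12E]] := density_of_cumulative_mass ac12 inc12.
have [g21 [g21_0 int21 g21E]] := density_of_cumulative_mass ac21 inc21.
(* With zero densities [split_of_densities] returns the default split everywhere, which supplies the
   components at the states with label (0,0). *)
have split_00 th : th = th1 \/ th = th2 -> exists lambda,
    split_at T (options_00 T thS cS th) lambda.
  move=> th12.
  have [op _] := regular_V_00 hth1 hth1S hthS2 hth2 hcS pot th12.
  have int0 (i : 'I_2) : mu.-integrable setT (EFin \o (fun=> 0 : R)).
    exact: integrable0.
  have finb t : 0 <= t <= T ->
      best_option (options_00 T thS cS th t) \is a fin_num.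
    move=> /andP[t0 tT]; rewrite ge0_fin_numE.
      apply: le_lt_trans (best_option_le _ ord0) _; exact: ltry.
    apply: le_best_option => -[[|[|//]] i2]; rewrite /tnth/=.
      by rewrite lee_fin ltW.
    by rewrite kinetic_ge0// subr_ge0.
  have [|lambda [spl _]] :=
    split_of_densities finb op (q := fun _ _ => 0) (fun _ _ => lexx 0) int0.
    by move=> i e a b *; rewrite !Rintegral_cst// !mul0r.
  by exists lambda.
have [l100 spl100] := split_00 th1 (or_introl erefl).
have [l200 spl200] := split_00 th2 (or_intror erefl).
have [tauS1 selS1] := arrival_selection_exists monS1 (proj2 trS1).
have [tauS2 selS2] := arrival_selection_exists monS2 (proj2 trS2).
have [tau12 sel12] := arrival_selection_exists mon12 (proj2 tr12).
have [tau21 sel21] := arrival_selection_exists mon21 (proj2 tr21).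
(* Defining the flows as the sums of the densities of their options makes the fraction times the
   flow equal to the density at every time. *)
pose g01 s := \sum_(j < 3) q01 j s; pose g10 s := \sum_(j < 3) q10 j s.
have densS n (q : 'I_n -> R -> R) : (forall i s, 0 <= q i s) ->
    (forall i, mu.-integrable setT (EFin \o q i)) ->
    flow_density T (fun s => \sum_(j < n) q j s).
  move=> q0 intq; split; last by move=> s _; exact: sumr_ge0.
  have intqT i : mu.-integrable `[0, T] (EFin \o q i).
    exact: integrableS (intq i).
  have := @integrable_sum _ _ _ mu _ (measurable_itv `[0, T]) _
    (index_enum 'I_n) xpredT _ (fun i _ => intqT i).
  by apply: eq_integrable => // x _; rewrite /= -sumEFin.
have d01 : flow_density T g01.
  by apply: densS => i; have [] := q01P i.
have d10 : flow_density T g10.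
  by apply: densS => i; have [] := q10P i.
have d12 : flow_density T g12.
  by split; [exact: integrableS int12|move=> s _; exact: g12_0].
have d21 : flow_density T g21.
  by split; [exact: integrableS int21|move=> s _; exact: g21_0].
have transp M tau q f Q A (C : R) : measurable_fun `[0, T[ tau ->
    (forall s, s \in `[0, T[ -> M s (tau s)) -> monotone_arrivals T M ->
    (forall s, 0 <= q s) -> mu.-integrable setT (EFin \o q) ->
    (forall t, t \in `[0, T] -> \int[mu]_(s in `[0, t]) q s = Q t) ->
    (forall s, s \in `[0, T] -> 0 <= f s) ->
    (forall t, t \in `[0, T] -> \int[mu]_(s in `[0, t]) f s = A t) ->
    increments_le T C Q -> arrives T M Q A -> transported_flow T tau q f.
  move=> mtau Mtau monM q0 intq qQ f0 fA lipQ [a1 a2 a3].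
  have T0T : T \in `[0, T] by rewrite in_itv/= lexx ltW.
  have sub s : s \in `[0, T[ -> s \in `[0, T].
    by rewrite !in_itv/= => /andP[-> /ltW].
  apply: (@arrives_transported_flow _ T M tau q f C) => //.
  - exact: integrableS intq.
  - move=> s t s0 st tT.
    have sI : s \in `[0, T] by rewrite in_itv/= s0 (le_trans st).
    have tI : t \in `[0, T] by rewrite in_itv/= tT (le_trans s0).
    by rewrite !qQ//; exact: lipQ.
  - split=> [s t sT tT H|s t sT tT H|t tT].
    + by rewrite qQ ?fA//; [exact: a1|exact: sub].
    + by rewrite qQ ?fA//; [exact: a2|exact: sub].
    + by rewrite qQ ?fA//; exact: a3.
(* The entering flow [g] is prescribed, so here the densities add up to it only almost everywhere;
   [tr_g] absorbs the difference. *)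
have g11 : {ae mu, forall s, s \in `[0, T] -> \sum_(j < 3) q11 j s = g s}.
  have d11 : flow_density T (fun s => \sum_(j < 3) q11 j s).
    by apply: densS => i; have [] := q11P i.
  apply: ae_eq_of_Rintegral; [exact: d11.1|exact: dens_g.1|].
  by move=> t tT; rewrite sum11.
have tr_g tau i f : measurable_fun `[0, T[ tau ->
    transported_flow T tau (q11 i) f ->
    transported_flow T tau (fun s => l11 i s * g s) f.
  move=> mtau tr t tT; rewrite tr//.
  set E := [set s | _].
  have mE : measurable E.
    have -> : E = `[0, T[ `&` tau @^-1` `]-oo, t[.
      by apply/seteqP; split => s /=; rewrite in_itv/= => /andP.
    exact: mtau.
  have ET : E `<=` `[0, T].
    by move=> s /andP[]; rewrite /= !in_itv/=; lra.
  apply: ae_eq_Rintegral => //.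
  - by have [_ /integrable_measurable mq _] := q11P i; exact: measurable_funTS.
  - apply: measurable_funM.
      by apply: measurable_funS ET _ => //; have [/(_ i)[]] := spl11.
    apply: measurable_funS ET _ => //.
    exact: integrable_measurable dens_g.1.
  - by apply: (ae_impl g11) => s H /ET sT; rewrite -(H sT) l11E.
have inc11 := split_mass_increments sp11 lipG.
have inc01' := split_mass_increments sp01 inc01.
have inc10' := split_mass_increments sp10 inc10.
split => //.
exists (SplitComponents l11 l01 l10 l100 l200); split => //.
exists g01, g10, g12, g21; split.
  exists tauS1, tauS2, tau12, tau21; split => //; split => /=.
  - apply: tr_g; first exact: selS1.1.
    have [q0 intq qQ] := q11P option2.
    by apply: transp selS1.1 selS1.2 monS1 q0 intq qQ d01.2 sum01 (inc11 _) trS1.1.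
  - apply: tr_g; first exact: selS2.1.
    have [q0 intq qQ] := q11P option3.
    by apply: transp selS2.1 selS2.2 monS2 q0 intq qQ d10.2 sum10 (inc11 _) trS2.1.
  - rewrite (_ : (fun s => _) = q01 option3); last by apply/funext.
    have [q0 intq qQ] := q01P option3.
    by apply: transp sel12.1 sel12.2 mon12 q0 intq qQ d12.2 g12E (inc01' _) tr12.1.
  - rewrite (_ : (fun s => _) = q10 option3); last by apply/funext.
    have [q0 intq qQ] := q10P option3.
    by apply: transp sel21.1 sel21.2 mon21 q0 intq qQ d21.2 g21E (inc10' _) tr21.1.
move=> t tT.
have sub : `[0, t]%classic `<=` `[0, T]%classic.
  by apply: subset_itvl; rewrite bnd_simp; move: tT; rewrite in_itv/= => /andP[].
have int f : flow_density T f -> mu.-integrable `[0, t] (EFin \o f).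
  by move=> [intf _]; exact: integrableS intf.
have tT' : 0 <= t <= T by rewrite in_itv in tT.
have [-> -> -> ->] := tot t tT'.
split.
- rewrite RintegralB//; [|exact: (integrableB _ (int _ dens_g) (int _ d01))|exact: int].
  by rewrite RintegralB//; [rewrite sum01 ?sum10|exact: int|exact: int].
- by rewrite RintegralB//; [rewrite sum01 ?g12E|exact: int|exact: int].
- by rewrite RintegralB//; [rewrite sum10 ?g21E|exact: int|exact: int].
- by rewrite RintegralD//; [rewrite g12E ?g21E|exact: int|exact: int].
Qed.

End Fixed.

End BalancePsi.

(** * Affine congestion costs *)

Section AffineCost.
Context {R : realType} (T : R).
Local Notation mu := (@lebesgue_measure R).

Definition lipschitz_with (k : R) (f : R -> R) : Prop :=
  forall s t, 0 <= s <= T -> 0 <= t <= T -> `|f s - f t| <= k * `|s - t|.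

Lemma klipschitz_with k f : k.-lipschitz_(`[0, T]) f <-> lipschitz_with k f.
Proof.
split=> [H s t sT tT|H [s t] [/= sT tT]].
  by apply: (H (s, t)); split; rewrite /= in_itv.
by apply: H; [move: sT|move: tT]; rewrite in_itv.
Qed.

Lemma lipschitz_integrable k f : lipschitz_with k f ->
  mu.-integrable `[0, T] (EFin \o f).
Proof.
move=> lipf; apply: continuous_compact_integrable; first exact: segment_compact.
have K0 : 0 < `|k| + 1 by rewrite ltr_wpDl.
apply/subspace_continuousP => x /=; rewrite in_itv/= => xT.
apply/cvgrPdist_le => e e0; rewrite near_withinE.
near=> y; rewrite /= in_itv/= => yT; apply: le_trans (lipf x y xT yT) _.
have : `|x - y| <= e / (`|k| + 1).
  near: y.
  by apply: (@cvgr_dist_le _ R^o _ _ _ id x) => //; rewrite divr_gt0.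
rewrite ler_pdivlMr// => h; apply: le_trans h.
by rewrite mulrC ler_wpM2l// (le_trans (ler_norm _))// lerDl.
Unshelve. all: by end_near. Qed.

Lemma Rintegral_increment (B : R) f : mu.-integrable `[0, T] (EFin \o f) ->
  (forall s, 0 <= s <= T -> f s <= B) ->
  increments_le T B (fun t => \int[mu]_(s in `[0, t]) f s).
Proof.
move=> intf fB s t s0 st tT; rewrite (Rintegral_itv0B intf)//.
have sub : `]s, t]%classic `<=` `[0, T]%classic.
  by move=> x /=; rewrite !in_itv/=; lra.
have mst : (mu `]s, t] = (t - s)%:E)%E.
  rewrite lebesgue_measure_itv/= lte_fin; case: ltP => // ts.
  by rewrite (_ : t = s) ?subrr//; apply/le_anti; rewrite st ts.
have -> : B * (t - s) = \int[mu]_(x in `]s, t]) (cst B x).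
  by rewrite Rintegral_cst//; congr (B * _); exact: (congr1 fine (esym mst)).
apply: le_Rintegral => //.
- exact: integrableS intf.
- have lipB : lipschitz_with 0 (cst B).
    by move=> x y _ _; rewrite /= subrr normr0 mul0r.
  exact: integrableS (lipschitz_integrable lipB).
- by move=> x /sub; rewrite /= in_itv; exact: fB.
Qed.

Lemma lipschitz_le k f : 0 <= T -> lipschitz_with k f ->
  forall s, 0 <= s <= T -> f s <= `|f 0| + `|k| * T.
Proof.
move=> T0 lipf s sT; have zT : 0 <= (0 : R) <= T by lra.
have := lipf s 0 sT zT; rewrite subr0 => h.
have : k * `|s| <= `|k| * T.
  rewrite (le_trans (ler_wpM2r _ (ler_norm k)))// ler_wpM2l//.
  by rewrite ger0_norm; lra.
have := ler_norm (f s - f 0); have := ler_norm (f 0).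
by lra.
Qed.

Definition cost_mass (F rho : by_label (R -> R)) : by_label (R -> R) :=
  fun w1 w2 t => \int[mu]_(s in `[0, t]) F w1 w2 (rho w1 w2 s).

Lemma cost_potential (F rho : by_label (R -> R)) (k : R) :
  (forall w1 w2, lipschitz_with k (F w1 w2 \o rho w1 w2)) ->
  (forall w1 w2 t, 0 <= t <= T -> 0 <= F w1 w2 (rho w1 w2 t)) ->
  potential T F rho (cost_mass F rho).
Proof.
move=> lipF F0.
have intF w1 w2 := lipschitz_integrable (lipF w1 w2).
have ndF w1 w2 := cumulative_mass_Rintegral (intF w1 w2).
split.
- by move=> w1 w2; rewrite /cost_mass set_itv1 Rintegral_set1.
- move=> w1 w2; have [|_] := ndF w1 w2; last exact.
  by apply: aeW => s; rewrite in_itv; exact: F0.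
- move=> w1 w2 t e tT e0.
  pose B := `|F w1 w2 (rho w1 w2 0)| + `|k| * T + 1.
  have T0 : 0 <= T by lra.
  have B0 : 0 < B by rewrite ltr_wpDl// addr_ge0// mulr_ge0.
  have FB s : 0 <= s <= T -> F w1 w2 (rho w1 w2 s) <= B.
    move=> sT; apply: le_trans (lipschitz_le T0 (lipF w1 w2) sT) _.
    by rewrite /B/= lerDl.
  have incF := Rintegral_increment (intF w1 w2) FB.
  have ndw : cumulative_mass T (cost_mass F rho w1 w2).
    by apply: ndF; apply: aeW => s; rewrite in_itv; exact: F0.
  exists (e / B); first by rewrite divr_gt0.
  have key x y : 0 <= x -> x <= y -> y <= T -> `|x - y| <= e / B ->
      `|cost_mass F rho w1 w2 x - cost_mass F rho w1 w2 y| <= e.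
    move=> x0 xy yT; rewrite distrC ger0_norm ?subr_ge0// ler_pdivlMr// => h.
    rewrite distrC ger0_norm ?subr_ge0; last by have [_] := ndw; exact.
    by rewrite (le_trans (incF x y x0 xy yT))// mulrC.
  move=> t' t'T; have [tt'|/ltW t't] := leP t t'.
    by apply: key; lra.
  by rewrite distrC => h; rewrite distrC; apply: key; lra.
- move=> w1 w2 s t s0 st tT; rewrite /congestion /cost_mass.
  rewrite (Rintegral_itv0B (intF w1 w2))// Rintegral_itv_obnd_cbnd; last first.
    apply: integrableS (intF w1 w2) => // x /=; rewrite !in_itv/=; lra.
  rewrite /Rintegral fineK//; apply: integrable_fin_num => //.
  by apply: integrableS (intF w1 w2) => // x /=; rewrite !in_itv/=; lra.
Qed.

Lemma cost_mass_dist (F rho F' rho' : by_label (R -> R)) (k k' e : R) w1 w2 :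
  lipschitz_with k (F w1 w2 \o rho w1 w2) ->
  lipschitz_with k' (F' w1 w2 \o rho' w1 w2) ->
  (forall t, 0 <= t <= T ->
    `|F w1 w2 (rho w1 w2 t) - F' w1 w2 (rho' w1 w2 t)| <= e) ->
  forall t, 0 <= t <= T ->
    `|cost_mass F rho w1 w2 t - cost_mass F' rho' w1 w2 t| <= e * T.
Proof.
move=> lipF lipF' close t /andP[t0 tT].
have intF := lipschitz_integrable lipF; have intF' := lipschitz_integrable lipF'.
have sub : `[0, t]%classic `<=` `[0, T]%classic.
  by apply: subset_itvl; rewrite bnd_simp.
have incr f : mu.-integrable `[0, T] (EFin \o f) ->
    (forall s, 0 <= s <= T -> f s <= e) ->
    \int[mu]_(s in `[0, t]) f s <= e * t.
  move=> intf fe; have := Rintegral_increment intf fe (lexx 0) t0 tT.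
  by rewrite set_itv1 Rintegral_set1 !subr0.
have e0 : 0 <= e.
  by rewrite (le_trans (normr_ge0 _) (close 0 _))// lexx (le_trans t0).
have eT : e * t <= e * T by rewrite ler_wpM2l.
have intB := @integrableB _ _ R mu _ (measurable_itv `[0, T]) _ _ intF intF'.
have intB' := @integrableB _ _ R mu _ (measurable_itv `[0, T]) _ _ intF' intF.
have intt f : mu.-integrable `[0, T] (EFin \o f) -> mu.-integrable `[0, t] (EFin \o f).
  exact: integrableS.
rewrite /cost_mass ler_norml lerNl opprB -!RintegralB//; try exact: intt.
apply/andP; split; apply: le_trans eT; apply: incr => // s /close;
  by rewrite ler_norml => /andP[? ?]; rewrite /=; lra.
Qed.

End AffineCost.

(** Compactness in near-covering form: pointwise convergence at [x] extends to a ball whose radius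
    depends only on [L] and [e]. Two Lipschitz displacements and the error at [x] account for the
    three thirds of [e]. *)
Lemma lipschitz_uniform_cvg (R : realType) (T L : R) (U : set_system nat)
    (f_ : nat -> R -> R) (f : R -> R) : Filter U -> 0 <= L ->
  (forall n, lipschitz_with T L (f_ n)) -> lipschitz_with T L f ->
  (forall t, 0 <= t <= T -> f_ ^~ t @ U --> f t) ->
  forall e : R, 0 < e -> \forall n \near U, forall t, 0 <= t <= T ->
    `|f_ n t - f t| <= e.
Proof.
move=> FU L0 lip_ lip cvgf e e0.
have L1 : 0 < L + 1 by rewrite ltr_wpDl.
have e3 : 0 < e / 3 by rewrite divr_gt0.
have cT : compact (`[0, T]%classic : set R) by exact: segment_compact.
move: cT => /compact_near_coveringP/near_covering_withinP.
move=> /(_ nat U (fun n t => `|f_ n t - f t| <= e) FU) H.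
have : \forall n \near U, `[0, T]%classic `<=` (fun t => `|f_ n t - f t| <= e).
  apply: H => x; rewrite /= in_itv/= => xT.
  exists (ball x (e / 3 / (L + 1)), [set n | `|f_ n x - f x| <= e / 3]).
    split; first by apply/nbhs_ballP; exists (e / 3 / (L + 1)) => //=; rewrite divr_gt0.
    by have /cvgrPdistC_le := cvgf x xT; apply.
  move=> [y n] /= [xy fx]; rewrite in_itv/= => yT.
  have xy' : L * `|x - y| <= e / 3.
    have : `|x - y| <= e / 3 / (L + 1) by exact: ltW xy.
    rewrite ler_pdivlMr// => h; apply: le_trans h.
    by rewrite mulrC ler_wpM2l// lerDl.
  have := lip x y xT yT; have := lip_ n x y xT yT.
  by move: fx; rewrite !ler_norml; lra.
by apply: filterS => n Hn t tT; apply: Hn; rewrite /= in_itv.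
Qed.

(** * Limits of equilibria and existence of an optimal pair *)

Section Main.
Context {R : realType} (T thS th1 th2 c1 c2 cS : R) (g : R -> R) (L : R).
Hypotheses (T0 : 0 < T) (hth1 : 0 < th1) (hth1S : th1 < thS)
  (hthS2 : thS < th2) (hth2 : th2 < 2 * pi) (hc1 : 0 < c1) (hc2 : 0 < c2)
  (hcS : 0 < cS) (L0 : 0 <= L) (dens_g : flow_density T g).
Local Notation K := (entered_mass T g).

(** Each mass is bounded by the departures that feed it, and so, back along the route, by the mass
    entered at the station. These bounds make all masses converge along an ultrafilter. *)
Lemma masses_le F rho m : mass_balance T thS th1 th2 c1 c2 cS g F rho m ->
  forall t, 0 <= t <= T ->
  [/\ 0 <= mass_in_01 m t <= K, 0 <= mass_in_10 m t <= K,
      0 <= mass_in_12 m t <= K & 0 <= mass_in_21 m t <= K] /\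
  forall i, [/\ 0 <= mass_out_11 m i t <= K, 0 <= mass_out_01 m i t <= K &
                0 <= mass_out_10 m i t <= K].
Proof.
move=> [[[q11 s11 _] [q01 s01 _] [q10 s10 _]]
  [[[_ _ l01] _] [[_ _ l10] _] [[_ _ l12] _] [[_ _ l21] _]]
  [a01 a10 a12 a21] _] t tT.
have T0T : 0 <= T <= T by rewrite lexx ltW.
have acc0 A : cumulative_mass T A -> 0 <= A t.
  by case/andP: tT => t0 tT [A0 ndA]; rewrite -A0; exact: ndA.
have accT A : cumulative_mass T A -> A t <= A T.
  by case/andP: tT => t0 tT [A0 ndA]; exact: ndA.
have part (Q : 'I_3 -> R -> R) i u : 0 <= u <= T ->
    (forall j, cumulative_mass T (Q j)) -> Q i u <= \sum_(j < 3) Q j u.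
  move=> /andP[u0 uT] accQ; rewrite (bigD1 i)//= lerDl; apply: sumr_ge0 => j _.
  by have [Q0 ndQ] := accQ j; rewrite -Q0; exact: ndQ.
have tI : t \in `[0, T] by rewrite in_itv.
have Q11 i u : 0 <= u <= T -> mass_out_11 m i u <= K.
  move=> uT; rewrite -[K]/(mass_entered g T) -s11//.
  apply: le_trans (part _ i _ T0T q11).
  by case/andP: uT => u0 uT; have [_] := q11 i; exact.
have b01 : mass_in_01 m t <= K by rewrite (le_trans (l01 t tI))// Q11.
have b10 : mass_in_10 m t <= K by rewrite (le_trans (l10 t tI))// Q11.
have TI : T \in `[0, T] by rewrite in_itv.
have Q01 i u : 0 <= u <= T -> mass_out_01 m i u <= K.
  move=> uT; apply: (@le_trans _ _ (mass_in_01 m T)).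
    rewrite -s01//; apply: le_trans (part _ i _ T0T q01).
    by case/andP: uT => u0 uT; have [_] := q01 i; exact.
  by rewrite (le_trans (l01 T TI))// Q11.
have Q10 i u : 0 <= u <= T -> mass_out_10 m i u <= K.
  move=> uT; apply: (@le_trans _ _ (mass_in_10 m T)).
    rewrite -s10//; apply: le_trans (part _ i _ T0T q10).
    by case/andP: uT => u0 uT; have [_] := q10 i; exact.
  by rewrite (le_trans (l10 T TI))// Q11.
split; last by move=> i; rewrite !acc0//= Q11// Q01// Q10.
rewrite !acc0//= b01 b10 (le_trans (l12 t tI)) ?Q01//.
by rewrite (le_trans (l21 t tI)) ?Q10.
Qed.

Lemma affine_cost_lipschitz (ab : 'rV[R]_4 * 'rV[R]_4) rho : mass_space T g L rho ->
  forall w1 w2, lipschitz_with T (`|ab.1 ord0 (coord w1 w2)| * L)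
    (affine_cost ab w1 w2 \o rho w1 w2).
Proof.
move=> Xrho w1 w2 s t sT tT; have [_ /klipschitz_with lip _] := Xrho w1 w2.
rewrite /= /affine_cost opprD addrACA subrr addr0 -mulrBr normrM -mulrA.
by rewrite ler_wpM2l//; exact: lip.
Qed.

Lemma affine_cost_potential (ab : 'rV[R]_4 * 'rV[R]_4) rho : mass_space T g L rho ->
  (forall (w1 w2 : bool) r, r \in `[0, K] -> 0 <= affine_cost ab w1 w2 r) ->
  potential T (affine_cost ab) rho (cost_mass (affine_cost ab) rho).
Proof.
(* Summing over the coordinates gives one Lipschitz constant for the four labels. *)
move=> Xrho pos; pose k := \sum_(j < 4) `|ab.1 ord0 j| * L.
apply: (@cost_potential _ _ _ _ k).
  move=> w1 w2 s t sT tT.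
  apply: le_trans (affine_cost_lipschitz ab Xrho w1 w2 sT tT) _.
  rewrite ler_wpM2r// /k (bigD1 (coord w1 w2))//= lerDl; apply: sumr_ge0 => j _.
  exact: mulr_ge0.
move=> w1 w2 t tT; apply: pos; have [p _ b] := Xrho w1 w2.
have tI : t \in `[0, T] by rewrite in_itv.
by rewrite in_itv/= p//= (le_trans (ler_norm _))// b.
Qed.

Section Limit.
Context (U : set_system nat) {UU : UltraFilter U}.
Variables (ab_ : nat -> 'rV[R]_4 * 'rV[R]_4) (ab : 'rV[R]_4 * 'rV[R]_4).
Hypothesis ab_lim : ab_ @ U --> ab.

Let cvg_coef w1 w2 :
  (fun n => (ab_ n).1 ord0 (coord w1 w2)) @ U --> ab.1 ord0 (coord w1 w2) /\
  (fun n => (ab_ n).2 ord0 (coord w1 w2)) @ U --> ab.2 ord0 (coord w1 w2).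
Proof.
split.
- have h : (fun n => (ab_ n).1) @ U --> ab.1 by apply: cvg_comp ab_lim _; exact: cvg_fst.
  exact: (cvg_comp _ _ h (@coord_continuous _ _ _ ord0 (coord w1 w2) ab.1)).
- have h : (fun n => (ab_ n).2) @ U --> ab.2 by apply: cvg_comp ab_lim _; exact: cvg_snd.
  exact: (cvg_comp _ _ h (@coord_continuous _ _ _ ord0 (coord w1 w2) ab.2)).
Qed.

Lemma affine_cost_cvg (rho_ : nat -> by_label (R -> R)) rho w1 w2 :
  (forall n, mass_space T g L (rho_ n)) -> mass_space T g L rho ->
  (forall t, 0 <= t <= T -> (fun n => rho_ n w1 w2 t) @ U --> rho w1 w2 t) ->
  forall e : R, 0 < e -> \forall n \near U, forall t, 0 <= t <= T ->
    `|affine_cost (ab_ n) w1 w2 (rho_ n w1 w2 t) -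
      affine_cost ab w1 w2 (rho w1 w2 t)| <= e.
Proof.
move=> Xrho_ Xrho rholim e e0.
pose a_ n : R := (ab_ n).1 ord0 (coord w1 w2).
pose b_ n : R := (ab_ n).2 ord0 (coord w1 w2).
pose a : R := ab.1 ord0 (coord w1 w2); pose b : R := ab.2 ord0 (coord w1 w2).
have ca : a_ @ U --> a by have [] := cvg_coef w1 w2.
have cb : b_ @ U --> b by have [] := cvg_coef w1 w2.
have K0 : 0 <= K.
  have [p _ bd] := Xrho w1 w2; have z : 0 \in `[0, T] by rewrite in_itv/= lexx ltW.
  by rewrite (le_trans (normr_ge0 _) (bd 0 z)).
have e3 : 0 < e / 3 by rewrite divr_gt0.
have eK : 0 < e / 3 / (K + 1) by rewrite divr_gt0// ltr_wpDl.
have ea : 0 < e / 3 / (`|a| + 1) by rewrite divr_gt0// ltr_wpDl.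
have lip_ n : lipschitz_with T L (rho_ n w1 w2).
  by apply/klipschitz_with; have [_ + _] := Xrho_ n w1 w2.
have lip : lipschitz_with T L (rho w1 w2).
  by apply/klipschitz_with; have [_ + _] := Xrho w1 w2.
have unif := lipschitz_uniform_cvg _ L0 lip_ lip rholim ea.
have /cvgrPdistC_le/(_ _ eK) na := ca.
have /cvgrPdistC_le/(_ _ e3) nb := cb.
near=> n.
have han : `|a_ n - a| <= e / 3 / (K + 1) by near: n.
have hbn : `|b_ n - b| <= e / 3 by near: n.
have hrn : forall t, 0 <= t <= T ->
    `|rho_ n w1 w2 t - rho w1 w2 t| <= e / 3 / (`|a| + 1).
  by near: n; exact: unif.
move=> t tT; have tI : t \in `[0, T] by rewrite in_itv.
have [_ _ bd] := Xrho_ n w1 w2.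
have frac (x k : R) : 0 < x -> 0 <= k -> x / (k + 1) * k <= x.
  move=> x0 k0; rewrite mulrAC ler_pdivrMr ?ltr_wpDl//.
  by rewrite ler_wpM2l ?lerDl// ltW.
have h1 : `|(a_ n - a) * rho_ n w1 w2 t| <= e / 3.
  rewrite normrM; apply: le_trans (frac _ _ e3 K0).
  by apply: ler_pM => //; exact: bd.
have h2 : `|a * (rho_ n w1 w2 t - rho w1 w2 t)| <= e / 3.
  rewrite normrM mulrC; apply: le_trans (frac _ _ e3 (normr_ge0 a)).
  by apply: ler_pM => //; exact: hrn.
rewrite /affine_cost -/(a_ n) -/(b_ n) -/a -/b.
have -> : a_ n * rho_ n w1 w2 t + b_ n - (a * rho w1 w2 t + b) =
  (a_ n - a) * rho_ n w1 w2 t + a * (rho_ n w1 w2 t - rho w1 w2 t) + (b_ n - b).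
  by ring.
by move: h1 h2 hbn; rewrite !ler_norml; lra.
Unshelve. all: by end_near. Qed.

Hypothesis pos_ : forall n (w1 w2 : bool) r, r \in `[0, K] ->
  0 <= affine_cost (ab_ n) w1 w2 r.
Hypothesis pos : forall (w1 w2 : bool) r, r \in `[0, K] ->
  0 <= affine_cost ab w1 w2 r.

Lemma equilibria_lim (G : R) (rho_ : nat -> by_label (R -> R)) :
  0 <= G -> increments_le T G (mass_entered g) ->
  (forall n, equilibria T thS th1 th2 c1 c2 cS g L (affine_cost (ab_ n)) (rho_ n)) ->
  exists2 rho : by_label (R -> R),
    equilibria T thS th1 th2 c1 c2 cS g L (affine_cost ab) rho &
    forall w1 w2 t, 0 <= t <= T -> (fun n => rho_ n w1 w2 t) @ U --> rho w1 w2 t.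
Proof.
move=> G0 lipG eq_.
have Xrho_ n : mass_space T g L (rho_ n) by have [] := eq_ n.
have ulim (u : nat -> R) : (forall n, 0 <= u n <= K) -> u @ U --> lim (u @ U).
  by move=> uK; apply/cvg_ex; exact: ultra_bounded_cvg uK.
(* Convergence is established on [[0, T]] only; the values of this [lim] elsewhere are arbitrary. *)
pose rho : by_label (R -> R) :=
  fun w1 w2 t => lim ((fun n => rho_ n w1 w2 t) @ U).
have rholim w1 w2 t : 0 <= t <= T ->
    (fun n => rho_ n w1 w2 t) @ U --> rho w1 w2 t.
  move=> tT; apply: ulim => n; have [p _ b] := Xrho_ n w1 w2.
  have tI : t \in `[0, T] by rewrite in_itv.
  by rewrite p//= (le_trans (ler_norm _))// b.
have Xrho : mass_space T g L rho.
  move=> w1 w2; split.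
  - move=> t tI; have tT : 0 <= t <= T by rewrite in_itv in tI.
    apply: (cvgr_to_ge (rholim w1 w2 t tT)); apply: nearW => n.
    by have [p _ _] := Xrho_ n w1 w2; exact: p.
  - apply/klipschitz_with => s t sT tT.
    apply: (cvgr_to_le (cvg_norm (cvgB (rholim w1 w2 s sT) (rholim w1 w2 t tT)))).
    apply: nearW => n; have [_ /klipschitz_with lip _] := Xrho_ n w1 w2.
    exact: lip.
  - move=> t tI; have tT : 0 <= t <= T by rewrite in_itv in tI.
    apply: (cvgr_to_le (cvg_norm (rholim w1 w2 t tT))).
    by apply: nearW => n; have [_ _ b] := Xrho_ n w1 w2; exact: b.
exists rho => //; split => //.
have pot_ n := affine_cost_potential (Xrho_ n) (pos_ n).
have pot := affine_cost_potential Xrho pos.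
have /choice[m_ mP] : forall n, exists m : masses,
    mass_balance T thS th1 th2 c1 c2 cS g (affine_cost (ab_ n)) (rho_ n) m.
  move=> n; have [_ psi_n] := eq_ n.
  have [m mP] := psi_mass_balance T0 hth1 hth1S hthS2 hth2 hc1 hc2 hcS dens_g
    (pot_ n) psi_n.
  by exists m.
pose m := Masses (fun t => lim ((fun n => mass_in_01 (m_ n) t) @ U))
  (fun t => lim ((fun n => mass_in_10 (m_ n) t) @ U))
  (fun t => lim ((fun n => mass_in_12 (m_ n) t) @ U))
  (fun t => lim ((fun n => mass_in_21 (m_ n) t) @ U))
  (fun i t => lim ((fun n => mass_out_11 (m_ n) i t) @ U))
  (fun i t => lim ((fun n => mass_out_01 (m_ n) i t) @ U))
  (fun i t => lim ((fun n => mass_out_10 (m_ n) i t) @ U)).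
have lip w1 w2 s t : 0 <= s -> s <= t -> t <= T ->
    `|rho w1 w2 t - rho w1 w2 s| <= L * (t - s).
  move=> s0 st tT; have [_ /klipschitz_with lipr _] := Xrho w1 w2.
  rewrite -[X in L * X]ger0_norm ?subr_ge0//; apply: lipr; lra.
apply: (mass_balance_psi T0 hth1 hth1S hthS2 hth2 hc1 hc2 hcS dens_g pot G0 L0
  Xrho lip lipG (m := m)).
apply: (mass_balance_lim T0 hth1 hth1S hthS2 hth2 hc1 hc2 hcS pot_ pot _ G0 L0
  lip lipG mP rholim).
- move=> e e0.
  (* An error [e / T] on the cost integrates to at most [e] on the potential. *)
  have eT : 0 < e / T by rewrite divr_gt0.
  have near_w w1 w2 : \forall n \near U, forall t, 0 <= t <= T ->
      `|cost_mass (affine_cost (ab_ n)) (rho_ n) w1 w2 t -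
        cost_mass (affine_cost ab) rho w1 w2 t| <= e.
    apply: filterS (affine_cost_cvg (w1 := w1) (w2 := w2) Xrho_ Xrho (rholim _ _) eT).
    move=> n close t tT; rewrite -[leRHS](divfK (lt0r_neq0 T0)).
    exact: (cost_mass_dist (affine_cost_lipschitz _ (Xrho_ n) _ _)
      (affine_cost_lipschitz _ Xrho _ _) close tT).
  near=> n => w1 w2.
  by case: w1; case: w2; near: n; exact: near_w.
- move=> t tT; split; apply: ulim => n.
  + by have [[]] := masses_le (mP n) tT.
  + by have [[]] := masses_le (mP n) tT.
  + by have [[]] := masses_le (mP n) tT.
  + by have [[]] := masses_le (mP n) tT.
- move=> i t tT; split; apply: ulim => n.
  + by have [_ /(_ i)[]] := masses_le (mP n) tT.
  + by have [_ /(_ i)[]] := masses_le (mP n) tT.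
  + by have [_ /(_ i)[]] := masses_le (mP n) tT.
Unshelve. all: by end_near. Qed.

End Limit.

End Main.

(** Membership in the space bounds the differences, so that the [sup] in [distX] is a genuine upper
    bound. *)
Lemma le_distX (R : realType) (T : R) (g : R -> R) (L : R)
    (rho rhobar : by_label (R -> R)) w1 w2 t :
  mass_space T g L rho -> mass_space T g L rhobar -> t \in `[0, T] ->
  `|rho w1 w2 t - rhobar w1 w2 t| <= distX T rho rhobar.
Proof.
move=> Xrho Xrhobar tT.
apply: (@le_trans _ _
  (sup [set `|rho w1 w2 t - rhobar w1 w2 t| | t in `[0, T]])).
  apply: ub_le_sup; last by exists t.
  exists (entered_mass T g + entered_mass T g) => _ [s sT <-].
  have [_ _ b] := Xrho w1 w2; have [_ _ b'] := Xrhobar w1 w2.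
  by rewrite (le_trans (ler_normB _ _))// lerD ?b ?b'.
exact: (@le_bigmax _ _ _ 0 (fun w : bool * bool =>
  sup [set `|rho w.1 w.2 t - rhobar w.1 w.2 t| | t in `[0, T]]) (w1, w2)).
Qed.

Lemma distX_le (R : realType) (T r : R) (rho rhobar : by_label (R -> R)) :
  0 <= T -> 0 <= r ->
  (forall w1 w2 t, t \in `[0, T] -> `|rho w1 w2 t - rhobar w1 w2 t| <= r) ->
  distX T rho rhobar <= r.
Proof.
move=> T0 r0 H; apply: bigmax_le => // w _; apply: ge_sup.
  by exists `|rho w.1 w.2 0 - rhobar w.1 w.2 0|, 0 => //=; rewrite in_itv/= lexx.
by move=> _ [t tT <-]; exact: H.
Qed.

Theorem theorem3 (R : realType) (T thS th1 th2 c1 c2 cS : R) (g : R -> R)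
    (Kset : set ('rV[R]_4 * 'rV[R]_4)) (L : R) (rhobar : by_label (R -> R))
    (hT : 0 < T)
    (hth1 : 0 < th1) (hth1S : th1 < thS) (hthS2 : thS < th2)
    (hth2 : th2 < 2 * pi)
    (hc1 : 0 < c1) (hc2 : 0 < c2) (hcS : 0 < cS)
    (hg0 : forall t, t \in `[0, T] -> 0 <= g t)
    (hglip : [lipschitz g t | t in `[0, T]])
    (hKne : Kset !=set0) (hKcompact : compact Kset)
    (hKpos : forall ab, Kset ab -> forall (w1 w2 : bool) (r : R),
       r \in `[0, entered_mass T g] -> 0 <= affine_cost ab w1 w2 r)
    (hL : 0 <= L)
    (hrhobar : mass_space T g L rhobar) :
  exists ab, Kset ab /\
    error T thS th1 th2 c1 c2 cS g L rhobar ab =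
    ereal_inf [set error T thS th1 th2 c1 c2 cS g L rhobar ab' | ab' in Kset].
Proof.
have [k /(klipschitz_with T k g) lipg] : exists k, k.-lipschitz_(`[0, T]) g.
  by move: hglip; rewrite /lipschitz_on => /filter_ex.
have dens_g : flow_density T g by split=> //; exact: lipschitz_integrable lipg.
pose G := `|g 0| + `|k| * T.
have G0 : 0 <= G by rewrite addr_ge0// mulr_ge0// ltW.
have lipG : increments_le T G (mass_entered g).
  apply: Rintegral_increment dens_g.1 _ => s sT.
  exact: (lipschitz_le (ltW hT) lipg sT).
set err := error _ _ _ _ _ _ _ _ _ _; set E := ereal_inf _.
have err_ge0 ab : (0 <= err ab)%E.
  apply: le_ereal_inf_tmp => _ [rho _ <-].
  by rewrite lee_fin; exact: bigmax_ge_id.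
have E_le ab : Kset ab -> (E <= err ab)%E.
  by move=> Kab; apply: ereal_inf_lbound; exists ab.
(* An infinite infimum means that every parameter has infinite error, so any element of [Kset] is
   optimal. *)
have [Eoo|Efin] := eqVneq E +oo%E.
  have [ab Kab] := hKne; exists ab; split => //.
  by apply/le_anti; rewrite E_le// Eoo leey.
have E0 : (0 <= E)%E by apply: le_ereal_inf_tmp => _ [ab _ <-].
pose r := fine E.
have Er : E = r%:E by rewrite fineK// ge0_fin_numE// ltey.
have r0 : 0 <= r by rewrite -lee_fin -Er.
(* A strict bound on [E] passes through both infima, over the parameters and over the equilibria,
   and produces a pair at once. *)
have /choice[x_ xP] : forall n, exists x : ('rV[R]_4 * 'rV[R]_4) * by_label (R -> R),
    [/\ Kset x.1, equilibria T thS th1 th2 c1 c2 cS g L (affine_cost x.1) x.2 &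
        distX T x.2 rhobar < r + n.+1%:R^-1].
  move=> n.
  have En : (E < (r + n.+1%:R^-1)%:E)%E by rewrite Er lte_fin ltrDl invr_gt0.
  have [_ [ab Kab <-] /ereal_inf_lt[_ [rho eqrho <-]]] := ereal_inf_lt En.
  by rewrite lte_fin => lt_n; exists (ab, rho).
(* [U] refines the filter of large indices, so what holds for all large [n] holds along [U]. *)
have [U [UU ooU]] := ultraFilterLemma (@eventually_filter).
have [|ab Kab abU] := ultra_compact_cvg (x_ := fun n => (x_ n).1) UU hKcompact.
  by move=> n; have [] := xP n.
have eq_ n : equilibria T thS th1 th2 c1 c2 cS g L (affine_cost (x_ n).1) (x_ n).2.
  by have [] := xP n.
have pos_ n (w1 w2 : bool) s : s \in `[0, entered_mass T g] ->
    0 <= affine_cost (x_ n).1 w1 w2 s.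
  by apply: hKpos; have [] := xP n.
have [rho eqrho rholim] := equilibria_lim hT hth1 hth1S hthS2 hth2 hc1 hc2 hcS hL
  dens_g abU pos_ (hKpos _ Kab) G0 lipG eq_.
exists ab; split => //; apply/le_anti/andP; split; last exact: E_le.
(* The limit [rho] competes in the infimum defining [err ab]. Its distance to [rhobar] is at most
   [r], since each pointwise difference is a limit of differences below [r + n.+1%:R^-1]. *)
apply: (@le_trans _ _ (distX T rho rhobar)%:E).
  by apply: ereal_inf_lbound; exists rho.
rewrite Er lee_fin; apply: distX_le => // [|w1 w2 t tI]; first exact: ltW.
have tT : 0 <= t <= T by rewrite in_itv in tI.
apply/ler_addgt0Pr => e e0.
apply: (cvgr_to_le (cvg_norm (cvgB (rholim w1 w2 t tT) (cvg_cst (rhobar w1 w2 t))))).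
apply: ooU; near=> n.
have [_ [Xn _] /ltW dn] := xP n.
apply: le_trans (le_distX w1 w2 Xn hrhobar tI) _.
apply: le_trans dn _; rewrite lerD2l ltW//.
by near: n; exact: near_infty_natSinv_lt (PosNum e0).
Unshelve. all: by end_near. Qed.
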